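(* Let $(\mathfrak g_1,\mathfrak h_1,\kappa_1)$ and $(\mathfrak g_2,\mathfrak h_2,\kappa_2)$ be coral locally affine Lie algebras over a field $\mathbb K$ of characteristic zero, with root systems $\Delta_1,\Delta_2$, sets of integrable roots $\Delta_{1,i},\Delta_{2,i}$ and $V_j:=\operatorname{span}_{\mathbb Q}\Delta_{j,i}$. If $\psi:V_1\to V_2$ is an isomorphism of the locally affine root systems, i.e. a $\mathbb Q$-linear isomorphism with $\psi(\Delta_{1,i})=\Delta_{2,i}$ (so that also $\psi(\Delta_1)=\Delta_2$), then there exists an isomorphism of Lie algebras between the cores $$\phi:(\mathfrak g_1)_c\to(\mathfrak g_2)_c\quad\text{with}\quad \phi(\mathfrak g_{1,\alpha})=\mathfrak g_{2,\psi(\alpha)}\quad\text{for all }\alpha\in\Delta_1.$$ If $\mathcal B\subseteq\Delta_{1,i}$ is an integral base, and $0\ne x_\alpha\in\mathfrak g_{1,\alpha}$, $0\neq y_\alpha\in\mathfrak g_{2,\psi(\alpha)}$ are given for $\alpha\in\mathcal B$, then there exists a unique such $\phi$ with $\phi(x_\alpha)=y_\alpha$ for all $\alpha\in\mathcal B$.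
   Context: $\mathbb K$ is a field of characteristic zero. A split Lie algebra is a pair $(\mathfrak g,\mathfrak h)$ where $\mathfrak h$ is a maximal abelian subalgebra of the $\mathbb K$-Lie algebra $\mathfrak g$ with $\operatorname{ad}\mathfrak h$ simultaneously diagonalizable. Put $\mathfrak g_\alpha=\{x\in\mathfrak g:[h,x]=\alpha(h)x\ \forall h\in\mathfrak h\}$ (so $\mathfrak g_0=\mathfrak h$) and $\Delta=\{\alpha\in\mathfrak h^*\setminus\{0\}:\mathfrak g_\alpha\ne\{0\}\}$. A root $\alpha$ is integrable if there exist $x_{\pm\alpha}\in\mathfrak g_{\pm\alpha}$ with $\alpha([x_\alpha,x_{-\alpha}])\neq0$ and $\operatorname{ad}x_{\pm\alpha}$ locally nilpotent; then $\dim\mathfrak g_{\pm\alpha}=1$ and the coroot $\check\alpha$ is the unique element of $[\mathfrak g_\alpha,\mathfrak g_{-\alpha}]$ with $\alpha(\check\alpha)=2$. $\Delta_i$ is the set of integrable roots; $\mathfrak g(\alpha)=\mathbb K\check\alpha+\mathfrak g_\alpha+\mathfrak g_{-\alpha}$. The core $\mathfrak g_c$ is the subalgebra generated by all $\mathfrak g(\alpha)$, $\alpha\in\Delta_i$. $\Delta_i$ is connected if any $\alpha,\beta\in\Delta_i$ are joined by a chain $\alpha=\alpha_0,\dots,\alpha_n=\beta$ in $\Delta_i$ with $\alpha_{j+1}(\check\alpha_j)\ne0$. A split quadratic Lie algebra $(\mathfrak g,\mathfrak h,\kappa)$ is a split Lie algebra with a non-degenerate invariant symmetric bilinear form $\kappa$.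 The map $\flat:\mathfrak h\to\mathfrak h^*$, $h^\flat(x)=\kappa(x,h)$, is injective with $\Delta\subseteq\flat(\mathfrak h)$; put $\alpha^\sharp=\flat^{-1}(\alpha)$ and $(\alpha,\beta)=\kappa(\alpha^\sharp,\beta^\sharp)$. A LEALA is a split quadratic Lie algebra for which $\Delta_i$ is connected and every $\alpha\in\Delta$ with $(\alpha,\alpha)\ne0$ is integrable. Standing normalization: $(\alpha,\alpha)\in\mathbb Q$, $(\alpha,\alpha)>0$ for all $\alpha\in\Delta_i$. Let $V$ be a rational vector space with positive semidefinite bilinear form $(\cdot,\cdot)$ and $\mathcal R\subseteq V$. $(V,\mathcal R)$ is a locally affine root system if: (A1) $(\alpha,\alpha)\ne0$ for $\alpha\in\mathcal R$ and $\operatorname{span}\mathcal R=V$; (A2) $\langle\beta,\alpha\rangle:=2(\alpha,\beta)/(\alpha,\alpha)\in\mathbb Z$ for $\alpha,\beta\in\mathcal R$; (A3) $\beta-\langle\beta,\alpha\rangle\alpha\in\mathcal R$ for $\alpha,\beta\in\mathcal R$; (A4) if $\mathcal R=\mathcal R_1\cup\mathcal R_2$ with $(\mathcal R_1,\mathcal R_2)\subseteq\{0\}$, then $\mathcal R_1$ or $\mathcal R_2$ is empty; (A5) $V^0=\{v:(v,V)=\{0\}\}$ intersects $\operatorname{span}_{\mathbb Z}\mathcal R$ in a non-trivial cyclic group. A coral locally affine Lie algebra is a LEALA with $\mathfrak g=\mathfrak h+\mathfrak g_c$ such that $\Delta_i$ is a locally affine root system in $V=\operatorname{span}_{\mathbb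 Q}\Delta_i$ and $\Delta\ne\Delta_i$. In such an algebra, $\Delta\setminus\Delta_i=\mathbb Z\delta\setminus\{0\}$ for a generator $\delta$ of $V^0\cap\operatorname{span}_{\mathbb Z}\Delta_i$, and all root spaces lie in $\mathfrak g_c$. An integral base is a linearly independent subset $\mathcal B\subseteq\Delta_i$ with $\Delta\subseteq\operatorname{span}_{\mathbb Z}\mathcal B$. *)

(* Defs.v *)
From HB Require Import structures.
From mathcomp Require Import all_boot all_order all_algebra.
From mathcomp Require Import boolp classical_sets functions.

Set Implicit Arguments.
Unset Strict Implicit.
Unset Printing Implicit Defensive.

Import Order.TTheory GRing.Theory Num.Theory.
Local Open Scope classical_set_scope.
Local Open Scope ring_scope.

Section Submodules.
Variables (R : nzRingType) (V : lmodType R).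

Record submod (S : submodClosed V) : Type :=
  Submod { submod_val :> V; _ : submod_val \in S }.

HB.instance Definition _ S := [isSub for @submod_val S].
HB.instance Definition _ S := [Choice of submod S by <:].
HB.instance Definition _ S := [SubChoice_isSubLmodule of submod S by <:].

Definition lin_span (A : set V) : {pred V} := fun x =>
  `[< exists (n : nat) (c : 'I_n -> R) (v : 'I_n -> V),
        (forall i, A (v i)) /\ x = \sum_i c i *: v i >].

Fact lin_span_closed A : submod_closed (lin_span A).
Proof.
split; first by apply/asboolP; exists 0%N, (fun=> 0), (fun=> 0);
  split; [case | rewrite big_ord0].
move=> a x y /asboolP[n [c [v [Av ->]]]] /asboolP[m [d [w [Aw ->]]]].
apply/asboolP; exists (n + m)%N.
exists (fun i => match fintype.split i with inl j => a * c j | inr j => d j end).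
exists (fun i => match fintype.split i with inl j => v j | inr j => w j end).
split=> [i|]; first by case: (fintype.split i).
rewrite big_split_ord scaler_sumr; congr (_ + _); apply: eq_bigr => i _.
  by rewrite -[lshift _ _]/(unsplit (inl _)) unsplitK scalerA.
by rewrite -[rshift _ _]/(unsplit (inr _)) unsplitK.
Qed.

HB.instance Definition _ A :=
  GRing.isSubmodClosed.Build R V (lin_span A)
    (GRing.submod_closed_semi (lin_span_closed A)).

Definition lin_indep (A : set V) : Prop :=
  forall (n : nat) (v : 'I_n -> V) (c : 'I_n -> R),
    injective v -> (forall i, A (v i)) ->
    \sum_i c i *: v i = 0 -> forall i, c i = 0.

End Submodules.

Definition int_span (V : zmodType) (A : set V) : set V := [set x |
  exists (n : nat) (z : 'I_n -> int) (v : 'I_n -> V),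
    (forall i, A (v i)) /\ x = \sum_i v i *~ z i].

(* [f x = y] and [f @` A = B] for a map f between the submodules S and T,
   where x, y, A and B live in the ambient modules. *)
Definition sub_maps (R1 R2 : nzRingType) (V : lmodType R1) (W : lmodType R2)
    (S : submodClosed V) (T : submodClosed W) (f : submod S -> submod T)
    (x : V) (y : W) : Prop :=
  exists a : submod S, \val a = x /\ \val (f a) = y.

Definition sub_image (R1 R2 : nzRingType) (V : lmodType R1) (W : lmodType R2)
    (S : submodClosed V) (T : submodClosed W) (f : submod S -> submod T)
    (A : set V) (B : set W) : Prop :=
  (forall x, A x -> x \in S) /\
  [set y | exists2 x, A x & sub_maps f x y] = B.

Section Dual.
Variables (K : fieldType) (M : lmodType K).

Definition linear_form : {pred M -> K^o} := fun f => `[< scalar f >].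

Fact linear_form_closed : submod_closed linear_form.
Proof.
split; first by apply/asboolP => a x y; rewrite mulr0 addr0.
move=> b f g /asboolP lf /asboolP lg; apply/asboolP => a x y.
have E z : (b *: f + g) z = b * f z + g z by [].
rewrite !E lf lg !mulrDr mulrCA !mulrA; exact: addrACA.
Qed.

HB.instance Definition _ :=
  GRing.isSubmodClosed.Build K (M -> K^o) linear_form
    (GRing.submod_closed_semi linear_form_closed).

Definition dual := submod linear_form.
HB.instance Definition _ := GRing.Lmodule.on dual.

End Dual.

Section RestrictScalars.
Variables (K : fieldType) (K0 : [pchar K] =i pred0).

Fact intr_neq0_pchar0 (z : int) : z != 0 -> z%:~R != 0 :> K.
Proof.
have natP := (pcharf0P K).1 K0.
by case: z => n z0; rewrite ?NegzE ?mulrNz ?oppr_eq0 -pmulrn natP.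
Qed.

Let nz_den x : (denq x)%:~R != 0 :> K.
Proof. by rewrite intr_neq0_pchar0 ?denq_eq0. Qed.

Fact ratrD_pchar0 : {morph @ratr K : x y / x + y}.
Proof.
have injZtoQ : @injective rat int intr by apply: intr_inj.
move=> x y.
apply: (canLR (mulfK (nz_den _))); apply: (mulIf (nz_den x)).
rewrite mulrAC mulrDl divfK ?nz_den // mulrAC -!rmorphM.
apply: (mulIf (nz_den y)); rewrite mulrAC mulrDl divfK ?nz_den //.
rewrite -!(rmorphM, rmorphD); congr _%:~R; apply: injZtoQ.
rewrite !(rmorphM, rmorphD) /= [_ + _]lock /= -lock !numqE.
by rewrite (mulrAC y) -!mulrDl -mulrA mulrAC !mulrA.
Qed.

Fact ratrM_pchar0 : {morph @ratr K : x y / x * y}.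
Proof.
have injZtoQ : @injective rat int intr by apply: intr_inj.
move=> x y; rewrite /ratr mulrC mulrAC.
apply: canLR (mulKf (nz_den _)) _; rewrite !mulrA.
do 2!apply: canRL (mulfK (nz_den _)) _; rewrite -!rmorphM; congr _%:~R.
apply: injZtoQ; rewrite !rmorphM [x * y]lock /= !numqE -lock.
by rewrite -!mulrA mulrA mulrCA -!mulrA (mulrCA y).
Qed.

End RestrictScalars.

(* The K-module M seen as a rational vector space; the proof argument is what
   makes [ratr] a ring morphism, and hence the action below a module action. *)
Definition restrict_rat (K : fieldType) (K0 : [pchar K] =i pred0)
  (M : lmodType K) : Type := M.

Section RestrictRat.
Variables (K : fieldType) (K0 : [pchar K] =i pred0) (M : lmodType K).
Local Notation MQ := (restrict_rat K0 M).

HB.instance Definition _ := GRing.Zmodule.copy MQ M.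

Definition rat_scale (q : rat) (x : MQ) : MQ := ratr q *: (x : M).

Fact rat_scaleA p q x : rat_scale p (rat_scale q x) = rat_scale (p * q) x.
Proof. by rewrite /rat_scale scalerA ratrM_pchar0. Qed.

Fact rat_scale1 : left_id 1 rat_scale.
Proof. by move=> x; rewrite /rat_scale /ratr divr1 scale1r. Qed.

Fact rat_scaleDr : right_distributive rat_scale +%R.
Proof. by move=> q x y; apply: scalerDr. Qed.

Fact rat_scaleDl x : {morph rat_scale^~ x : p q / p + q}.
Proof. by move=> p q; rewrite /rat_scale ratrD_pchar0 // scalerDl. Qed.

HB.instance Definition _ := GRing.Zmodule_isLmodule.Build rat MQ
  rat_scaleA rat_scale1 rat_scaleDr rat_scaleDl.

End RestrictRat.

HB.mixin Record isLieAlgebra (K : fieldType) g of GRing.Lmodule K g := {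
  bracket : g -> g -> g;
  bracket_linearl : forall y, linear (bracket^~ y);
  bracket_linearr : forall x, linear (bracket x);
  bracketxx : forall x, bracket x x = 0;
  jacobi : forall x y z,
    bracket x (bracket y z) + bracket y (bracket z x)
      + bracket z (bracket x y) = 0
}.

#[short(type="lieAlgType")]
HB.structure Definition LieAlgebra (K : fieldType) :=
  { g of GRing.Lmodule K g & isLieAlgebra K g }.

HB.mixin Record isBracketClosed (K : fieldType) (g : lieAlgType K)
    (S : g -> bool) := {
  bracket_closed : {in S &, forall x y, bracket x y \in S}
}.

#[short(type="lieSubalgClosed")]
HB.structure Definition LieSubalgClosed (K : fieldType) (g : lieAlgType K) :=
  { S of @GRing.SubmodClosed K g S & isBracketClosed K g S }.

Section SubLieAlgebra.
Variables (K : fieldType) (g : lieAlgType K) (S : lieSubalgClosed g).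

Definition sub_bracket (x y : submod S) : submod S :=
  Submod (bracket_closed (\val x) (\val y) (valP x) (valP y)).

Fact sub_bracket_linearl y : linear (sub_bracket^~ y).
Proof. by move=> a x z; apply/val_inj; apply: bracket_linearl. Qed.

Fact sub_bracket_linearr x : linear (sub_bracket x).
Proof. by move=> a y z; apply/val_inj; apply: bracket_linearr. Qed.

Fact sub_bracketxx x : sub_bracket x x = 0.
Proof. by apply/val_inj; apply: bracketxx. Qed.

Fact sub_jacobi x y z :
  sub_bracket x (sub_bracket y z) + sub_bracket y (sub_bracket z x)
    + sub_bracket z (sub_bracket x y) = 0.
Proof. by apply/val_inj; apply: jacobi. Qed.

HB.instance Definition _ := isLieAlgebra.Build K (submod S)
  sub_bracket_linearl sub_bracket_linearr sub_bracketxx sub_jacobi.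

End SubLieAlgebra.

Section GeneratedSubalgebra.
Variables (K : fieldType) (g : lieAlgType K) (A : set g).

Definition lie_gen : {pred g} := fun x =>
  `[< forall S : lieSubalgClosed g, (forall y, A y -> y \in S) -> x \in S >].

Fact lie_gen_submod : submod_closed lie_gen.
Proof.
split; first by apply/asboolP => S _; apply: rpred0.
move=> a x y /asboolP Sx /asboolP Sy; apply/asboolP => S AS.
by rewrite rpredD ?rpredZ ?Sx ?Sy.
Qed.

Fact lie_gen_bracket : {in lie_gen &, forall x y, bracket x y \in lie_gen}.
Proof.
move=> x y /asboolP Sx /asboolP Sy; apply/asboolP => S AS.
by rewrite bracket_closed ?Sx ?Sy.
Qed.

HB.instance Definition _ := GRing.isSubmodClosed.Build K g lie_gen
  (GRing.submod_closed_semi lie_gen_submod).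
HB.instance Definition _ := isBracketClosed.Build K g lie_gen lie_gen_bracket.

End GeneratedSubalgebra.

Definition lie_iso (K : fieldType) (g1 g2 : lieAlgType K) (f : g1 -> g2) :=
  [/\ linear f, {morph f : x y / bracket x y} & bijective f].

Section SplitLieAlgebra.
Variables (K : fieldType) (g : lieAlgType K) (h : submodClosed g).

Definition lie_abelian (a : submodClosed g) : Prop :=
  {in a &, forall x y, bracket x y = 0}.

Definition maximal_abelian : Prop :=
  lie_abelian h /\
  forall a : submodClosed g,
    lie_abelian a -> {subset h <= a} -> {subset a <= h}.

Definition root_space (alpha : dual (submod h)) : set g :=
  [set x | forall t : submod h, bracket (\val t) x = (\val alpha t : K) *: x].

(* The sum of the joint eigenspaces is automatically direct. *)
Definition ad_diagonalizable : Prop :=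
  forall x : g, exists (n : nat) (alpha : 'I_n -> dual (submod h))
      (y : 'I_n -> g),
    (forall i, root_space (alpha i) (y i)) /\ x = \sum_i y i.

Definition split_lie_algebra : Prop := maximal_abelian /\ ad_diagonalizable.

Definition root_set : set (dual (submod h)) :=
  [set alpha | alpha != 0 /\ exists2 x, x != 0 & root_space alpha x].

Definition ad_locally_nilpotent (x : g) : Prop :=
  forall y, exists n, iter n (bracket x) y = 0.

Definition integrable_roots : set (dual (submod h)) :=
  [set alpha | root_set alpha /\ exists x y : g,
    [/\ root_space alpha x, root_space (- alpha) y,
        exists2 t : submod h, \val t = bracket x y & \val alpha t != 0,
        ad_locally_nilpotent x & ad_locally_nilpotent y]].

(* Meaningful when alpha is integrable: the defining conditions then have a
   unique solution. *)
Definition coroot (alpha : dual (submod h)) : submod h :=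
  xget 0 [set t : submod h | \val alpha t = 2 /\
    \val t \in lin_span [set z : g | exists x y : g,
      [/\ root_space alpha x, root_space (- alpha) y & z = bracket x y]]].

Definition sl2_subalgebra (alpha : dual (submod h)) : set g :=
  [set z | exists (c : K) (x y : g),
    [/\ root_space alpha x, root_space (- alpha) y
      & z = c *: \val (coroot alpha) + x + y]].

Definition core : {pred g} :=
  lie_gen [set x : g | exists2 alpha, integrable_roots alpha
                                    & sl2_subalgebra alpha x].
HB.instance Definition _ := LieSubalgClosed.on core.

Definition integrable_connected : Prop :=
  forall alpha beta, integrable_roots alpha -> integrable_roots beta ->
    exists (n : nat) (gamma : nat -> dual (submod h)),
      [/\ gamma 0%N = alpha, gamma n = beta,
          forall j, (j <= n)%N -> integrable_roots (gamma j)
        & forall j, (j < n)%N -> \val (gamma j.+1) (coroot (gamma j)) != 0].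

Variable kappa : g -> g -> K.

Record split_quadratic : Prop := {
  quadratic_split : split_lie_algebra;
  kappa_linear : forall y, scalar (kappa^~ y);
  kappa_sym : forall x y, kappa x y = kappa y x;
  kappa_invariant : forall x y z, kappa (bracket x y) z = kappa x (bracket y z);
  kappa_nondegenerate : forall x, (forall y, kappa x y = 0) -> x = 0
}.

Definition flat (t : submod h) : submod h -> K :=
  fun s => kappa (\val s) (\val t).

(* Meaningful on the range of the injective map [flat], which contains all
   roots and hence their span. *)
Definition sharp (alpha : dual (submod h)) : submod h :=
  xget 0 [set t | flat t = \val alpha].

Definition root_form (alpha beta : dual (submod h)) : K :=
  kappa (\val (sharp alpha)) (\val (sharp beta)).

(* The last field is the normalization of kappa. *)
Record leala : Prop := {
  leala_quadratic : split_quadratic;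
  leala_connected : integrable_connected;
  leala_integrable : forall alpha, root_set alpha ->
    root_form alpha alpha != 0 -> integrable_roots alpha;
  leala_normalized : forall alpha, integrable_roots alpha ->
    exists2 q : rat, 0 < q & root_form alpha alpha = ratr q
}.

End SplitLieAlgebra.

Arguments root_set {K g} h _.
Arguments integrable_roots {K g} h _.

Section LocallyAffineRootSystem.
Variables (V : lmodType rat) (form : V -> V -> rat) (R : set V).

Definition cartan_int (beta alpha : V) : rat :=
  2 * form alpha beta / form alpha alpha.

Definition form_radical : set V := [set v | forall w, form v w = 0].

Record locally_affine_root_system : Prop := {
  form_linear : forall y, scalar (form^~ y);
  form_sym : forall x y, form x y = form y x;
  form_psd : forall x, 0 <= form x x;
  lars_nonisotropic : forall alpha, R alpha -> form alpha alpha != 0;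
  lars_span : forall v, v \in lin_span R;
  lars_integral : forall alpha beta, R alpha -> R beta ->
    exists z : int, cartan_int beta alpha = z%:~R;
  lars_reflection : forall alpha beta, R alpha -> R beta ->
    R (beta - cartan_int beta alpha *: alpha);
  lars_irreducible : forall R1 R2 : set V, R = R1 `|` R2 ->
    (forall alpha beta, R1 alpha -> R2 beta -> form alpha beta = 0) ->
    R1 = set0 \/ R2 = set0;
  lars_affine : exists2 delta, delta != 0 &
    form_radical `&` int_span R = [set v | exists z : int, v = delta *~ z]
}.

End LocallyAffineRootSystem.

Section Coral.
Variables (K : fieldType) (K0 : [pchar K] =i pred0) (g : lieAlgType K).
Variable (h : submodClosed g).

Definition dualQ : lmodType rat := restrict_rat K0 (dual (submod h)).

Definition rootQ : {pred dualQ} :=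
  lin_span (integrable_roots h : set dualQ).
HB.instance Definition _ := GRing.SubmodClosed.on rootQ.

Definition coral_locally_affine (kappa : g -> g -> K) : Prop :=
  [/\ leala h kappa,
      forall x : g, exists a b, [/\ a \in h, b \in core h & x = a + b],
      (* the form of the root system is the restriction of [root_form], which
         is rational-valued on the span of the integrable roots *)
      exists2 form : submod rootQ -> submod rootQ -> rat,
        forall a b, ratr (form a b) = root_form kappa (\val a) (\val b) &
        locally_affine_root_system form
          [set a : submod rootQ | integrable_roots h (\val a)]
    & root_set h <> integrable_roots h].

Definition integral_base (B : set dualQ) : Prop :=
  [/\ B `<=` integrable_roots h, lin_indep B
    & root_set h `<=` (int_span B : set dualQ)].

End Coral.

Arguments rootQ {K} K0 {g} h _.

Section CoreIso.
Variables (K : fieldType) (K0 : [pchar K] =i pred0) (g1 g2 : lieAlgType K).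
Variables (h1 : submodClosed g1) (h2 : submodClosed g2).
Variable psi : submod (rootQ K0 h1) -> submod (rootQ K0 h2).

Definition core_iso_along (phi : submod (core h1) -> submod (core h2)) : Prop :=
  lie_iso phi /\
  forall a : submod (rootQ K0 h1), root_set h1 (\val a) ->
    sub_image phi (root_space (\val a)) (root_space (\val (psi a))).

End CoreIso.

(* Main.v *)
Require Import Defs.
From HB Require Import structures.
From mathcomp Require Import all_boot all_order all_algebra zify ring lra.
From mathcomp Require Import boolp classical_sets functions wochoice.

Set Implicit Arguments.
Unset Strict Implicit.
Unset Printing Implicit Defensive.

Import Order.TTheory GRing.Theory Num.Theory.
Local Open Scope classical_set_scope.
Local Open Scope ring_scope.

(** An isomorphism of the cores along psi is its graph, a subalgebra D of the
    product of the two algebras, generated by the lines spanned by the vectors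
    (e1 a, c a * e2 a), one for each real root a, where e1 a and e2 a are fixed
    root vectors for a and psi a. The whole matter is to choose the scalars c a
    so that D is a graph.

    Scalars are called consistent when the part of D in the degrees of real
    roots contains no element (0, y) with y nonzero. Consistency is enough
    ([graph_injr], [graph_injl]): in a nonzero isotropic degree an element (0, y)
    of D yields by bracketing elements (0, [y, x]) in real degrees, so y
    annihilates all real root vectors and vanishes because the invariant form is
    nondegenerate; in degree 0 the algebra D is spanned by the pairs of
    corresponding coroots ([graph_zero]), and coroots satisfy the same linear
    relations on both sides. Indeed these relations are spanned by rational
    relations between the roots ([relation_rational]), and psi preserves the
    Cartan integers ([cartan_int_unique]), hence the lengths of roots up to a
    common factor.

    Consistent scalars exist locally. The roots in the integral span of a
    finite set of roots are ordered by a height, which has simple roots, the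
    indecomposable positive ones. Root vectors for plus and minus the simple roots
    satisfy the relations needed for a triangular decomposition
    ([hgen_triangular]), so that the subalgebra which pairs of them generate has
    only a line in the degree of a simple root ([simple_line]). It reaches every
    root in both components ([hgen_reach]), and an element (0, y) of a root degree,
    bracketed with a vector of the opposite degree and then with a suitable simple
    root vector, would break that line ([local_unique]).

    The ratio of two consistent choices is a character of the root lattice:
    when the finite set is connected the simple roots are linearly independent
    ([simple_indep]), and brackets propagate the ratio from the simple roots
    ([consistent_ratio]). Conversely twisting by a character preserves
    consistency. The local choices are therefore glued by normalizing their
    values on a basis of the root lattice ([consistent_global]). The root lattice
    may be of uncountable rank; it is nevertheless free, because modulo its
    radical it consists of bounded integer-valued functions on the roots
    ([root_lattice_basis], by the argument of Specker and Noebeling). The same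
    character argument gives uniqueness: an isomorphism is determined by its
    scalars, and these by their values on an integral base. *)

(** * Integral spans *)

Lemma sum_extend (I : eqType) (Z : zmodType) (s t : seq I) (F : I -> Z) :
  uniq s -> uniq t -> {subset s <= t} ->
  \sum_(b <- t) (if b \in s then F b else 0) = \sum_(b <- s) F b.
Proof.
move=> us ut st; rewrite -big_mkcond -big_filter; apply: perm_big.
apply: uniq_perm => //; first exact: filter_uniq.
by move=> b; rewrite mem_filter; case: (boolP (b \in s)) => //= /st.
Qed.

Lemma fctMz (X : Type) (f : X -> int) (n : int) x : (f *~ n) x = n * f x.
Proof.
rewrite mulrC -[RHS]/(f x * n) -[n in RHS]intz mulrzr.
by case: n => p; rewrite ?NegzE ?mulrNz ?fctE -!pmulrn ?natmulfctE.
Qed.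

Section IntSpan.
Variable V : zmodType.
Implicit Types (A B S : set V) (x y : V).

Definition subgroup S : Prop := S 0 /\ forall x y, S x -> S y -> S (x - y).

Section SubgroupTheory.
Variables (S : set V) (gS : subgroup S).

Lemma subgroup0 : S 0. Proof. by case: gS. Qed.

Lemma subgroupB x y : S x -> S y -> S (x - y). Proof. by case: gS => _; apply. Qed.

Lemma subgroupN x : S x -> S (- x).
Proof. by move=> Sx; rewrite -sub0r; apply: subgroupB => //; apply: subgroup0. Qed.

Lemma subgroupD x y : S x -> S y -> S (x + y).
Proof. by move=> Sx Sy; rewrite -[y]opprK; apply: subgroupB => //; apply: subgroupN. Qed.

Lemma subgroupMz x z : S x -> S (x *~ z).
Proof.
move=> Sx; have Sn n : S (x *+ n).
  by elim: n => [|n IHn]; [rewrite mulr0n; apply: subgroup0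
    | rewrite mulrS; apply: subgroupD].
case: z => n; first exact: Sn.
by rewrite NegzE mulrNz; apply: subgroupN; apply: Sn.
Qed.

Lemma subgroup_sum (I : eqType) (r : seq I) (F : I -> V) :
  (forall i, i \in r -> S (F i)) -> S (\sum_(i <- r) F i).
Proof.
move=> SF; rewrite big_seq; elim/big_rec: _ => [|i x ri Sx]; first exact: subgroup0.
by apply: subgroupD => //; apply: SF.
Qed.

End SubgroupTheory.

Lemma int_span_subgroup A : subgroup (int_span A).
Proof.
split; first by exists 0%N, (fun=> 0), (fun=> 0); split; [case | rewrite big_ord0].
move=> x y [n [c [v [Av ->]]]] [m [d [w [Aw ->]]]].
exists (n + m)%N.
exists (fun i => match fintype.split i with inl j => c j | inr j => - d j end).
exists (fun i => match fintype.split i with inl j => v j | inr j => w j end).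
split=> [i|]; first by case: (fintype.split i).
rewrite big_split_ord -sumrN; congr (_ + _); apply: eq_bigr => i _.
  by rewrite -[lshift _ _]/(unsplit (inl _)) unsplitK.
by rewrite -[rshift _ _]/(unsplit (inr _)) unsplitK mulrNz.
Qed.

Lemma int_span_gen A x : A x -> int_span A x.
Proof.
by exists 1%N, (fun=> 1), (fun=> x); split=> //; rewrite big_ord1 mulr1z.
Qed.

Lemma int_span_min A S : subgroup S -> A `<=` S -> int_span A `<=` S.
Proof.
move=> gS AS _ [n [c [v [Av ->]]]]; apply: (subgroup_sum gS) => i _.
by apply: (subgroupMz gS); apply: AS.
Qed.

Lemma int_spanS A B : A `<=` B -> int_span A `<=` int_span B.
Proof.
move=> AB; apply: int_span_min; first exact: int_span_subgroup.
by move=> x /AB; apply: int_span_gen.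
Qed.

(** Sums over duplicate-free lists make it possible to regroup terms, hence to
    speak of the coordinates of an element. *)
Lemma int_span_uniqP A x : int_span A x ->
  exists (s : seq V) (c : V -> int),
    [/\ uniq s, forall b, b \in s -> A b & x = \sum_(b <- s) b *~ c b].
Proof.
move: x; apply: int_span_min => [|x Ax]; last first.
  exists [:: x], (fun=> 1); split=> // [b|]; first by rewrite inE => /eqP->.
  by rewrite big_seq1 mulr1z.
split; first by exists [::], (fun=> 0); split=> //; rewrite big_nil.
move=> x y [s [c [us sA ->]]] [t [d [ut tA ->]]].
exists (undup (s ++ t)), (fun b => (if b \in s then c b else 0)
                                  - (if b \in t then d b else 0)).
split; first exact: undup_uniq.
  by move=> b; rewrite mem_undup mem_cat => /orP[/sA|/tA].
under [RHS]eq_bigr do rewrite mulrzBr.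
rewrite sumrB -(sum_extend (t := undup (s ++ t))) ?undup_uniq //; last first.
  by move=> b bs; rewrite mem_undup mem_cat bs.
rewrite -(sum_extend (t := undup (s ++ t)) (s := t)) ?undup_uniq //; last first.
  by move=> b bs; rewrite mem_undup mem_cat bs orbT.
by congr (_ - _); apply: eq_bigr => b _; case: ifP; rewrite ?mulr0z.
Qed.

Definition zindep A : Prop := forall (s : seq V) (c : V -> int), uniq s ->
  (forall b, b \in s -> A b) -> \sum_(b <- s) b *~ c b = 0 ->
  forall b, b \in s -> c b = 0.

Definition zbasis A B : Prop := [/\ A `<=` B, zindep A & B `<=` int_span A].

End IntSpan.

Section AdditiveOn.
Variables (V W : zmodType).
Implicit Types (S : set V) (f : V -> W).

Definition additive_on S f : Prop :=
  forall x y, S x -> S y -> f (x + y) = f x + f y.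

Section Theory.
Variables (S : set V) (f : V -> W).
Hypotheses (gS : subgroup S) (fS : additive_on S f).

Lemma additive_on0 : f 0 = 0.
Proof.
have S0 := subgroup0 gS; apply: (addrI (f 0)).
by rewrite -fS // !addr0.
Qed.

Lemma additive_onN x : S x -> f (- x) = - f x.
Proof.
move=> Sx; apply: (addrI (f x)); rewrite -fS ?subrr ?additive_on0 //.
exact: (subgroupN gS).
Qed.

Lemma additive_onB x y : S x -> S y -> f (x - y) = f x - f y.
Proof.
by move=> Sx Sy; rewrite fS ?additive_onN //; apply: (subgroupN gS).
Qed.

Lemma additive_onMz x z : S x -> f (x *~ z) = f x *~ z.
Proof.
move=> Sx; have fn n : f (x *+ n) = f x *+ n.
  elim: n => [|n IHn]; first by rewrite !mulr0n additive_on0.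
  rewrite !mulrS fS ?IHn //; exact: (@subgroupMz _ _ gS x n).
case: z => n; first exact: fn.
by rewrite NegzE !mulrNz additive_onN ?fn //; apply: (@subgroupMz _ _ gS x n.+1).
Qed.

Lemma additive_on_sum (I : eqType) (r : seq I) (F : I -> V) :
  (forall i, i \in r -> S (F i)) ->
  f (\sum_(i <- r) F i) = \sum_(i <- r) f (F i).
Proof.
elim: r => [|i r IHr] SF; first by rewrite !big_nil additive_on0.
have SFr j : j \in r -> S (F j) by move=> jr; apply: SF; rewrite inE jr orbT.
rewrite !big_cons fS ?IHr //; first by apply: SF; rewrite inE eqxx.
exact: (subgroup_sum gS).
Qed.

End Theory.

Lemma additive_on_sub S S' f : S `<=` S' -> additive_on S' f -> additive_on S f.
Proof. by move=> SS' fS' x y Sx Sy; apply: fS'; apply: SS'. Qed.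

(** Two expansions of an element in an independent set yield the same value, since
    their difference expands zero. *)
Lemma zindep_extend (A : set V) (t : V -> W) : zindep A ->
  exists2 f : V -> W, additive_on (int_span A) f & forall b, A b -> f b = t b.
Proof.
move=> indA.
pose rep x w := exists (s : seq V) (c : V -> int), [/\ uniq s,
  forall b, b \in s -> A b, x = \sum_(b <- s) b *~ c b
  & w = \sum_(b <- s) t b *~ c b].
have repD e x w y v : rep x w -> rep y v -> rep (x + y *~ e) (w + v *~ e).
  move=> [s [c [us sA -> ->]]] [u [d [uu uA -> ->]]].
  pose r := undup (s ++ u).
  exists r, (fun b => (if b \in s then c b else 0)
                    + (if b \in u then d b * e else 0)).
  have ur : uniq r by apply: undup_uniq.
  have sr : {subset s <= r} by move=> b bs; rewrite mem_undup mem_cat bs.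
  have tr : {subset u <= r} by move=> b bs; rewrite mem_undup mem_cat bs orbT.
  split=> //; first by move=> b; rewrite mem_undup mem_cat => /orP[/sA|/uA].
    under [RHS]eq_bigr do rewrite mulrzDr.
    rewrite big_split -(sum_extend (s := s) (t := r)) // mulrz_suml -(sum_extend (s := u) (t := r)) //.
    by congr (_ + _); apply: eq_bigr => b _; case: ifP; rewrite ?mulr0z ?mulrzA.
  under [RHS]eq_bigr do rewrite mulrzDr.
  rewrite big_split -(sum_extend (s := s) (t := r)) // mulrz_suml -(sum_extend (s := u) (t := r)) //.
  by congr (_ + _); apply: eq_bigr => b _; case: ifP; rewrite ?mulr0z ?mulrzA.
have rep0 w : rep 0 w -> w = 0.
  case=> s [c [us sA /esym/(indA _ _ us sA) c0 ->]].
  by rewrite big_seq big1 // => b /c0->; rewrite mulr0z.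
have rep_uniq x w v : rep x w -> rep x v -> w = v.
  move=> xw xv; have := repD (- 1) _ _ _ _ xw xv.
  rewrite !mulrNz !mulr1z subrr => /rep0/eqP.
  by rewrite subr_eq0 => /eqP.
have repP x : int_span A x -> exists w, rep x w.
  move=> /int_span_uniqP[s [c [us sA ->]]].
  by exists (\sum_(b <- s) t b *~ c b), s, c.
pose f x := xget 0 [set w | rep x w].
have fP x : int_span A x -> rep x (f x).
  by move=> /repP[w xw]; apply: (@xgetPex _ 0 [set w | rep x w]); exists w.
exists f => [x y Ax Ay|b Ab].
  apply: (rep_uniq (x + y)).
    by apply: fP; apply: (subgroupD (int_span_subgroup A)).
  by have := repD 1 _ _ _ _ (fP _ Ax) (fP _ Ay); rewrite !mulr1z.
apply: (rep_uniq b); first by apply: fP; apply: int_span_gen.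
exists [:: b], (fun=> 1); split=> //; try by rewrite big_seq1 mulr1z.
by move=> a; rewrite inE => /eqP->.
Qed.

Lemma additive_on_eq (A : set V) f g : additive_on (int_span A) f ->
  additive_on (int_span A) g -> (forall b, A b -> f b = g b) ->
  forall x, int_span A x -> f x = g x.
Proof.
move=> fA gA fg; have gsA := int_span_subgroup A.
suff H : int_span A `<=` [set x | int_span A x /\ f x = g x] by move=> x /H[].
apply: int_span_min => [|b Ab].
  split; first by split; [apply: subgroup0|rewrite !(additive_on0 gsA)].
  move=> x y [Ax fx] [Ay fy]; split; first exact: (subgroupB gsA).
  by rewrite !(additive_onB gsA) // fx fy.
by split; [apply: int_span_gen | apply: fg].
Qed.

End AdditiveOn.

(** * Bounded integer-valued functions *)

Section WellOrder.

Definition wo (T : Type) (lt : T -> T -> Prop) : Prop :=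
  [/\ well_founded lt, forall x y z, lt x y -> lt y z -> lt x z
    & forall x y, [\/ x = y, lt x y | lt y x]].

Lemma wo_exists (T : eqType) : exists lt : T -> T -> Prop, wo lt.
Proof.
have [R woR] := well_ordering_principle T.
have Rxy x y : x != y -> ~~ (R x y && R y x).
  move=> nxy; apply/negP => /andP[xy yx].
  have [|z [_ zmin]] := woR (pred2 x y); first by exists x; rewrite inE eqxx.
  have Rxx u : R u u.
    have [|v [[vu +] _]] := woR (pred1 u); first by exists u; rewrite inE.
    by move: vu; rewrite inE => /eqP-> /(_ u); rewrite inE; apply.
  have zx : z = x.
    apply: zmin; split; first by rewrite inE eqxx.
    by move=> u; rewrite !inE => /orP[]/eqP->.
  have zy : z = y.
    apply: zmin; split; first by rewrite inE eqxx orbT.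
    by move=> u; rewrite !inE => /orP[]/eqP->.
  by move/eqP: nxy; apply; rewrite -zx -zy.
have Rmin (A : pred T) x : A x -> exists2 z, A z & forall u, A u -> R z u.
  by move=> Ax; have [|z [[zA zmin] _]] := woR A; [exists x | exists z].
have tot x y : R x y || R y x.
  have [|z /orP[]/eqP-> zmin] := Rmin (pred2 x y) x; first by rewrite /= eqxx.
    by rewrite zmin //= eqxx orbT.
  by rewrite (zmin x) /= ?eqxx ?orbT.
exists (fun x y => R x y /\ x != y); split.
- move=> x; apply: contrapT => nx.
  have [|z /asboolP nz zmin] :=
    Rmin (fun u => `[< ~ Acc (fun x y => R x y /\ x != y) u >]) x.
    exact/asboolP.
  apply: nz; constructor=> y [yz nyz]; apply: contrapT => ny.
  have zy : R z y by apply: zmin; apply/asboolP.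
  by have := Rxy _ _ nyz; rewrite yz zy.
- move=> x y z [xy nxy] [yz nyz]; split; last first.
    by apply/eqP => xz; move: xy nyz; rewrite xz => zy /Rxy; rewrite yz zy.
  have [|u] := Rmin [pred u | [|| u == x, u == y | u == z]] x; first by rewrite /= eqxx.
  move=> /= /or3P[]/eqP-> umin.
  + by apply: umin; rewrite eqxx !orbT.
  + by have := Rxy _ _ nxy; rewrite xy umin ?eqxx.
  + by have := Rxy _ _ nyz; rewrite yz umin ?eqxx ?orbT.
- move=> x y; have [->|nxy] := eqVneq x y; first by constructor.
  by case/orP: (tot x y) => ?; [constructor 2|constructor 3]; rewrite // eq_sym.
Qed.

End WellOrder.

Section Monomials.
Variables (X : Type) (L : eqType) (ev : L -> X -> bool).
Implicit Types (l : L) (ls u w : seq L) (m : bitseq) (f g : X -> int).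

(** Letters are bool-valued functions, and words stand for their products. As
    letters are idempotent, repetitions in a word are immaterial. *)
Definition word_fun w : X -> int := fun x => \prod_(l <- w) (ev l x)%:R.

(** The multilinear polynomials in the letters of [ls], expanded with respect to
    the first letter. *)
Fixpoint pol ls f : Prop :=
  if ls is l :: ls' then exists A B,
    [/\ pol ls' A, pol ls' B & forall x, f x = A x + (ev l x)%:R * B x]
  else exists c, forall x, f x = c.

(** The integral combinations of the monomials lexicographically below the one
    that [m] selects in [ls]. *)
Fixpoint ltpol ls m f : Prop :=
  match ls, m with
  | l :: ls', true :: m' => exists A B,
      [/\ pol ls' A, ltpol ls' m' B & forall x, f x = A x + (ev l x)%:R * B x]
  | _ :: ls', false :: m' => ltpol ls' m' f
  | _, _ => forall x, f x = 0
  end.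

Definition agree ls (x y : X) := forall l, l \in ls -> ev l x = ev l y.

Lemma pol_agree ls f x y : pol ls f -> agree ls x y -> f x = f y.
Proof.
elim: ls f => [|l ls IH] f /=; first by case=> c fc _; rewrite !fc.
case=> A [B [pA pB fE]] xy.
have xy' : agree ls x y by move=> k kl; apply: xy; rewrite inE kl orbT.
by rewrite !fE (IH A pA xy') (IH B pB xy') (xy l) // inE eqxx.
Qed.

(** The value of f is split according to the value of the first letter; a value
    that is not attained is replaced by 0. *)
Lemma agree_pol ls f (x0 : X) :
  (forall x y, agree ls x y -> f x = f y) -> pol ls f.
Proof.
elim: ls f => [|l ls IH] f fP /=; first by exists (f x0) => x; apply: fP.
pose h b x := if pselect (exists y, agree ls x y /\ ev l y = b) is left e
              then f (projT1 (cid e)) else 0.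
have hP b : pol ls (h b).
  apply: IH => x y xy; rewrite /h.
  case: pselect => [ex|nx]; case: pselect => [ey|ny] //.
  - case: cid => u /= [xu ub]; case: cid => v /= [yv vb]; apply: fP => k.
    rewrite inE => /orP[/eqP->|kl]; first by rewrite ub vb.
    by rewrite -(xu _ kl) -(yv _ kl) xy.
  - case: ny; case: ex => u [xu ub]; exists u; split=> // k kl.
    by rewrite -(xu _ kl) xy.
  - case: nx; case: ey => u [xu ub]; exists u; split=> // k kl.
    by rewrite -(xu _ kl) xy.
have hE x : h (ev l x) x = f x.
  rewrite /h; case: pselect => [e|[]]; last by exists x.
  case: cid => u /= [xu ub]; apply: fP => k; rewrite inE => /orP[/eqP->//|kl].
  by rewrite (xu _ kl).
have [nA nB] : pol ls (h false) /\ pol ls (fun x => h true x - h false x).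
  split=> //; apply: IH => x y xy.
  by rewrite (pol_agree (hP true) xy) (pol_agree (hP false) xy).
exists (h false), (fun x => h true x - h false x); split=> // x.
by rewrite -hE; case: (ev l x); rewrite ?mul0r ?addr0 // mul1r addrC subrK.
Qed.

(** A monomial that is a rational combination of smaller ones on a set of
    points is an integral one. With the top variable [l] split off, the relation
    holds for the tails at those points where both values of [l] occur; at the
    others the correction is a polynomial without [l], hence lower. *)
Lemma ltpol_pure (x0 : X) ls m (Z : set X) (n : int) f :
  size m = size ls -> n != 0 -> ltpol ls m f ->
  (forall x, Z x -> n * word_fun (mask m ls) x = f x) ->
  exists2 g, ltpol ls m g & forall x, Z x -> word_fun (mask m ls) x = g x.
Proof.
move=> sm n0; elim: ls m sm Z f => [|l ls IH] [|b m] //= => [_ | [sm]] Z f.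
  move=> f0 fE; exists (fun=> 0) => // x /fE.
  by rewrite f0 /word_fun big_nil mulr1 => n0'; rewrite n0' in n0.
case: b; last by move=> lf fE; apply: (IH _ sm Z f).
move=> [A [B [pA lB fE]]] nE.
have mE x : word_fun (l :: mask m ls) x = (ev l x)%:R * word_fun (mask m ls) x.
  by rewrite /word_fun big_cons.
pose Z1 : set X := [set x | [/\ Z x, ev l x
  & exists x', [/\ Z x', ~~ ev l x' & agree ls x x']]].
have [x [Zx lx [x' [Zx' lx' xx']]]|B' lB' B'E] := IH m sm Z1 B lB.
  have := nE _ Zx; have := nE _ Zx'; rewrite !mE !fE lx (negPf lx').
  rewrite !mul0r mulr0 addr0 !mul1r -(pol_agree pA xx') => <- ->.
  by rewrite add0r.
pose bad x := (exists y, [/\ Z y, agree ls x y & ev l y]) /\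
   ~ (exists x', [/\ Z x', agree ls x x' & ~~ ev l x']).
pose h x := if pselect (bad x) is left _ then word_fun (mask m ls) x - B' x else 0.
have wagree x y : agree ls x y -> word_fun (mask m ls) x = word_fun (mask m ls) y.
  move=> xy; rewrite /word_fun; apply: eq_big_seq => k /mem_mask kl.
  by rewrite (xy _ kl).
have polltp ks r g : ltpol ks r g -> pol ks g.
  elim: ks r g => [|k ks IHk] [|b r] g //=; try by exists 0.
    move=> g0; exists (fun=> 0), (fun=> 0); split=> [||x].
    - exact: (agree_pol x0).
    - exact: (agree_pol x0).
    - by rewrite g0 mulr0 addr0.
  case: b => [[A1 [B1 [pA1 /IHk pB1 gE]]]|/IHk pg]; first by exists A1, B1.
  exists g, (fun=> 0); split=> // [|x]; first exact: (agree_pol x0).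
  by rewrite mulr0 addr0.
exists (fun x => h x + (ev l x)%:R * B' x).
  exists h, B'; split=> //; apply: (agree_pol x0) => x y xy; rewrite /h.
  have yx : agree ls y x by move=> k kl; rewrite xy.
  have tr a b c : agree ls a b -> agree ls b c -> agree ls a c.
    by move=> ab bc k kl; rewrite ab // bc.
  have badP a b : agree ls a b -> bad a -> bad b.
    move=> ab [[c [Zc ac lc]] nex]; have ba : agree ls b a by move=> k kl; rewrite ab.
    split; first by exists c; split=> //; apply: tr ac.
    by case=> d [Zd bd ld]; apply: nex; exists d; split=> //; apply: tr bd.
  case: pselect => bx; case: pselect => by_ //.
  - by rewrite (wagree _ _ xy) (pol_agree (polltp _ _ _ lB') xy).
  - by case: by_; apply: badP bx.
  - by case: bx; apply: badP by_.
move=> x Zx; rewrite mE /h; case: (boolP (ev l x)) => lx; last first.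
  rewrite !mul0r addr0; case: pselect => // -[_ []].
  by exists x; split.
rewrite !mul1r; case: pselect => [_|nbx]; first by rewrite subrK.
rewrite add0r; apply: B'E; split=> //; apply: contrapT => nex; apply: nbx.
split; first by exists x.
by case=> d [Zd xd ld]; apply: nex; exists d; split.
Qed.

End Monomials.

Section Words.
Variables (X : Type) (x0 : X) (L : eqType) (ev : L -> X -> bool).
Variables (lt : L -> L -> Prop) (woL : wo lt).
Implicit Types (l : L) (ls u w : seq L) (m : bitseq) (f g : X -> int).

Local Notation word_fun := (word_fun ev).
Local Notation pol := (pol ev).
Local Notation ltpol := (ltpol ev).

Let lt_wf : well_founded lt. Proof. by case: woL. Qed.
Let lt_trans x y z : lt x y -> lt y z -> lt x z. Proof. by case: woL => _ + _; apply. Qed.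
Let lt_total x y : [\/ x = y, lt x y | lt y x]. Proof. by case: woL. Qed.
Let ltxx x : ~ lt x x.
Proof. by elim/(well_founded_ind lt_wf): x => x IH xx; apply: (IH x). Qed.

(** Decreasing words represent the finite sets of letters, and the lexicographic
    order on them is a well-order when the order on letters is one. *)
Fixpoint decr w : Prop :=
  if w is l :: w' then (forall k, k \in w' -> lt k l) /\ decr w' else True.

Fixpoint lex u w : Prop :=
  match u, w with
  | _, [::] => False
  | [::], _ :: _ => True
  | a :: u', b :: w' => lt a b \/ (a = b /\ lex u' w')
  end.

Definition wlt u w := [/\ decr u, decr w & lex u w].

Lemma decr_subseq u w : subseq u w -> decr w -> decr u.
Proof.
elim: w u => [|l w IH] [|k u] //= + [lw dw]; case: eqP => [->|_] uw.
  split; last exact: IH.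
  by move=> j ju; apply: lw; apply: mem_subseq uw _ ju.
by have /= := IH (k :: u) uw dw.
Qed.

Lemma wlt_wf : well_founded wlt.
Proof.
have Acc0 : Acc wlt [::] by constructor=> u [_ _]; case: u.
have AccS l : forall w, decr (l :: w) -> Acc wlt (l :: w).
  elim/(well_founded_ind lt_wf): l => l IHl w dlw.
  have Aw : Acc wlt w.
    case: w dlw => [|k w]; first by move=> _; exact: Acc0.
    case=> lw dw; apply: (IHl k _ w dw); exact: (lw k (mem_head k w)).
  elim: Aw dlw => {}w _ IHw [lw dw]; constructor=> -[|a u] [du _]; first by move=> _; exact: Acc0.
  case=> [al|[al uw]]; first exact: IHl.
  by move: du; rewrite al => du; apply: IHw => //; split=> //; case: du.
move=> w; constructor=> -[|l u] [du _ _]; [exact: Acc0 | exact: AccS].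
Qed.

Lemma wlt_trans u v w : wlt u v -> wlt v w -> wlt u w.
Proof.
move=> [du _ uv] [_ dw vw]; split=> //.
elim: u v w uv vw {du dw} => [|a u IH] [|b v] [|c w] //=.
case=> [ab|[-> uv]] [bc|[<- vw]].
- by left; apply: lt_trans bc.
- by left.
- by left.
- by right; split=> //; apply: IH vw.
Qed.

Lemma wlt_total u w : decr u -> decr w -> [\/ u = w, wlt u w | wlt w u].
Proof.
elim: u w => [|a u IH] [|b w].
- by constructor 1.
- by move=> _ dw; constructor 2.
- by move=> du _; constructor 3.
move=> [au du] [bw dw].
have [ab|ab|ba] := lt_total a b; last 2 first.
- by constructor 2; split=> //=; left.
- by constructor 3; split=> //=; left.
subst b; have [->|[_ _ uw]|[_ _ wu]] := IH w du dw; first by constructor 1.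
- by constructor 2; split=> //=; right.
- by constructor 3; split=> //=; right.
Qed.

Lemma decr_cover (r : seq L) : exists2 ls, decr ls & {subset r <= ls}.
Proof.
have ins l ls : decr ls -> exists2 ls', decr ls' & l :: ls =i ls'.
  elim: ls => [|k ls IH] /=; first by exists [:: l].
  case=> kls dls; have [lk|lk|kl] := lt_total l k.
  - exists (k :: ls) => // j; rewrite lk !inE; by case: eqP.
  - have [ls' dls' E] := IH dls; exists (k :: ls').
      split=> // j; rewrite -E inE => /orP[/eqP->//|]; exact: kls.
    by move=> j; rewrite !inE -E inE orbCA.
  - exists [:: l, k & ls] => //; split; last by split.
    move=> j; rewrite inE => /orP[/eqP->//|/kls jk]; exact: lt_trans kl.
elim: r => [|l r [ls dls rls]]; first by exists [::].
have [ls' dls' E] := ins l ls dls; exists ls' => // j; rewrite -E !inE.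
by case: eqP => //= _ /rls.
Qed.

Lemma decr_mem_subseq u ls : decr u -> decr ls -> {subset u <= ls} -> subseq u ls.
Proof.
elim: ls u => [|k ls IH] [|a u] //.
  by move=> _ _ /(_ a); rewrite inE eqxx => /(_ isT).
move=> [au du] [kls dls] sub /=; case: eqP => [ak|/eqP nak].
  apply: IH => // j ju; have := sub j; rewrite !inE ju orbT => /(_ isT).
  by case/orP=> // /eqP jk; have := au _ ju; rewrite ak jk => /ltxx.
apply: IH => //= j jau; have := sub j jau; rewrite inE => /orP[/eqP jk|//].
have := sub a; rewrite !inE eqxx (negPf nak) => /(_ isT)/kls ak.
move: jau; rewrite inE jk eq_sym (negPf nak) => /au ka.
by case: (ltxx (lt_trans ka ak)).
Qed.

Lemma pol_subgroup ls : subgroup (pol ls).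
Proof.
split; first by apply: (agree_pol x0).
move=> f g pf pg; apply: (agree_pol x0) => x y xy.
by rewrite !fctE (pol_agree pf xy) (pol_agree pg xy).
Qed.

Lemma ltpol_subgroup ls m : subgroup (ltpol ls m).
Proof.
elim: ls m => [|l ls IH] [|[] m] /=; try (split=> [//|f g f0 g0 x];
  by rewrite !fctE f0 g0 subrr).
- have [p0 pB] := pol_subgroup ls; have [q0 qB] := IH m; split=> [|f g].
    by exists 0, 0; split=> // x; rewrite mulr0 addr0.
  move=> [A [B [pA lB fE]]] [A' [B' [pA' lB' gE]]].
  exists (A - A'), (B - B'); split; [exact: pB | exact: qB | move=> x].
  by rewrite !fctE fE gE; ring.
- exact: IH.
Qed.

Lemma word_fun_cons l w x : word_fun (l :: w) x = (ev l x)%:R * word_fun w x.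
Proof. by rewrite /word_fun big_cons. Qed.

Lemma pol_span ls f : pol ls f ->
  int_span [set word_fun u | u in [set u | subseq u ls]] f.
Proof.
elim: ls f => [|l ls IH] f /=.
  case=> c fE; have -> : f = word_fun [::] *~ c.
    by apply/funext => x; rewrite fE fctMz /word_fun big_nil mulr1.
  apply: (subgroupMz (int_span_subgroup _)); apply: int_span_gen.
  by exists [::].
case=> A [B [/IH pA /IH pB fE]].
have -> : f = A + (fun x => (ev l x)%:R * B x) by apply/funext => x; rewrite fE.
have gS := int_span_subgroup [set word_fun u | u in [set u | subseq u (l :: ls)]].
apply: (subgroupD gS).
  apply: int_spanS pA => _ [u uls <-]; exists u => //=.
  exact: subseq_trans uls (subseq_cons _ _).
pose S := [set g | int_span [set word_fun u | u in [set u | subseq u (l :: ls)]]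
                 (fun x => (ev l x)%:R * g x)].
suff : S B by []; move: B pB {fE}; apply: int_span_min.
  split.
    rewrite /S /=; set z := (X in int_span _ X); have -> : z = 0.
      by apply/funext => x; rewrite /z mulr0.
    exact: (subgroup0 gS).
  move=> g h Sg Sh; rewrite /S /=; set z := (X in int_span _ X).
  have -> : z = (fun x => (ev l x)%:R * g x) - (fun x => (ev l x)%:R * h x).
    by apply/funext => x; rewrite /z !fctE mulrBr.
  exact: (subgroupB gS).
move=> _ [u uls <-]; apply: int_span_gen; exists (l :: u); first by rewrite /= eqxx.
by apply/funext => x; rewrite word_fun_cons.
Qed.

Lemma word_pol u ls : subseq u ls -> pol ls (word_fun u).
Proof.
elim: ls u => [|l ls IH] [|k u] //=; try by exists 1 => x; rewrite /word_fun big_nil.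
  by move=> _; apply: (@agree_pol _ _ ev (l :: ls) _ x0) => x y _;
    rewrite /word_fun !big_nil.
case: eqP => [->|_] uls.
  exists 0, (word_fun u); split; [exact: (subgroup0 (pol_subgroup ls)) | exact: IH |].
  by move=> x; rewrite word_fun_cons add0r.
exists (word_fun (k :: u)), 0; split; first exact: IH.
  exact: (subgroup0 (pol_subgroup ls)).
by move=> x; rewrite mulr0 addr0.
Qed.

Lemma ltpol_word ls m u : decr ls -> subseq u ls -> lex u (mask m ls) ->
  ltpol ls m (word_fun u).
Proof.
elim: ls m u => [|l ls IH] [|b m] u //; try by case: u.
move=> [lls dls]; case: b => /=; last first.
  case: u => [|k u] /=.
    by move=> _ uw; apply: (IH m [::] dls _ uw); apply: sub0seq.
  case: eqP => [->|_] uls; last exact: (IH m (k :: u)).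
  case E: (mask m ls) => [|j w] //= jk; case: (ltxx (x := j)).
  have jl : lt j l.
    by apply: lls; apply: (@mem_mask _ _ m); rewrite E inE eqxx.
  by case: jk => [lj|[lj _]]; [apply: lt_trans jl _ | rewrite -{2}lj].
case: u => [|k u] /= uls.
  move=> _; exists (word_fun [::]), 0; split.
  - exact/word_pol/sub0seq.
  - exact: (subgroup0 (ltpol_subgroup ls m)).
  - by move=> x; rewrite mulr0 addr0.
move: uls; case: eqP => [->|nkl] uls [].
- by move/ltxx.
- case=> _ uw; exists 0, (word_fun u); split.
  + exact: (subgroup0 (pol_subgroup ls)).
  + exact: IH.
  + by move=> x; rewrite add0r word_fun_cons.
- move=> _; exists (word_fun (k :: u)), 0; split.
  + exact: word_pol.
  + exact: (subgroup0 (ltpol_subgroup ls m)).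
  + by move=> x; rewrite mulr0 addr0.
- by case.
Qed.

Lemma ltpol_span ls m f : decr ls -> ltpol ls m f ->
  int_span [set word_fun u | u in [set u | subseq u ls /\ lex u (mask m ls)]] f.
Proof.
have zero A g : (forall x, g x = 0) -> int_span A g.
  move=> g0; have -> : g = 0 by apply/funext.
  exact: (subgroup0 (int_span_subgroup A)).
elim: ls m f => [|l ls IH] [|b m] f; try by move=> _; apply: zero.
move=> [lls dls]; case: b => /=; last first.
  move=> /(IH _ _ dls); apply: int_spanS => _ [u [uls uw] <-]; exists u => //.
  by split=> //; apply: subseq_trans uls (subseq_cons _ _).
set A := (X in int_span X); have gS := int_span_subgroup A.
case=> C [B [pC /(IH _ _ dls) pB fE]].
have -> : f = C + (fun x => (ev l x)%:R * B x) by apply/funext => x; rewrite fE.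
apply: (subgroupD gS).
  apply: int_spanS (pol_span pC) => _ [u uls <-]; exists u => //; split.
    exact: subseq_trans uls (subseq_cons _ _).
  case: u uls => [|k u] //= uls; left; apply: lls.
  by apply: (mem_subseq uls); rewrite inE eqxx.
pose S := [set g | int_span A (fun x => (ev l x)%:R * g x)].
suff : S B by []; move: B pB {fE}; apply: int_span_min.
  split.
    by apply: zero => x; rewrite mulr0.
  move=> g h Sg Sh; rewrite /S /=; set z := (X in int_span _ X).
  have -> : z = (fun x => (ev l x)%:R * g x) - (fun x => (ev l x)%:R * h x).
    by apply/funext => x; rewrite /z !fctE mulrBr.
  exact: (subgroupB gS).
move=> _ [u [uls uw] <-]; apply: int_span_gen; exists (l :: u).
  by split; rewrite /= ?eqxx //; right.
by apply/funext => x; rewrite word_fun_cons.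
Qed.

(** Only finitely many letters occur in a given relation, which reduces the claim
    to [ltpol_pure]. *)
Lemma word_pure w (n : int) : decr w -> n != 0 ->
  int_span [set word_fun u | u in [set u | wlt u w]] (word_fun w *~ n) ->
  int_span [set word_fun u | u in [set u | wlt u w]] (word_fun w).
Proof.
move=> dw n0 [k [z [v [vP wE]]]].
have /choice[u uP] i : exists u, wlt u w /\ word_fun u = v i.
  by have [u uw uE] := vP i; exists u.
have [ls dls sub] := decr_cover (w ++ flatten [seq u i | i <- enum 'I_k]).
have wls : subseq w ls.
  by apply: decr_mem_subseq => // j jw; apply: sub; rewrite mem_cat jw.
have uls i : subseq (u i) ls.
  apply: decr_mem_subseq => //; first by case: (uP i) => [[]].
  move=> j ju; apply: sub; rewrite mem_cat; apply/orP; right.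
  by apply/flattenP; exists (u i) => //; apply/mapP; exists i; rewrite ?mem_enum.
have [m sm wm] := subseqP wls.
have lE : ltpol ls m (word_fun w *~ n).
  rewrite wE; apply: (subgroup_sum (ltpol_subgroup ls m)) => i _.
  apply: (subgroupMz (ltpol_subgroup ls m)).
  have [[_ _ uw] <-] := uP i; apply: (ltpol_word dls (uls i)).
  by rewrite -wm.
have [|g lg wg] := ltpol_pure x0 (Z := setT) sm n0 lE.
  by move=> x _; rewrite fctMz wm.
have -> : word_fun w = g by apply/funext => x; rewrite -wg // -wm.
apply: int_spanS (ltpol_span dls lg) => _ [t [tls tw] <-]; exists t => //.
split=> //; first exact: decr_subseq tls dls.
by rewrite wm.
Qed.

End Words.

Lemma subrACA (V : zmodType) (a b c d : V) : (a - b) - (c - d) = (a - c) - (b - d).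
Proof. by rewrite !opprB [d - c]addrC [d - b]addrC addrACA. Qed.

(** * Bases from a filtration with torsion-free cyclic factors *)

Section LeadingTerms.
Variables (T : Type) (lt : T -> T -> Prop) (D : set T).
Hypothesis lt_wf : well_founded lt.
Hypothesis lt_trans : forall x y z, lt x y -> lt y z -> lt x z.
Hypothesis lt_total : forall x y, D x -> D y -> [\/ x = y, lt x y | lt y x].
Hypothesis ltD : forall x y, lt x y -> D x.
Variables (V H : zmodType) (e : T -> H) (S : set V) (phi : V -> H).
Hypotheses (gS : subgroup S) (phiS : additive_on S phi).

Let Alt w : set H := int_span [set e u | u in [set u | lt u w]].
Let Ale w : set H := [set x | exists z, Alt w (x - e w *~ z)].

Hypothesis e_pure : forall w z, D w -> z != 0 -> Alt w (e w *~ z) -> Alt w (e w).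
Hypothesis phi_span : forall v, S v -> int_span [set e u | u in D] (phi v).

Let ltxx x : ~ lt x x.
Proof. by elim/(well_founded_ind lt_wf): x => x IH xx; apply: (IH x). Qed.

Let gAlt w : subgroup (Alt w). Proof. exact: int_span_subgroup. Qed.

Let gAle w : subgroup (Ale w).
Proof.
split; first by exists 0; rewrite mulr0z subr0; apply: (subgroup0 (gAlt w)).
move=> x y [a xa] [b yb]; exists (a - b); rewrite mulrzBr subrACA.
exact: (subgroupB (gAlt w)).
Qed.

Let Alt_le u w : lt u w -> Alt u `<=` Alt w.
Proof. by move=> uw; apply: int_spanS => _ [t tu <-]; exists t => //; apply: lt_trans uw. Qed.

Let Ale_lt u w : lt u w -> Ale u `<=` Alt w.
Proof.
move=> uw x [z xz]; rewrite -[x](subrK (e u *~ z)); apply: (subgroupD (gAlt w)).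
  exact: Alt_le xz.
by apply: (subgroupMz (gAlt w)); apply: int_span_gen; exists u.
Qed.

Let Alt_Ale w : Alt w `<=` Ale w.
Proof. by move=> x Ax; exists 0; rewrite mulr0z subr0. Qed.

Let Ale_top (A : set T) x : A `<=` D -> int_span [set e u | u in A] x ->
  x = 0 \/ exists2 w, A w & Ale w x.
Proof.
move=> AD /int_span_uniqP[s [c [_ sA ->]]]; elim: s sA => [|y s IH] sA.
  by left; rewrite big_nil.
rewrite big_cons; have [u Au uy] := sA y (mem_head _ _).
have Aey : Ale u (y *~ c y).
  by exists (c y); rewrite uy subrr; apply: (subgroup0 (gAlt u)).
have [|->|[w Aw sw]] := IH; first by move=> b bs; apply: sA; rewrite inE bs orbT.
  by right; exists u; rewrite ?addr0.
right; have [uw|uw|wu] := lt_total (AD _ Au) (AD _ Aw).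
- by exists w => //; apply: (subgroupD (gAle w)) => //; rewrite -uw.
- exists w => //; apply: (subgroupD (gAle w)) => //.
  by apply: Alt_Ale; apply: Ale_lt Aey.
- exists u => //; apply: (subgroupD (gAle u)) => //.
  by apply: Alt_Ale; apply: Ale_lt sw.
Qed.

Let wo_max (U : eqType) (g : U -> T) (r : seq U) :
  (exists b, b \in r) -> (forall b, b \in r -> D (g b)) ->
  exists2 b, b \in r & forall a, a \in r -> g a = g b \/ lt (g a) (g b).
Proof.
elim: r => [|y r IH] [b br] rD; first by [].
have Dy := rD _ (mem_head _ _).
have rD' a : a \in r -> D (g a) by move=> ar; apply: rD; rewrite inE ar orbT.
case: r IH {br} rD rD' => [|z r] IH rD rD'.
  by exists y; rewrite ?mem_head // => a; rewrite !inE => /eqP->; left.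
have [||m mr mmax] := IH => //; first by exists z; rewrite inE eqxx.
have [ym|ym|my] := lt_total Dy (rD' _ mr).
- exists m; first by rewrite inE mr orbT.
  by move=> a /predU1P[->|/mmax]; [left|].
- exists m; first by rewrite inE mr orbT.
  by move=> a /predU1P[->|/mmax]; [right|].
- exists y; first by rewrite inE eqxx.
  move=> a /predU1P[->|/mmax[->|am]]; [by left|by right|].
  by right; apply: lt_trans my.
Qed.

(** The leading coefficients at a given index form a subgroup of the integers;
    an element realizing its generator is taken into the basis. *)
Lemma leading_basis : exists2 B : set V, B `<=` S &
  (forall v, S v -> exists2 b, int_span B b & phi v = phi b) /\
  (forall (s : seq V) (c : V -> int), uniq s -> (forall b, b \in s -> B b) ->
     phi (\sum_(b <- s) b *~ c b) = 0 -> forall b, b \in s -> c b = 0).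
Proof.
pose lead w v z := [/\ S v, z != 0 & Alt w (phi v - e w *~ z)].
pose good w := [/\ D w, ~ Alt w (e w) & exists v z, lead w v z].
have lead_gen w : good w -> exists vz : V * int, lead w vz.1 vz.2 /\
    forall v z, lead w v z -> (vz.2 %| z)%Z.
  move=> [_ nAw [v0 [z0 L0]]].
  have [n [[v [z [L zn]]] nmin]] : exists n, (exists v z, lead w v z /\ `|z|%N = n) /\
      forall v z, lead w v z -> (n <= `|z|)%N.
    have [|n /asboolP nP nmin] := @ex_minnP (fun n => `[< exists v z, lead w v z /\ `|z|%N = n >]).
      by exists `|z0|%N; apply/asboolP; exists v0, z0.
    by exists n; split=> // v z L; apply: nmin; apply/asboolP; exists v, z.
  exists (v, z); split=> //= v1 z1 [Sv1 z10 L1].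
  have [Sv z0' Lz] := L; apply/dvdz_mod0P/eqP; apply: contraT => r0.
  have /nmin : lead w (v1 - v *~ (z1 %/ z)%Z) (z1 %% z)%Z.
    split=> //; first by apply: (subgroupB gS) => //; apply: (subgroupMz gS).
    rewrite (additive_onB gS phiS) //; last exact: (subgroupMz gS).
    rewrite (additive_onMz gS phiS) //.
    have := subgroupB (gAlt w) L1 (subgroupMz (gAlt w) (z1 %/ z)%Z Lz).
    by rewrite mulrzBl -mulrzA [z * _]mulrC /modz mulrzBr [_ - _ - (_ - _)]subrACA.
  rewrite -zn leqNgt => /negP[]; have := ltz_mod z1 z0'.
  by have := modz_ge0 z1 z0'; lia.
have /choice[bz bzP] w : exists vz : V * int, good w -> lead w vz.1 vz.2 /\
    forall v z, lead w v z -> (vz.2 %| z)%Z.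
  by have [/lead_gen[vz vzP]|ng] := pselect (good w); [exists vz|exists (0, 0)].
pose B := [set (bz w).1 | w in good].
have BS : B `<=` S by move=> _ [w /bzP[[Sv _ _] _] <-].
have spanS : int_span B `<=` S by apply: int_span_min gS BS.
exists B => //; split.
  have main w : D w -> forall v, S v -> Ale w (phi v) ->
      exists2 b, int_span B b & phi v = phi b.
    elim/(well_founded_ind lt_wf): w => w IH Dw v Sv.
    have down x : S x -> Alt w (phi x) -> exists2 b, int_span B b & phi x = phi b.
      move=> Sx Ax; have [|x0|[u uw Aux]] := @Ale_top [set u | lt u w] (phi x) _ Ax.
      - by move=> u /ltD.
      - exists 0; first exact: (subgroup0 (int_span_subgroup B)).
        by rewrite x0 (additive_on0 gS phiS).
      - exact: (IH u uw (ltD uw)).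
    move=> [z vz]; have [z0|z0] := eqVneq z 0.
      by apply: down => //; move: vz; rewrite z0 mulr0z subr0.
    have [Aw|nAw] := pselect (Alt w (e w)).
      apply: down => //; rewrite -[phi v](subrK (e w *~ z)).
      by apply: (subgroupD (gAlt w)) => //; apply: (subgroupMz (gAlt w)).
    have gw : good w by split=> //; exists v, z.
    have [[Sb d0 Lb] dvd] := bzP w gw.
    have /dvdzP[k zk] := dvd v z (And3 Sv z0 vz).
    have Sbk : S ((bz w).1 *~ k) by apply: (subgroupMz gS).
    have [||b Bb bE] := down (v - (bz w).1 *~ k); first exact: (subgroupB gS).
      rewrite (additive_onB gS phiS) // (additive_onMz gS phiS) //.
      have := subgroupB (gAlt w) vz (subgroupMz (gAlt w) k Lb).
      by rewrite mulrzBl -mulrzA [_ * k]mulrC -zk subrACA subrr subr0.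
    exists (b + (bz w).1 *~ k).
      apply: (subgroupD (int_span_subgroup B)) => //.
      apply: (subgroupMz (int_span_subgroup B)); apply: int_span_gen.
      by exists w.
    rewrite phiS //; last exact: spanS.
    by rewrite -bE -phiS ?subrK //; apply: (subgroupB gS).
  move=> v Sv; have [v0|[w Dw]] := Ale_top (@subset_refl _ D) (phi_span Sv).
    exists 0; first exact: (subgroup0 (int_span_subgroup B)).
    by rewrite v0 (additive_on0 gS phiS).
  exact: main.
move=> s c us sB s0; apply: contrapT => /existsNP[b1 /not_implyP[b1s c1]].
have [w1 gw1 _] := sB _ b1s.
have /choice[iw iwP] b : exists w, B b -> good w /\ (bz w).1 = b.
  by have [[w gw wb]|nB] := pselect (B b); [exists w|exists w1].
have [||b0 b0s b0max] := @wo_max _ iw [seq b <- s | c b != 0].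
- by exists b1; rewrite mem_filter b1s andbT; apply/eqP.
- by move=> b; rewrite mem_filter => /andP[_ /sB/iwP[[]]].
move: b0s; rewrite mem_filter => /andP[cb0 b0s].
have [gw bw] := iwP _ (sB _ b0s); set w := iw b0 in gw bw.
have [Dw nAw _] := gw; have [[_ d0 Lb] _] := bzP w gw.
apply: nAw; apply: (e_pure Dw (z := (bz w).2 * c b0)); first by rewrite mulf_neq0.
rewrite -[e w *~ _]opprK; apply: (subgroupN (gAlt w)).
have -> : - (e w *~ ((bz w).2 * c b0)) = (phi (bz w).1 - e w *~ (bz w).2) *~ c b0
    + \sum_(b <- s | b != b0) phi (b *~ c b).
  rewrite mulrzBl -mulrzA addrAC -[LHS]add0r; congr (_ - _).
  rewrite bw -(additive_onMz gS phiS); last exact: BS _ (sB _ b0s).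
  have := s0; rewrite (additive_on_sum gS phiS) => [|b bs]; last first.
    by apply: (subgroupMz gS); apply: BS _ (sB _ bs).
  by rewrite (bigD1_seq b0) //= => ->.
apply: (subgroupD (gAlt w)); first exact: (subgroupMz (gAlt w)).
rewrite big_seq_cond; elim/big_rec: _ => [|b x /andP[bs nb] Ax].
  exact: (subgroup0 (gAlt w)).
apply: (subgroupD (gAlt w)) => //.
have [->|cb] := eqVneq (c b) 0.
  by rewrite mulr0z (additive_on0 gS phiS); apply: (subgroup0 (gAlt w)).
rewrite (additive_onMz gS phiS); last exact: BS _ (sB _ bs).
apply: (subgroupMz (gAlt w)); have [gu bu] := iwP _ (sB _ bs).
have [|uw|uw] := b0max b; first by rewrite mem_filter cb.
  by move/eqP: nb; case; rewrite -bu uw.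
apply: (Ale_lt uw); exists (bz (iw b)).2.
by have [[_ _ +] _] := bzP _ gu; rewrite bu.
Qed.

End LeadingTerms.

(** * Locally affine root systems *)

Section RootSystem.
Variables (V : lmodType rat) (form : V -> V -> rat) (R : set V).
Hypothesis lars : locally_affine_root_system form R.
Implicit Types (a b v w x y : V).

Local Notation ci := (cartan_int form).
Local Notation Lam := (int_span R).

Lemma rformDl x y z : form (x + y) z = form x z + form y z.
Proof. by have := form_linear lars z 1 x y; rewrite scale1r mul1r. Qed.

Lemma rform0l z : form 0 z = 0.
Proof. by apply: (addrI (form 0 z)); rewrite -rformDl !addr0. Qed.

Lemma rformZl q x z : form (q *: x) z = q * form x z.
Proof. by have := form_linear lars z q x 0; rewrite addr0 rform0l addr0. Qed.

Lemma rformNl x z : form (- x) z = - form x z.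
Proof. by rewrite -scaleN1r rformZl mulN1r. Qed.

Lemma rformBl x y z : form (x - y) z = form x z - form y z.
Proof. by rewrite rformDl rformNl. Qed.

Lemma rformMzl n x z : form (x *~ n) z = form x z *~ n.
Proof. by rewrite -scaler_int rformZl mulrzl. Qed.

Let sym := form_sym lars.

Lemma rformDr x y z : form z (x + y) = form z x + form z y.
Proof. by rewrite sym rformDl ![form _ z]sym. Qed.

Lemma rformZr q x z : form z (q *: x) = q * form z x.
Proof. by rewrite sym rformZl sym. Qed.

Lemma rformNr x z : form z (- x) = - form z x.
Proof. by rewrite sym rformNl sym. Qed.

Lemma rformBr x y z : form z (x - y) = form z x - form z y.
Proof. by rewrite rformDr rformNr. Qed.

Lemma rform_suml (I : Type) (r : seq I) (P : pred I) (F : I -> V) z :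
  form (\sum_(i <- r | P i) F i) z = \sum_(i <- r | P i) form (F i) z.
Proof. by elim/big_ind2: _ => [|? ? ? ? <- <-|//]; rewrite ?rform0l ?rformDl. Qed.

Lemma root_norm_gt0 a : R a -> 0 < form a a.
Proof. by move=> Ra; rewrite lt_neqAle eq_sym (lars_nonisotropic lars Ra) (form_psd lars). Qed.

(** Otherwise a semidefinite form takes a negative value on some w + t x. *)
Lemma isotropic_radical x w : form x x = 0 -> form x w = 0.
Proof.
move=> x0; apply/eqP/contraT => xw0.
have := form_psd lars (w + (- (form w w + 1) / (2 * form x w)) *: x).
rewrite !(rformDl, rformDr, rformZl, rformZr) x0 [form w x]sym.
have E : - (form w w + 1) / (2 * form x w) * form x w = - (form w w + 1) / 2.
  by field.
rewrite E !mulr0; lra.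
Qed.

Lemma isotropicD x y : form x x = 0 -> form (x + y) (x + y) = form y y.
Proof.
move=> x0; rewrite !(rformDl, rformDr) x0 [form y x]sym !(isotropic_radical _ x0).
by rewrite !add0r.
Qed.

Lemma rform_ext x : (forall a, R a -> form a x = 0) -> forall w, form x w = 0.
Proof.
move=> xR w; have /asboolP[n [c [v [Rv ->]]]] := lars_span lars w.
rewrite sym rform_suml big1 // => i _; rewrite rformZl xR ?mulr0 //.
Qed.

Lemma int_span_orth (A B : set V) x y : (forall p q, A p -> B q -> form p q = 0) ->
  int_span A x -> int_span B y -> form x y = 0.
Proof.
move=> AB Ax; move: y; apply: int_span_min => [|q Bq /=].
  split=> [|y z /= xy xz]; first by rewrite /= sym rform0l.
  by rewrite rformBr xy xz subrr.
move: x Ax; apply: int_span_min => [|p Ap /=]; last exact: AB.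
split=> [|y z /= xy xz]; first by rewrite /= rform0l.
by rewrite rformBl xy xz subrr.
Qed.

Lemma ciE a b : ci a b = 2 * form b a / form b b. Proof. by []. Qed.

Lemma ciDl x y b : ci (x + y) b = ci x b + ci y b.
Proof. by rewrite !ciE rformDr; ring. Qed.

Lemma ciNl x b : ci (- x) b = - ci x b.
Proof. by rewrite !ciE rformNr; ring. Qed.

Lemma ciBl x y b : ci (x - y) b = ci x b - ci y b.
Proof. by rewrite ciDl ciNl. Qed.

Lemma ciZl q x b : ci (q *: x) b = q * ci x b.
Proof. by rewrite !ciE rformZr; ring. Qed.

Lemma ciaa a : R a -> ci a a = 2.
Proof. by move=> /(lars_nonisotropic lars) a0; rewrite ciE mulfK. Qed.

Lemma ci_gt0 a b : R b -> (0 < ci a b) = (0 < form a b).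
Proof.
by move=> /root_norm_gt0 b0; rewrite ciE pmulr_lgt0 ?invr_gt0 // pmulr_rgt0 // sym.
Qed.

Lemma ci_lt0 a b : R b -> (ci a b < 0) = (form a b < 0).
Proof. by move=> Rb; rewrite -oppr_gt0 -ciNl ci_gt0 // rformNl oppr_gt0. Qed.

Lemma ci_eq0 a b : R b -> (ci a b == 0) = (form a b == 0).
Proof.
move=> /root_norm_gt0 b0; rewrite ciE !mulf_eq0 invr_eq0 (gt_eqF b0) orbF.
by rewrite sym.
Qed.

Lemma isotropic_ci0 x b : form x x = 0 -> ci x b = 0.
Proof. by move=> x0; rewrite ciE sym isotropic_radical // mulr0 mul0r. Qed.

Lemma rootN a : R a -> R (- a).
Proof.
move=> Ra; have := lars_reflection lars Ra Ra.
by rewrite ciaa // scaler_nat mulr2n opprD addrA subrr add0r.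
Qed.

Lemma root_neq0 a : R a -> a != 0.
Proof.
by move=> /(lars_nonisotropic lars); apply: contra_neq => ->; apply: rform0l.
Qed.

Lemma lattice_ci_int v b : Lam v -> R b -> exists z : int, ci v b = z%:~R.
Proof.
move=> + Rb; move: v; apply: int_span_min => [|a Ra]; last first.
  exact: (lars_integral lars Rb Ra).
split; first by exists 0; rewrite isotropic_ci0 ?rform0l.
move=> x y [m mE] [n nE]; exists (m - n).
by rewrite ciBl mE nE rmorphB.
Qed.

(** The Cartan integers, extended additively to the root lattice. *)
Definition cz v b : int := Num.floor (ci v b).

Lemma czE v b : Lam v -> R b -> (cz v b)%:~R = ci v b.
Proof. by move=> Lv Rb; have [z zE] := lattice_ci_int Lv Rb; rewrite /cz zE intrKfloor. Qed.

Lemma cz_additive b : R b -> additive_on Lam (cz^~ b).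
Proof.
move=> Rb x y Lx Ly; have gL := int_span_subgroup R.
have Lxy : Lam (x + y) by apply: (subgroupD gL).
apply: (@intr_inj rat); rewrite rmorphD /= !czE ?ciDl //.
Qed.

Lemma cauchy_schwarz x y : form x y ^+ 2 <= form x x * form y y.
Proof.
have [y0|y0] := eqVneq (form y y) 0.
  by rewrite sym (isotropic_radical _ y0) y0 mulr0 expr0n.
have yp : 0 < form y y by rewrite lt_neqAle eq_sym y0 (form_psd lars).
have := form_psd lars (x - (form x y / form y y) *: y).
rewrite !(rformBl, rformBr, rformZl, rformZr) [form y x]sym => H.
suff E : form x x - form x y / form y y * form x y -
    (form x y / form y y * form x y -
     form x y / form y y * (form x y / form y y * form y y)) =
    (form x x * form y y - form x y ^+ 2) / form y y.
  by move: H; rewrite E pmulr_lge0 ?invr_gt0 // subr_ge0.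
by field.
Qed.

(** By the Cauchy-Schwarz inequality the product of the two Cartan integers is at most 4. *)
Lemma cz_bound a b : R a -> R b -> `|cz a b| <= 4.
Proof.
move=> Ra Rb; have La := int_span_gen Ra; have Lb := int_span_gen Rb.
have a0 := root_norm_gt0 Ra; have b0 := root_norm_gt0 Rb.
have E : ci a b * ci b a = 4 * (form a b ^+ 2 / (form a a * form b b)).
  rewrite !ciE [form b a]sym; field.
  by rewrite (gt_eqF a0) (gt_eqF b0).
have le4 : cz a b * cz b a <= 4.
  rewrite -(ler_int rat) rmorphM /= !czE // E -[leRHS]mulr1 ler_pM2l //.
  by rewrite ler_pdivrMr ?mul1r ?cauchy_schwarz ?mulr_gt0.
have ge0 : 0 <= cz a b * cz b a.
  rewrite -(ler_int rat) rmorphM /= !czE // E.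
  by rewrite mulr_ge0 // divr_ge0 ?sqr_ge0 // mulr_ge0 // ltW.
have z0 : cz b a = 0 -> cz a b = 0.
  move/(congr1 (fun z : int => z%:~R : rat)); rewrite czE // => /eqP.
  by rewrite ci_eq0 // sym -ci_eq0 // -czE // intr_eq0 => /eqP.
have [/z0->|nz] := eqVneq (cz b a) 0; first by rewrite normr0.
nia.
Qed.

Lemma exists_delta : exists delta : V, [/\ delta != 0, Lam delta,
  form delta delta = 0 &
  forall x, Lam x -> form x x = 0 -> exists z : int, x = delta *~ z].
Proof.
have [d d0 dE] := lars_affine lars.
have : [set v | exists z : int, v = d *~ z] d by exists 1; rewrite mulr1z.
rewrite -dE => -[dr dL]; exists d; split=> //.
move=> x Lx x0; suff : [set v | exists z : int, v = d *~ z] x by [].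
by rewrite -dE; split=> // w; apply: isotropic_radical.
Qed.

Lemma mulrz_neq0 (x : V) (z : int) : x != 0 -> x *~ z = 0 -> z = 0.
Proof.
move=> x0; rewrite -scaler_int => /eqP; rewrite scaler_eq0 (negPf x0) orbF.
by rewrite intr_eq0 => /eqP.
Qed.

(** Modulo the radical, the lattice embeds by means of its pairings with the
    coroots into the bounded integer-valued functions on the roots, where the
    monomials in characteristic functions give the required filtration. *)
Lemma root_lattice_basis : exists2 B : set V, zbasis B Lam &
  exists2 delta, B delta & [/\ delta != 0, form delta delta = 0 &
    forall x, Lam x -> form x x = 0 -> exists z : int, x = delta *~ z].
Proof.
have [d [d0 Ld dd dP]] := exists_delta; have gL := int_span_subgroup R.
have [lt wolt] := wo_exists (V -> bool).
pose ev (l : V -> bool) (x : V) := l x.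
pose phi v : V -> int := fun a => if `[< R a >] then cz v a else 0.
have phiL : additive_on Lam phi.
  move=> x y Lx Ly; apply/funext => a; rewrite fctE /phi.
  by case: asboolP => // Ra; apply: cz_additive.
have phi_span v : Lam v -> int_span [set word_fun ev u | u in decr lt] (phi v).
  set E := [set _ | _ in _].
  suff H : Lam `<=` [set v | Lam v /\ int_span E (phi v)] by move=> /H[].
  have gE := int_span_subgroup E.
  apply: int_span_min => [|a Ra].
    split; first by split; rewrite ?(additive_on0 gL phiL); apply: subgroup0.
    move=> x y [Lx Ex] [Ly Ey]; split; first exact: (subgroupB gL).
    by rewrite (additive_onB gL phiL) //; apply: (subgroupB gE).
  split; first exact: int_span_gen.
  have -> : phi a = \sum_(i < 9) word_fun ev [:: fun x => phi a x == i%:Z - 4] *~ (i%:Z - 4).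
    apply/funext => x; rewrite fct_sumE.
    under eq_bigr do rewrite fctMz /word_fun big_seq1 /ev.
    have : `|phi a x| <= 4.
      rewrite /phi; case: asboolP => // Rx; exact: cz_bound.
    rewrite !big_ord_recl big_ord0 /=; move: (phi a x) => z zb.
    have : z \in [:: -4; -3; -2; -1; 0; 1; 2; 3; 4] by rewrite !inE; lia.
    by rewrite !inE => /or3P[|| /or3P[|| /or3P[|| /or3P[||]]]] /eqP ->.
  apply: (subgroup_sum gE) => i _; apply: (subgroupMz gE); apply: int_span_gen.
  by exists [:: fun x => phi a x == i%:Z - 4] => //; split.
have ker x : Lam x -> phi x = 0 -> form x x = 0.
  move=> Lx px; apply: rform_ext => a Ra; rewrite sym; apply/eqP.
  rewrite -ci_eq0 // -czE //; have := congr1 (fun f => f a) px.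
  by rewrite /phi asboolT //= => ->.
have phid : phi d = 0.
  apply/funext => a; rewrite /phi; case: asboolP => // Ra.
  by apply: (@intr_inj rat); rewrite czE // isotropic_ci0.
have [B0 B0L [B0span B0ind]] := @leading_basis (seq (V -> bool)) (wlt lt) (decr lt)
  (wlt_wf wolt) (wlt_trans wolt) (wlt_total wolt) (fun p q pq => let: And3 dp _ _ := pq in dp)
  V (V -> int) (word_fun ev) Lam phi gL phiL
  (fun p z dp z0 => @word_pure V 0 (V -> bool) ev lt wolt p z dp z0) phi_span.
exists (B0 `|` [set d]); last by exists d; [right | split].
have BL : B0 `|` [set d] `<=` Lam by move=> x [/B0L|->].
split=> // [s c us sB s0|v Lv]; last first.
  have [b Bb pb] := B0span v Lv.
  have Lb : Lam b by move: Bb; apply: int_span_min.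
  have gB := int_span_subgroup (B0 `|` [set d]).
  have Lvb : Lam (v - b) by apply: (subgroupB gL).
  have [|z vb] := dP (v - b) Lvb.
    by apply: ker; rewrite // (additive_onB gL phiL) // pb subrr.
  rewrite -[v](subrK b) vb; apply: (subgroupD gB).
    by apply: (subgroupMz gB); apply: int_span_gen; right.
  by apply: int_spanS Bb => x; left.
have cB b : b \in s -> b != d -> c b = 0.
  move=> bs bd; apply: (B0ind [seq b <- s | b != d] c); last by rewrite mem_filter bd.
  - exact: filter_uniq.
  - by move=> e; rewrite mem_filter => /andP[/eqP ed /sB[]].
  have sL e : e \in s -> Lam (e *~ c e).
    by move=> es; apply: (subgroupMz gL); apply: BL; apply: sB.
  have := congr1 phi s0; rewrite (additive_on_sum gL phiL) // (additive_on0 gL phiL).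
  rewrite (additive_on_sum gL phiL) => [|e]; last by rewrite mem_filter => /andP[_ /sL].
  rewrite big_filter (bigID (pred1 d)) /= big1 ?add0r // => e /eqP->.
  by rewrite (additive_onMz gL phiL) // phid mul0rz.
move=> b bs; have [bd|] := eqVneq b d; last exact: cB.
move: s0; rewrite (bigD1_seq b) //= big_seq_cond big1 => [|e /andP[es eb]].
  by rewrite addr0 bd; apply: mulrz_neq0.
by rewrite cB ?mulr0z // -bd.
Qed.

End RootSystem.

Section Heights.
Variables (V : lmodType rat) (form : V -> V -> rat) (R : set V).
Hypothesis lars : locally_affine_root_system form R.
Implicit Types (a b v w x y : V).

Local Notation ci := (cartan_int form).
Local Notation Lam := (int_span R).

Let sym := form_sym lars.
Let gL : subgroup Lam := int_span_subgroup R.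

(** Of two roots at an obtuse angle either one reflects to the sum, or both
    Cartan integers are -2, and then the sum is isotropic. *)
Lemma root_add a b : R a -> R b -> form a b < 0 ->
  R (a + b) \/ form (a + b) (a + b) = 0.
Proof.
move=> Ra Rb ab; have a0 := root_norm_gt0 lars Ra; have b0 := root_norm_gt0 lars Rb.
have [z zE] := lars_integral lars Rb Ra; have [t tE] := lars_integral lars Ra Rb.
have zl : z < 0 by rewrite -(ltr_int rat) -zE (ci_lt0 lars).
have tl : t < 0 by rewrite -(ltr_int rat) -tE (ci_lt0 lars) // sym.
have [z1|z1] := eqVneq z (-1).
  have := lars_reflection lars Rb Ra.
  by rewrite zE z1 scaleN1r opprK; left.
have [t1|t1] := eqVneq t (-1).
  have := lars_reflection lars Ra Rb.
  by rewrite tE t1 scaleN1r opprK addrC; left.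
have E : ci a b * ci b a * (form a a * form b b) = 4 * form a b ^+ 2.
  rewrite !ciE [form b a]sym; field.
  by rewrite (gt_eqF a0) (gt_eqF b0).
have zt : z * t <= 4.
  rewrite -(ler_int rat) rmorphM /= -zE -tE.
  have ab0 : 0 < form a a * form b b by rewrite mulr_gt0.
  by rewrite -(ler_pM2r ab0) E ler_pM2l // (cauchy_schwarz lars).
have [z2 t2] : z = - 2%:Z /\ t = - 2%:Z by nia.
move: zE tE; rewrite z2 t2 !ciE [form b a]sym => /(canRL (divfK _)) H /(canRL (divfK _)) H'.
right; rewrite !(rformDl lars, rformDr lars) [form b a]sym.
by have := H (lt0r_neq0 b0); have := H' (lt0r_neq0 a0); lra.
Qed.

(** Dominant is the coordinate along the generator of the radical in a basis of
    the lattice; it separates isotropic elements from zero. Pairings with the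
    members of F0, scaled by powers of 9, a base larger than twice their bound,
    are added to separate the roots in the span of F0 from zero: a root
    orthogonal to all of F0 cannot lie in its span. *)
Lemma height_exists (F0 : seq V) : (forall a, a \in F0 -> R a) ->
  exists f : V -> int, [/\ additive_on Lam f,
    forall a, R a -> int_span [set` F0] a -> f a != 0 &
    forall x, Lam x -> form x x = 0 -> x != 0 -> f x != 0].
Proof.
move=> F0R; have [B [BL Bind Bspan] [d Bd [d0 dd dP]]] := root_lattice_basis lars.
have [f0 f0add f0E] := zindep_extend (fun b => (b == d)%:R : int) Bind.
have {f0add} f0add : additive_on Lam f0 by apply: additive_on_sub f0add.
have [g [M [[M0 gadd] gM giso gF]]] : exists g : V -> int, exists M : int,
    [/\ 0 <= M /\ additive_on Lam g, forall a, R a -> `|g a| <= M,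
     forall x, Lam x -> form x x = 0 -> g x = 0
    & forall a, R a -> g a = 0 -> forall b, b \in F0 -> cz form a b = 0].
  elim: F0 F0R => [|b F IH] FR.
    by exists (fun=> 0), 0; split=> //; split=> // x y; rewrite addr0.
  have [|g [M [[M0 gadd] gM giso gF]]] := IH.
    by move=> a aF; apply: FR; rewrite inE aF orbT.
  have Rb : R b by apply: FR; rewrite inE eqxx.
  exists (fun x => 9 * g x + cz form x b), (9 * M + 4); split.
  - split=> [|x y Lx Ly]; first by lia.
    by rewrite gadd // (cz_additive lars) //=; ring.
  - by move=> a Ra; have := gM a Ra; have := cz_bound lars Ra Rb; lia.
  - move=> x Lx xx; rewrite giso // add0r; apply: (@intr_inj rat).
    by rewrite (czE lars) // (isotropic_ci0 lars).
  - move=> a Ra ga; have cb := cz_bound lars Ra Rb.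
    have [ga0 cab] : g a = 0 /\ cz form a b = 0 by lia.
    by move=> c; rewrite inE => /orP[/eqP->//|]; apply: gF.
exists (fun x => (M + 1) * f0 x + g x); split.
- by move=> x y Lx Ly /=; rewrite gadd // f0add //; ring.
- move=> a Ra aF; apply/eqP => fa.
  have ga := gM a Ra; have g0 : g a = 0.
    have [f00|[f1|f1]] : f0 a = 0 \/ 1 <= f0 a \/ f0 a <= -1 by lia.
    - by move: fa; rewrite f00; lia.
    - have : (M + 1) * 1 <= (M + 1) * f0 a by rewrite ler_pM2l; lia.
      lia.
    - have : (M + 1) * f0 a <= (M + 1) * -1 by rewrite ler_pM2l; lia.
      lia.
  have aa : form a a = 0.
    apply: (int_span_orth lars _ aF (int_span_gen (erefl a : [set a] a))) => b _ bF ->.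
    have Rb := F0R b bF; apply/eqP; rewrite sym -(ci_eq0 lars) // -(czE lars) //.
      by rewrite (gF a).
    exact: int_span_gen.
  by have := root_norm_gt0 lars Ra; rewrite aa ltxx.
- move=> x Lx xx x0; have [z xz] := dP x Lx xx.
  have f0d : f0 d = 1 by rewrite f0E ?eqxx.
  rewrite giso // addr0 xz (additive_onMz gL f0add); last exact: BL.
  rewrite f0d.
  rewrite mulf_neq0 //; first by lia.
  by rewrite intz; apply: contra_neq x0 => z0; rewrite xz z0 mulr0z.
Qed.

End Heights.

Section SimpleRoots.
Variables (V : lmodType rat) (form : V -> V -> rat) (R : set V).
Hypothesis lars : locally_affine_root_system form R.
Variable F0 : seq V.
Hypothesis F0R : forall a, a \in F0 -> R a.
Implicit Types (a b p q v w x y : V) (f : V -> int).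

Local Notation ci := (cartan_int form).
Local Notation Lam := (int_span R).
Local Notation Lsp := (int_span [set` F0]).

Let sym := form_sym lars.
Let gL : subgroup Lam := int_span_subgroup R.
Let gsp : subgroup Lsp := int_span_subgroup [set` F0].

(** The finitely generated subsystem of the roots in the span of F0. It need not be
    finite, since it can contain translates by isotropic elements. *)
Definition closure_roots : set V := R `&` Lsp.
Local Notation cl := closure_roots.

Definition height f : Prop := [/\ additive_on Lam f,
  forall a, cl a -> f a != 0 &
  forall x, Lam x -> form x x = 0 -> x != 0 -> f x != 0].

Lemma span_lattice : Lsp `<=` Lam.
Proof. exact: int_spanS. Qed.

Lemma closureN a : cl a -> cl (- a).
Proof. by move=> [Ra La]; split; [apply: (rootN lars) | apply: (subgroupN gsp)]. Qed.

Lemma heightN f : height f -> height (fun x => - f x).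
Proof.
case=> fadd f0 fi; split=> [x y Lx Ly|a /f0|x Lx xx /(fi _ Lx xx)]; rewrite ?oppr_eq0 //.
by rewrite fadd // opprD.
Qed.

(** Positive roots that are not sums of smaller positive elements, one a root, the
    other a root or isotropic. Excluding isotropic summands as well makes distinct
    simple roots differ neither by a root nor by an isotropic element. *)
Definition simple f p : Prop := [/\ cl p, 0 < f p & forall b, cl b ->
  0 < f b -> f b < f p -> R (p - b) \/ form (p - b) (p - b) = 0 -> False].

Section Fixed.
Variables (f : V -> int) (fH : height f).

Let fadd : additive_on Lam f. Proof. by case: fH. Qed.
Let fN x : Lam x -> f (- x) = - f x. Proof. exact: (additive_onN gL fadd). Qed.
Let fB x y : Lam x -> Lam y -> f (x - y) = f x - f y.
Proof. exact: (additive_onB gL fadd). Qed.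
Let fMz x z : Lam x -> f (x *~ z) = f x *~ z. Proof. exact: (additive_onMz gL fadd). Qed.
Let clL a : cl a -> Lam a. Proof. by case=> _ /span_lattice. Qed.

Lemma simple_diff p q : simple f p -> simple f q -> p != q ->
  ~ (R (p - q) \/ form (p - q) (p - q) = 0).
Proof.
move=> [cp fp pmin] [cq fq qmin] pq RI.
have Lp := clL cp; have Lq := clL cq.
have RI' : R (q - p) \/ form (q - p) (q - p) = 0.
  rewrite -opprB; case: RI => [/(rootN lars)|I0]; first by left.
  by right; rewrite (rformNl lars) (rformNr lars) opprK.
have n0 : f (p - q) != 0.
  have [_ f0 fi] := fH; case: RI => RI.
    by apply: f0; split=> //; apply: (subgroupB gsp); [case: cp | case: cq].
  by apply: fi => //; rewrite ?subr_eq0 //; apply: (subgroupB gL).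
move: n0; rewrite fB // subr_eq0 neq_lt => /orP[pq'|qp].
  exact: (qmin p).
exact: (pmin q).
Qed.

Lemma simple_le0 p q : simple f p -> simple f q -> p != q -> form p q <= 0.
Proof.
move=> sp sq pq; rewrite leNgt; apply/negP => fpq.
have [[Rp _] _ _] := sp; have [[Rq _] _ _] := sq.
apply: (simple_diff sp sq pq); apply: (root_add lars Rp (rootN lars Rq)).
by rewrite (rformNr lars) oppr_lt0.
Qed.

(** The roots in the classes of b and -b modulo the radical are permuted by
    translations, the products of two reflections. *)
Lemma root_translate b x (z : int) : R b -> form x x = 0 -> R (b + x) -> R (b + x *~ z).
Proof.
move=> Rb xx Rbx.
have step k l : R (b + x *~ k) -> R (b + x *~ l) -> R (b + x *~ (k + k - l)).
  move=> Rk Rl; have := lars_reflection lars Rk Rl.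
  have S m w : form (b + x *~ m) w = form b w.
    by rewrite (rformDl lars) (rformMzl lars) (isotropic_radical lars w xx) mul0rz addr0.
  have E : ci (b + x *~ l) (b + x *~ k) = 2.
    by rewrite ciE !S ![form b (b + _)]sym !S -ciE (ciaa lars).
  rewrite E scaler_nat => /(rootN lars).
  by rewrite opprB mulr2n mulrzBr mulrzDr [b + _ + (b + _)]addrACA opprD [b + b + _ + _]addrACA addrK.
have RNn (n : nat) : R (b + x *~ n) /\ R (b + x *~ n.+1).
  elim: n => [|n [IH IH']]; first by rewrite mulr0z addr0 mulr1z.
  split=> //; have := step n.+1 n IH' IH.
  by have -> : n.+1%:Z + n.+1%:Z - n%:Z = n.+2%:Z by lia.
case: z => n; first by case: (RNn n).
have := step 0 n.+1; rewrite mulr0z addr0 add0r NegzE; apply=> //.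
by case: (RNn n).
Qed.

(** Induction on the height; a positive isotropic difference of two roots is
    translated into a sum of two smaller positive roots. *)
Lemma simple_sum a : cl a -> 0 < f a ->
  exists2 s : seq V, (forall p, p \in s -> simple f p) & a = \sum_(p <- s) p.
Proof.
have [n] := ubnP `|f a|%N; elim: n a => // n IH a fan ca fa.
have [sa|nsa] := pselect (simple f a).
  by exists [:: a]; rewrite ?big_seq1 // => p; rewrite inE => /eqP->.
have [b [cb fb fba RI]] : exists b, [/\ cl b, 0 < f b, f b < f a
    & R (a - b) \/ form (a - b) (a - b) = 0].
  apply: contrapT => nb; apply: nsa; split=> // b cb fb fba RI.
  by apply: nb; exists b.
have join b1 c1 (s t : seq V) : (forall p, p \in s -> simple f p) -> b1 = \sum_(p <- s) p ->
    (forall p, p \in t -> simple f p) -> c1 = \sum_(p <- t) p ->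
    exists2 s : seq V, (forall p, p \in s -> simple f p) & b1 + c1 = \sum_(p <- s) p.
  move=> sP -> tP ->; exists (s ++ t); last by rewrite big_cat.
  by move=> p; rewrite mem_cat => /orP[/sP|/tP].
have [s sP bs] : exists2 s : seq V, (forall p, p \in s -> simple f p) & b = \sum_(p <- s) p.
  by apply: IH => //; lia.
have La := clL ca; have Lb := clL cb.
have Lspab : Lsp (a - b) by apply: (subgroupB gsp); [case: ca | case: cb].
have Lab : Lam (a - b) by apply: span_lattice.
have fab : f (a - b) = f a - f b by apply: fB.
rewrite -[a](subrK b) addrC.
suff [t tP ct] : exists2 s : seq V, (forall p, p \in s -> simple f p) & a - b = \sum_(p <- s) p.
  exact: join bs tP ct.
case: RI => [Rab|iab]; first by apply: IH => //; rewrite fab; lia.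
set g := a - b in Lspab Lab fab iab *.
have fg0 : 0 < f g by rewrite fab subr_gt0.
have Rbg : R (b + g) by rewrite /g addrC subrK; case: ca.
pose k := - (f b %/ f g)%Z.
have Rt m : cl (b + g *~ m).
  split; first by apply: root_translate => //; case: cb.
  by apply: (subgroupD gsp); [case: cb | apply: (subgroupMz gsp)].
have ft m : f (b + g *~ m) = f b + f g * m.
  by rewrite fadd ?fMz // ?mulrzz //; apply: (subgroupMz gL).
have [_ f0 _] := fH.
have r0 : f (b + g *~ k) = (f b %% f g)%Z.
  by rewrite ft /k /modz mulrN mulrC.
have rg : f (b + g *~ k) < f g by rewrite r0 ltz_pmod.
have rp : 0 < f (b + g *~ k).
  by rewrite lt_neqAle eq_sym f0 //= r0 modz_ge0 // gt_eqF.
have c2 : cl (g - (b + g *~ k)).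
  have -> : g - (b + g *~ k) = - (b + g *~ (k - 1)).
    by rewrite mulrzBr mulr1z addrA opprB.
  by apply: closureN; apply: Rt.
have f2 : f (g - (b + g *~ k)) = f g - f (b + g *~ k).
  by apply: fB => //; apply: clL.
have [s1 s1P E1] : exists2 s : seq V, (forall p, p \in s -> simple f p)
    & b + g *~ k = \sum_(p <- s) p.
  by apply: IH => //; lia.
have [s2 s2P E2] : exists2 s : seq V, (forall p, p \in s -> simple f p)
    & g - (b + g *~ k) = \sum_(p <- s) p.
  by apply: IH => //; lia.
have [s3 s3P E3] := join _ _ _ _ s1P E1 s2P E2.
by exists s3 => //; rewrite -E3 addrC subrK.
Qed.

Lemma simple_obtuse a : cl a -> 0 < f a -> exists2 p, simple f p & 0 < form a p.
Proof.
move=> ca fa; have [s sP as_] := simple_sum ca fa.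
apply: contrapT => np; have := root_norm_gt0 lars ca.1.
rewrite {1}as_ (rform_suml lars) ltNge big_seq sumr_le0 // => p ps.
by rewrite sym leNgt; apply/negP => ap; apply: np; exists p => //; apply: sP.
Qed.

(** How a positive root arises from smaller ones by adding simple roots; the last
    case is that of a root congruent to a simple one modulo the radical. *)
Lemma positive_cases a : cl a -> 0 < f a ->
  [\/ simple f a,
      exists2 p, simple f p & [/\ cl (a - p), 0 < f (a - p), f (a - p) < f a & 0 < ci a p]
    | exists p b, [/\ simple f p, cl b, 0 < f b < f a, ci b p = -2 & a = b + p + p]].
Proof.
move=> ca fa; have [sa|nsa] := pselect (simple f a); first by constructor 1.
have [p sp fap] := simple_obtuse ca fa; have [cp fp pmin] := sp.
have La := clL ca; have Lp := clL cp.
have nap : a != p by apply: contra_notN nsa => /eqP->.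
have ap_sp : Lsp (a - p) by apply: (subgroupB gsp); [case: ca | case: cp].
have fap' := fB La Lp; have [_ f0 fi] := fH.
have RI : R (a - p) \/ form (a - p) (a - p) = 0.
  apply: (root_add lars ca.1 (rootN lars cp.1)).
  by rewrite (rformNr lars) oppr_lt0.
have RI' : R (p - a) \/ form (p - a) (p - a) = 0.
  rewrite -opprB; case: RI => [/(rootN lars)|I0]; first by left.
  by right; rewrite (rformNl lars) (rformNr lars) opprK.
have pos : 0 < f (a - p).
  have : f (a - p) != 0.
    case: RI => RI; first by apply: f0.
    by apply: fi => //; rewrite ?subr_eq0 //; apply: span_lattice.
  rewrite neq_lt => /orP[|//]; rewrite fap' subr_lt0 => fap2.
  by case: (pmin a ca fa fap2 RI').
case: RI => [Rap|iap].
  by constructor 2; exists p => //; split=> //; rewrite ?(ci_gt0 lars) //; [lia | case: cp].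
have Rpm m : cl (p + (a - p) *~ m).
  split; last by apply: (subgroupD gsp); [case: cp | apply: (subgroupMz gsp)].
  by apply: root_translate => //; [case: cp | rewrite addrC subrK; case: ca].
have Rpa : cl (p - (a - p)) by have := Rpm (-1); rewrite mulrNz mulr1z.
have Lap : Lam (a - p) by apply: span_lattice.
have fpa : f (p - (a - p)) = f p - f (a - p) by rewrite fB.
have fneg : f (p - (a - p)) < 0.
  have := f0 _ Rpa; rewrite neq_lt => /orP[//|fpos].
  case: (pmin _ Rpa fpos); first by lia.
  by right; rewrite subKr.
constructor 3; exists p, (a - p - p); split=> //.
- by have := closureN Rpa; rewrite opprB.
- by rewrite fB // fap'; apply/andP; split; lia.
- rewrite (ciBl lars) (ciaa lars cp.1) (isotropic_ci0 lars) //; lra.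
- by rewrite !subrK.
Qed.

(** A subset of the simple roots orthogonal to its complement splits the whole
    closure, one positive root at a time. *)
Lemma closure_split (I : set V) : I `<=` simple f ->
  (forall p q, I p -> simple f q -> ~ I q -> form p q = 0) ->
  forall a, cl a -> int_span I a \/ int_span (simple f `\` I) a.
Proof.
move=> Is Iorth; set J := simple f `\` I.
have gI := int_span_subgroup I; have gJ := int_span_subgroup J.
have orth x y : int_span I x -> int_span J y -> form x y = 0.
  by apply: (int_span_orth lars) => p q Ip [sq nIq]; apply: Iorth.
have side p : simple f p -> int_span I p \/ int_span J p.
  move=> sp; have [Ip|nIp] := pselect (I p); first by left; apply: int_span_gen.
  by right; apply: int_span_gen.
have pos a : cl a -> 0 < f a -> int_span I a \/ int_span J a.
  have [n] := ubnP `|f a|%N; elim: n a => // n IH a fan ca fa.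
  have [sa|[p sp [cap fap fapa ap]]|[p [b [sp cb /andP[fb fba] bp aE]]]] := positive_cases ca fa.
  - exact: side.
  - have pp := root_norm_gt0 lars (let: And3 cp _ _ := sp in cp.1).
    have [[Rp Lp] fp pmin] := sp.
    have aa := root_norm_gt0 lars cap.1.
    (* if p and a - p lie on different sides, then a - 2p is a root as well *)
    have mixed : form (a - p) p = 0 -> form (a - p) p = 0 /\ (int_span I (a - p - p) \/ int_span J (a - p - p)).
      move=> app; split=> //.
      have Rapp : R (a - p - p).
        have := lars_reflection lars Rp ca.1.
        have -> : ci a p = 2.
          rewrite -[a](subrK p) (ciDl lars) (ciaa lars Rp).
          by move: (ci_eq0 lars (a - p) Rp); rewrite app eqxx => /eqP->; rewrite add0r.
        by rewrite scaler_nat mulr2n opprD addrA.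
      have capp : cl (a - p - p) by split=> //; apply: (subgroupB gsp) => //; case: cap.
      have fapp : f (a - p - p) = f (a - p) - f p.
        by apply: fB; [apply: clL|apply: span_lattice].
      have fpos : 0 < f (a - p - p).
        have [_ f0 _] := fH; have := f0 _ capp; rewrite neq_lt => /orP[fneg|//].
        case: (pmin (a - p) cap fap); first by rewrite -subr_lt0 -fapp.
        by left; have := rootN lars Rapp; rewrite opprB.
      by apply: IH => //; lia.
    have [Iap|Jap] : int_span I (a - p) \/ int_span J (a - p) by apply: IH => //; lia.
    + have [Ip|Jp] := side p sp; first by left; rewrite -[a](subrK p); apply: (subgroupD gI).
      have [app [Iapp|Japp]] := mixed (orth _ _ Iap Jp).
        have := orth _ _ Iapp Jp; rewrite (rformBl lars) app; lra.
      have := orth _ _ Iap Japp; rewrite (rformBr lars) app; lra.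
    + have [Ip|Jp] := side p sp; last by right; rewrite -[a](subrK p); apply: (subgroupD gJ).
      have pap : form (a - p) p = 0 by rewrite sym; apply: orth.
      have [app [Iapp|Japp]] := mixed pap.
        have := orth _ _ Iapp Jap; rewrite (rformBl lars) [form p _]sym app; lra.
      have := orth _ _ Ip Japp; rewrite (rformBr lars) [form p _]sym app; lra.
  - have [[Rp _] _ _] := sp.
    have nbp : form b p != 0 by rewrite -(ci_eq0 lars) // bp.
    have [Ib|Jb] : int_span I b \/ int_span J b by apply: IH => //; lia.
    + have [Ip|Jp] := side p sp; last by rewrite (orth _ _ Ib Jp) eqxx in nbp.
      by left; rewrite aE; do 2!apply: (subgroupD gI) => //.
    + have [Ip|Jp] := side p sp; first by rewrite sym (orth _ _ Ip Jb) eqxx in nbp.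
      by right; rewrite aE; do 2!apply: (subgroupD gJ) => //.
move=> a ca; have [_ f0 _] := fH; have := f0 _ ca; rewrite neq_lt => /orP[fneg|]; last exact: pos.
rewrite -[a]opprK; have [||Ia|Ja] := pos (- a); first exact: closureN.
- by rewrite fN ?oppr_gt0 //; apply: clL.
- by left; apply: (subgroupN gI).
- by right; apply: (subgroupN gJ).
Qed.

Hypothesis F0conn : forall P : set V,
  (forall a b, a \in F0 -> b \in F0 -> P a -> ~ P b -> form a b = 0) ->
  (forall a, a \in F0 -> P a) \/ (forall a, a \in F0 -> ~ P a).

Lemma simple_connected (I : set V) : I `<=` simple f ->
  (forall p q, I p -> simple f q -> ~ I q -> form p q = 0) ->
  (forall p, ~ I p) \/ simple f `<=` I.
Proof.
move=> Is Iorth; have split_ := closure_split Is Iorth; set J := simple f `\` I in split_.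
have F0cl a : a \in F0 -> cl a by move=> aF; split; [apply: F0R | apply: int_span_gen].
have orth x y : int_span I x -> int_span J y -> form x y = 0.
  by apply: (int_span_orth lars) => p q Ip [sq nIq]; apply: Iorth.
have [a b aF bF Ia nIb|allI|allJ] := F0conn (P := int_span I).
- by have [//|Jb] := split_ b (F0cl b bF); apply: orth.
- right=> q sq; apply: contrapT => nIq; have [[Rq Lq] _ _] := sq.
  have : int_span I q.
    move: q Lq {sq nIq Rq}; apply: int_span_min => //; exact: int_span_subgroup.
  move=> Iq; have := root_norm_gt0 lars Rq.
  by rewrite (orth q q) ?ltxx //; apply: int_span_gen.
- left=> p Ip; have [[Rp Lp] _ _] := Is _ Ip.
  have : int_span J p.
    move: p Lp {Ip Rp}; apply: int_span_min => [|a aF]; first exact: int_span_subgroup.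
    by have [/(allJ _ aF)|] := split_ a (F0cl a aF).
  move=> Jp; have := root_norm_gt0 lars Rp.
  by rewrite (orth p p) ?ltxx //; apply: int_span_gen.
Qed.

(** The two sides of a relation with separated signs have nonpositive product, so
    their common value u is isotropic. As u is orthogonal to every simple root,
    the support of its positive side is orthogonal to the other simple roots,
    hence is empty or contains all of them; then the heights add up to zero with
    one sign. *)
Lemma simple_indep : zindep (simple f).
Proof.
move=> s c us sS s0.
pose u := \sum_(p <- s | 0 < c p) p *~ c p.
pose w := \sum_(p <- s | c p < 0) p *~ c p.
have uw : u = - w.
  apply/eqP; rewrite -addr_eq0 /u /w; move: s0; rewrite (bigID (fun p => 0 < c p)) /=.
  rewrite [X in _ + X = _ -> _](bigID (fun p => c p < 0)) /=.
  rewrite [X in _ + (_ + X) = _ -> _]big1 ?addr0 => [|p /andP[]]; last first.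
    by rewrite -!leNgt => cp0 cp0'; have -> : c p = 0 by lia.
  move=> E; apply/eqP; rewrite -[RHS]E; congr (_ + _); apply: eq_bigl => p.
  by apply/idP/andP => [|[]//]; rewrite -leNgt; lia.
have uq q : simple f q -> ~ (q \in s /\ 0 < c q) -> form u q <= 0.
  move=> sq nq; rewrite /u (rform_suml lars) big_seq_cond sumr_le0 // => p /andP[ps cp].
  rewrite (rformMzl lars) -mulrzr mulr_le0_ge0 ?ler0z ?(ltW cp) //.
  by apply: simple_le0 => //; [apply: sS | apply/eqP => pq; apply: nq; rewrite -pq].
have uu : form u u = 0.
  apply/eqP; rewrite eq_le (form_psd lars) andbT {2}uw (rformNr lars) oppr_le0 /w.
  rewrite sym (rform_suml lars) big_seq_cond sumr_ge0 // => q /andP[qs cq].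
  rewrite (rformMzl lars) -mulrzr sym mulr_le0 ?lerz0 ?(ltW cq) //.
  by apply: uq; [apply: sS | case=> _; rewrite ltNge (ltW cq)].
have urad := isotropic_radical lars.
have w0 : \sum_(p <- s) f p * c p = 0.
  have := congr1 f s0; rewrite (additive_on_sum gL fadd) => [|p ps]; last first.
    by apply: (subgroupMz gL); apply: clL; case: (sS _ ps).
  rewrite (additive_on0 gL fadd) => E; rewrite -[RHS]E; apply: eq_big_seq => p ps.
  by rewrite fMz ?mulrzz //; apply: clL; case: (sS _ ps).
pose I : set V := [set p | p \in s /\ 0 < c p].
have Is : I `<=` simple f by move=> p [/sS].
have [p q [ps cp] sq nIq|nI|allI] := simple_connected Is.
- have Lq0 r : r \in s -> 0 < c r -> form r q * (c r)%:~R <= 0.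
    move=> rs cr; rewrite mulr_le0_ge0 ?ler0z ?(ltW cr) //.
    by apply: simple_le0 => //; [apply: sS | apply/eqP => rq; apply: nIq; rewrite -rq].
  have := urad u q uu; rewrite /u (rform_suml lars) -big_filter.
  rewrite (bigD1_seq p) ?mem_filter ?cp ?filter_uniq //= => E.
  have : form p q * (c p)%:~R = 0.
    apply/eqP; rewrite eq_le Lq0 //= mulrzr -(rformMzl lars).
    move/eqP: E; rewrite addr_eq0 => /eqP->; rewrite oppr_ge0 big_seq_cond.
    apply: sumr_le0 => r; rewrite mem_filter => /andP[/andP[cr rs] _].
    by rewrite (rformMzl lars) -mulrzr Lq0.
  by move/eqP; rewrite mulf_eq0 intr_eq0 (gt_eqF cp) orbF => /eqP.
- have cle p : p \in s -> c p <= 0 by move=> ps; rewrite leNgt; apply/negP => cp; apply: (nI p).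
  move=> p ps; have := cle p ps; rewrite le_eqVlt => /orP[/eqP//|cp].
  have fp : 0 < f p by case: (sS _ ps).
  have : \sum_(p <- s) f p * c p < 0.
    rewrite (bigD1_seq p) //= ltr_wnDr //; last by rewrite pmulr_rlt0.
    rewrite big_seq_cond sumr_le0 // => q /andP[qs _].
    by rewrite mulr_ge0_le0 ?cle //; case: (sS _ qs) => _ /ltW.
  by rewrite w0 ltxx.
- have cge p : p \in s -> 0 < c p by move=> /sS/allI[].
  move=> p ps; have cp := cge p ps.
  have fp : 0 < f p by case: (sS _ ps).
  have : 0 < \sum_(p <- s) f p * c p.
    rewrite (bigD1_seq p) //= ltr_wpDr //; last by rewrite mulr_gt0.
    rewrite big_seq_cond sumr_ge0 // => q /andP[qs _].
    by rewrite mulr_ge0 ?(ltW (cge q qs)) //; case: (sS _ qs) => _ /ltW.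
  by rewrite w0 ltxx.
Qed.

End Fixed.

End SimpleRoots.

Section Connected.
Variables (V : lmodType rat) (form : V -> V -> rat) (R : set V).
Hypothesis lars : locally_affine_root_system form R.
Implicit Types (a b : V) (F : seq V) (P : set V).

(** Connectedness is phrased with predicates instead of chains: no partition into
    two nonempty mutually orthogonal parts. *)
Definition connected_roots F : Prop := (forall a, a \in F -> R a) /\
  forall P, (forall a b, a \in F -> b \in F -> P a -> ~ P b -> form a b = 0) ->
  (forall a, a \in F -> P a) \/ (forall a, a \in F -> ~ P a).

Let conn_cat F G a : a \in F -> a \in G -> connected_roots F -> connected_roots G ->
  connected_roots (F ++ G).
Proof.
move=> aF aG [FR Fc] [GR Gc]; split=> [b|P orth].
  by rewrite mem_cat => /orP[/FR|/GR].
have [b c bF cF||] := Fc P.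
- by apply: orth; rewrite mem_cat ?bF ?cF.
- move=> FP; have [b c bG cG|GP|GP] := Gc P; last by case: (GP _ aG); apply: FP.
    by apply: orth; rewrite mem_cat ?bG ?cG orbT.
  by left=> b; rewrite mem_cat => /orP[/FP|/GP].
- move=> FP; have [b c bG cG|GP|GP] := Gc P; last 2 first.
  + by case: (FP _ aF); apply: GP.
  + by right=> b; rewrite mem_cat => /orP[/FP|/GP].
  by apply: orth; rewrite mem_cat ?bG ?cG orbT.
Qed.

(** By irreducibility any two roots lie in a finite connected list. *)
Lemma connected_cover F : (forall a, a \in F -> R a) ->
  exists2 G, connected_roots G & {subset F <= G}.
Proof.
case: F => [|a0 F] FR.
  by exists [::] => //; split=> // P _; left.
have R0 : R a0 by apply: FR; rewrite inE eqxx.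
have join b : R b -> exists G, [/\ connected_roots G, a0 \in G & b \in G].
  pose R1 := [set b | R b /\ exists G, [/\ connected_roots G, a0 \in G & b \in G]].
  have one c : R c -> connected_roots [:: c].
    move=> Rc; split=> [d|P orth]; first by rewrite inE => /eqP->.
    have [Pc|nPc] := pselect (P c); [left|right]; by move=> d; rewrite inE => /eqP->.
  have [|c d [Rc [G [Gc aG cG]]] [Rd nd]|R10|R20] := @lars_irreducible _ _ _ lars R1 (R `\` R1).
  - apply/seteqP; split=> c; last by case=> [[]|[]].
    by move=> Rc; have [?|?] := pselect (R1 c); [left|right].
  - apply/eqP; apply: contraT => cd0; case: nd; split=> //.
    exists (G ++ [:: d]); split; [|by rewrite mem_cat aG|by rewrite mem_cat inE eqxx orbT].
    split=> [b'|P orth]; first by rewrite mem_cat inE => /orP[/Gc.1|/eqP->].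
    have cGd : c \in G ++ [:: d] by rewrite mem_cat cG.
    have dGd : d \in G ++ [:: d] by rewrite mem_cat inE eqxx orbT.
    have [e e' eG eG'|GP|GP] := Gc.2 P.
    + by apply: orth; rewrite mem_cat ?eG ?eG'.
    + have [Pd|nPd] := pselect (P d).
        by left=> e; rewrite mem_cat inE => /orP[/GP|/eqP->].
      have E := orth c d cGd dGd (GP _ cG) nPd.
      by rewrite E eqxx in cd0.
    + have [Pd|nPd] := pselect (P d); last first.
        by right=> e; rewrite mem_cat inE => /orP[/GP|/eqP->].
      have E := orth d c dGd cGd Pd (GP _ cG).
      by rewrite (form_sym lars) E eqxx in cd0.
  - have : R1 a0 by split=> //; exists [:: a0]; split; rewrite ?inE //; apply: one.
    by rewrite R10.
  - move=> Rb; apply: contrapT => nb; suff : (R `\` R1) b by rewrite R20.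
    by split=> // -[_].
have : forall b, b \in F -> R b by move=> b bF; apply: FR; rewrite inE bF orbT.
elim: F {FR} => [_|b F IH FR].
  have [G [Gc aG _]] := join a0 R0; exists G => // b; by rewrite inE => /eqP->.
have [|G Gc FG] := IH; first by move=> c cF; apply: FR; rewrite inE cF orbT.
have [|H [Hc aH bH]] := join b; first by apply: FR; rewrite inE eqxx.
exists (G ++ H); first by apply: (conn_cat (a := a0)) => //; apply: FG; rewrite inE eqxx.
move=> c; rewrite !inE mem_cat => /or3P[/eqP->|/eqP->|cF].
- by rewrite aH orbT.
- by rewrite bH orbT.
- by rewrite FG // inE cF orbT.
Qed.

End Connected.

(** * Lie algebras graded by weights *)

Section LieBasics.
Variables (K : fieldType) (g : lieAlgType K).
Implicit Types (x y z : g) (k : K).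

Lemma bracketDl x y z : bracket (x + y) z = bracket x z + bracket y z.
Proof. by have := bracket_linearl z 1 x y; rewrite /= !scale1r. Qed.

Lemma bracketDr x y z : bracket z (x + y) = bracket z x + bracket z y.
Proof. by have := bracket_linearr z 1 x y; rewrite /= !scale1r. Qed.

Lemma bracket0l z : bracket 0 z = 0.
Proof. by apply: (addrI (bracket 0 z)); rewrite -bracketDl !addr0. Qed.

Lemma bracket0r z : bracket z 0 = 0.
Proof. by apply: (addrI (bracket z 0)); rewrite -bracketDr !addr0. Qed.

Lemma bracketZl k x z : bracket (k *: x) z = k *: bracket x z.
Proof. by have := bracket_linearl z k x 0; rewrite /= bracket0l !addr0. Qed.

Lemma bracketZr k x z : bracket z (k *: x) = k *: bracket z x.
Proof. by have := bracket_linearr z k x 0; rewrite /= bracket0r !addr0. Qed.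

Lemma bracketNl x z : bracket (- x) z = - bracket x z.
Proof. by rewrite -scaleN1r bracketZl scaleN1r. Qed.

Lemma bracketNr x z : bracket z (- x) = - bracket z x.
Proof. by rewrite -scaleN1r bracketZr scaleN1r. Qed.

Lemma bracketC x y : bracket x y = - bracket y x.
Proof.
apply/eqP; rewrite -addr_eq0; have := bracketxx (x + y).
by rewrite bracketDl !bracketDr !bracketxx add0r addr0 => ->.
Qed.

Lemma bracket_jacobi x y z :
  bracket x (bracket y z) = bracket (bracket x y) z + bracket y (bracket x z).
Proof.
have /eqP := jacobi x y z; rewrite -addrA addr_eq0 => /eqP->.
by rewrite opprD addrC [bracket z (bracket _ _)]bracketC opprK [bracket z x]bracketC bracketNr opprK.
Qed.

Lemma bracket_sumr (I : Type) (r : seq I) (P : pred I) (F : I -> g) z :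
  bracket z (\sum_(i <- r | P i) F i) = \sum_(i <- r | P i) bracket z (F i).
Proof. by elim/big_ind2: _ => [|? ? ? ? <- <-|//]; rewrite ?bracket0r ?bracketDr. Qed.

Definition sl2_triple (e f h : g) : Prop :=
  [/\ bracket e f = h, bracket h e = 2 *: e, bracket h f = (-2) *: f,
      ad_locally_nilpotent e & ad_locally_nilpotent f].

Lemma sl2_triple_sym e f h : sl2_triple e f h -> sl2_triple f e (- h).
Proof.
case=> ef he hf ne nf; split=> //; first by rewrite bracketC ef.
  by rewrite bracketNl hf scaleNr opprK.
by rewrite bracketNl he scaleNr.
Qed.

End LieBasics.

Section Sl2.
Variables (K : fieldType) (K0 : [pchar K] =i pred0) (g : lieAlgType K).
Implicit Types (e f h x y : g) (m : K).

Let natr_neq0 n : (n.+1)%:R != 0 :> K.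
Proof. by rewrite (pcharf0P K).1. Qed.

Lemma sl2_weight e f h x m k : sl2_triple e f h -> bracket h x = m *: x ->
  bracket h (iter k (bracket f) x) = (m - (2 * k)%:R) *: iter k (bracket f) x.
Proof.
case=> _ _ hf _ _ hx; elim: k => [|k IH]; first by rewrite /= muln0 subr0.
rewrite iterS bracket_jacobi hf bracketZl IH bracketZr -scalerDl.
by congr (_ *: _); rewrite mulnS natrD; ring.
Qed.

Lemma sl2_commute e f h x m k : sl2_triple e f h -> bracket h x = m *: x ->
  bracket e (iter k.+1 (bracket f) x) = iter k.+1 (bracket f) (bracket e x)
     + (k.+1%:R * (m - k%:R)) *: iter k (bracket f) x.
Proof.
move=> sl hx; have [ef _ _ _ _] := sl; elim: k => [|k IH].
  by rewrite /= bracket_jacobi ef hx mul1r subr0 addrC.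
rewrite iterS bracket_jacobi ef (sl2_weight _ sl hx) IH bracketDr bracketZr.
rewrite addrCA -iterS -[bracket f (iter k _ _)]iterS; congr (_ + _).
rewrite -scalerDl; congr (_ *: _).
by rewrite mul2n -addnn -[k.+2]addn1 -[k.+1]addn1 !natrD; ring.
Qed.

(** Induction on the number of applications of e that annihilate x: the vector
    e x has weight m + 2 and is annihilated by the power m + 2 of f, so it
    vanishes; then e takes the iterates of f on x back to nonzero multiples of
    the previous ones. *)
Lemma sl2_inj e f h x (m : nat) : sl2_triple e f h -> bracket h x = m%:R *: x ->
  iter m (bracket f) x = 0 -> x = 0.
Proof.
move=> sl; have [ef he _ ne _] := sl.
have [n] := ne x; elim: n x m => [//|n IH] x m enx hx fx.
have f0 k : iter k (bracket f) (0 : g) = 0.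
  by elim: k => // k /= ->; rewrite bracket0r.
have ex0 : bracket e x = 0.
  apply: (IH _ m.+2); first by rewrite -iterSr.
    rewrite bracket_jacobi he hx bracketZl bracketZr -scalerDl.
    by congr (_ *: _); rewrite -[m.+2]addn2 natrD addrC.
  have := sl2_commute m.+1 sl hx.
  have fm : iter m.+1 (bracket f) x = 0 by rewrite iterS fx bracket0r.
  by rewrite fm scaler0 addr0 iterS fm bracket0r bracket0r => <-.
elim: m x fx hx ex0 {enx} => [//|m IHm] x fx hx ex0.
have : iter m (bracket f) x = 0.
  have := sl2_commute m sl hx; rewrite fx bracket0r ex0 f0 add0r => /esym/eqP.
  rewrite scaler_eq0 => /orP[|/eqP//].
  by rewrite -natrB // subSnn mulr1 (negPf (natr_neq0 m)).
have low j : (j <= m)%N -> iter j (bracket f) x = 0 -> x = 0.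
  elim: j => // j IHj jm fj; apply: IHj; first exact: ltnW.
  have := sl2_commute j sl hx; rewrite fj bracket0r ex0 f0 add0r => /esym/eqP.
  rewrite scaler_eq0 => /orP[|/eqP//].
  rewrite -natrB; last by apply: leq_trans (leqnSn m); apply: ltnW.
  rewrite mulf_eq0 (negPf (natr_neq0 j)) /= subSn ?(ltnW jm) //.
  by rewrite (negPf (natr_neq0 _)).
exact: low.
Qed.

Lemma sl2_fx_neq0 e f h x (m : nat) : sl2_triple e f h ->
  bracket h x = m.+1%:R *: x -> x != 0 -> bracket f x != 0.
Proof.
move=> sl hx; apply: contra_neq => fx; apply: (sl2_inj sl hx).
by rewrite iterSr fx; elim: m {hx} => //= m ->; rewrite bracket0r.
Qed.

(** If e annihilated f x, it would annihilate the iterate of f on x of weight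
    - (m + 1), which is nonzero and on which the power m + 1 of e is injective. *)
Lemma sl2_efx_neq0 e f h x (m : nat) : sl2_triple e f h ->
  bracket h x = m.+1%:R *: x -> x != 0 -> bracket e (bracket f x) != 0.
Proof.
move=> sl hx x0; have [ef he hf _ _] := sl.
apply/eqP => ey; set y := bracket f x in ey.
have hy : bracket h y = (m.+1%:R - 2) *: y.
  by have := sl2_weight 1 sl hx.
have z0 : iter m (bracket f) y != 0.
  by apply: contra_neq x0; rewrite -iterSr; apply: sl2_inj sl hx.
have ez : bracket e (iter m (bracket f) y) = 0.
  case: m {hx z0} hy => [//|m] hy; rewrite (sl2_commute _ sl hy) ey.
  have -> : iter m.+1 (bracket f) (0 : g) = 0.
    by elim: m.+1 => // k /= ->; rewrite bracket0r.
  have -> : m.+2%:R - 2 - m%:R = 0 :> K by rewrite -[m.+2]addn2 natrD; ring.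
  by rewrite mulr0 scale0r addr0.
move/eqP: z0; apply; apply: (@sl2_inj f e (- h) _ m.+1 (sl2_triple_sym sl)).
  rewrite bracketNl (sl2_weight _ sl hy) -scaleNr; congr (_ *: _).
  by rewrite mul2n -addnn -[m.+1]addn1 !natrD; ring.
rewrite iterSr ez; elim: m {hx hy ez} => //= m ->; exact: bracket0r.
Qed.

End Sl2.

Section ProductLie.
Variables (K : fieldType) (g1 g2 : lieAlgType K).

Definition prod_bracket (z w : g1 * g2) : g1 * g2 :=
  (bracket z.1 w.1, bracket z.2 w.2).

Fact prod_bracket_linearl w : linear (prod_bracket^~ w).
Proof. by move=> k z z'; congr (_, _); apply: bracket_linearl. Qed.

Fact prod_bracket_linearr w : linear (prod_bracket w).
Proof. by move=> k z z'; congr (_, _); apply: bracket_linearr. Qed.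

Fact prod_bracketxx z : prod_bracket z z = 0.
Proof. by congr (_, _); apply: bracketxx. Qed.

Fact prod_jacobi x y z : prod_bracket x (prod_bracket y z)
  + prod_bracket y (prod_bracket z x) + prod_bracket z (prod_bracket x y) = 0.
Proof. by congr (_, _); apply: jacobi. Qed.

HB.instance Definition _ := isLieAlgebra.Build K (g1 * g2)%type
  prod_bracket_linearl prod_bracket_linearr prod_bracketxx prod_jacobi.

End ProductLie.

Section Homogeneous.
Variables (K : fieldType) (g : lieAlgType K) (V : zmodType).
Implicit Types (S : V -> set g) (a b : V) (z : g).

(** A graded subalgebra is presented by its homogeneous elements together with
    their degrees, so that no direct sum has to be formed. *)
Inductive hgen S : V -> g -> Prop :=
| hgen_gen a z : S a z -> hgen S a z
| hgen_lin a k z z' : hgen S a z -> hgen S a z' -> hgen S a (k *: z + z')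
| hgen_bracket a b z z' : hgen S a z -> hgen S b z' -> hgen S (a + b) (bracket z z').

Lemma hgen0 S a z : hgen S a z -> hgen S a 0.
Proof. by move=> az; rewrite -(addNr z) -scaleN1r; apply: hgen_lin. Qed.

Lemma hgenZ S a k z : hgen S a z -> hgen S a (k *: z).
Proof. by move=> az; rewrite -[_ *: _]addr0; apply: hgen_lin => //; apply: hgen0 az. Qed.

Lemma hgenD S a z z' : hgen S a z -> hgen S a z' -> hgen S a (z + z').
Proof. by move=> az az'; rewrite -[z]scale1r; apply: hgen_lin. Qed.

Lemma hgen_sub S S' : (forall a z, S a z -> hgen S' a z) ->
  forall a z, hgen S a z -> hgen S' a z.
Proof.
move=> SS' a z; elim=> {a z} [a z /SS'//|a k z z' _ az _ az'|a b z z' _ az _ bz'].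
  exact: hgen_lin.
exact: hgen_bracket.
Qed.

Definition homogeneous_closed (G : V -> set g) : Prop :=
  [/\ forall a, G a 0, forall a k x y, G a x -> G a y -> G a (k *: x + y)
    & forall a b x y, G a x -> G b y -> G (a + b) (bracket x y)].

Lemma hgen_min S G : homogeneous_closed G -> (forall a z, S a z -> G a z) ->
  forall a z, hgen S a z -> G a z.
Proof.
move=> [_ Gl Gb] SG a z.
by elim=> {a z} [a z /SG//|a k z z' _ az _ az'|a b z z' _ az _ bz']; [apply: Gl|apply: Gb].
Qed.

Lemma hgen_degree S (P : set V) : subgroup P -> (forall a z, S a z -> P a) ->
  forall a z, hgen S a z -> P a.
Proof. by move=> gP SP a z; elim=> {a z} [a z /SP//|//|a b z z' _ Pa _ Pb]; apply: (subgroupD gP). Qed.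

End Homogeneous.

Section Radical.
Variables (K : fieldType) (g : lieAlgType K).
Variables (V : lmodType rat) (form : V -> V -> rat) (R : set V).
Hypothesis lars : locally_affine_root_system form R.
Variables (G S : V -> set g).
Hypothesis Gclosed : homogeneous_closed G.
Hypothesis Groot : forall a x, form a a != 0 -> ~ R a -> G a x -> x = 0.
Hypothesis SG : forall a z, S a z -> R a /\ G a z.

Inductive bracket_sum (T : V -> set g) (a : V) : g -> Prop :=
| bracket_sum0 : bracket_sum T a 0
| bracket_sumD k b c y z w : R b -> R c -> b + c = a -> T b y -> T c z ->
    bracket_sum T a w -> bracket_sum T a (k *: bracket y z + w).

Lemma bracket_sum_lin T a k x y : bracket_sum T a x -> bracket_sum T a y ->
  bracket_sum T a (k *: x + y).
Proof.
move=> xs ys; elim: xs => [|l b c u v w Rb Rc bc Tu Tv _ IH].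
  by rewrite scaler0 add0r.
by rewrite scalerDr scalerA -addrA; apply: (bracket_sumD (k * l) Rb Rc bc Tu Tv IH).
Qed.

Lemma bracket_sum_mem T a b c y z : R b -> R c -> b + c = a -> T b y -> T c z ->
  bracket_sum T a (bracket y z).
Proof.
move=> Rb Rc bc Ty Tz; rewrite -[bracket y z]scale1r -[_ *: _]addr0.
exact: (bracket_sumD 1 Rb Rc bc Ty Tz (bracket_sum0 T a)).
Qed.

(** When z has isotropic degree and x, y have root degrees with an isotropic sum,
    the Jacobi identity turns the bracket of [x, y] with z into brackets of x with
    [y, z] and of y with [x, z]; the degrees of [y, z] and [x, z] are nonisotropic,
    hence roots unless the element vanishes. *)
Lemma hgen_isotropic a z : hgen S a z -> form a a = 0 -> bracket_sum (hgen S) a z.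
Proof.
have SG' b w : hgen S b w -> G b w.
  by apply: hgen_min => // c y /SG[].
elim=> {a z} [a z /SG[Ra _] aa|a k z z' _ IH _ IH' aa|a b z z' az IH bz IH' ab].
- by have := root_norm_gt0 lars Ra; rewrite aa ltxx.
- by apply: bracket_sum_lin; [apply: IH|apply: IH'].
have real c d x y : hgen S c x -> hgen S d y -> c + d = a + b ->
    form c c != 0 -> form d d != 0 -> bracket_sum (hgen S) (a + b) (bracket x y).
  move=> cx dy cd cc dd; have [Rc|nRc] := pselect (R c); last first.
    by rewrite (Groot cc nRc (SG' _ _ cx)) bracket0l; apply: bracket_sum0.
  have [Rd|nRd] := pselect (R d); last first.
    by rewrite (Groot dd nRd (SG' _ _ dy)) bracket0r; apply: bracket_sum0.
  exact: (bracket_sum_mem Rc Rd cd cx dy).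
have [aa|aa] := eqVneq (form a a) 0; last first.
  have [bb|bb] := eqVneq (form b b) 0; last exact: (real _ _ _ _ az bz erefl aa).
  by move: aa; rewrite -(isotropicD lars a bb) [b + a]addrC ab eqxx.
have bb : form b b = 0 by rewrite -(isotropicD lars b aa).
elim: (IH aa) => [|k c d x y w Rc Rd cd cx dy _ IHw].
  by rewrite bracket0l; apply: bracket_sum0.
rewrite bracketDl bracketZl; apply: bracket_sum_lin => //.
have cc := lars_nonisotropic lars Rc; have dd := lars_nonisotropic lars Rd.
have -> : bracket (bracket x y) z' = bracket x (bracket y z') - bracket y (bracket x z').
  by rewrite [bracket x (bracket y z')]bracket_jacobi addrK.
rewrite [X in bracket_sum _ _ X]addrC -scaleN1r; apply: bracket_sum_lin.
  apply: (real d (c + b) y) => //; first exact: hgen_bracket.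
    by rewrite -cd addrA [d + c]addrC.
  by rewrite addrC (isotropicD lars).
apply: (real c (d + b) x) => //; first exact: hgen_bracket.
  by rewrite -cd addrA.
by rewrite addrC (isotropicD lars).
Qed.

End Radical.

(** * Triangular decomposition *)

Section NilPart.
Variables (K : fieldType) (g : lieAlgType K) (V : zmodType).
Variables (E : V -> g).
Implicit Types (P : set V) (a b p q : V) (z : g).

(** Iterated brackets formed by applying one generator at a time; they span the
    subalgebra generated by the E p. *)
Inductive nil_part P : V -> g -> Prop :=
| nil_part0 a : nil_part P a 0
| nil_part_gen p : P p -> nil_part P p (E p)
| nil_part_lin a k z z' : nil_part P a z -> nil_part P a z' ->
    nil_part P a (k *: z + z')
| nil_part_ad p a z : P p -> nil_part P a z -> nil_part P (p + a) (bracket (E p) z).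

Inductive cartan_part P : V -> g -> Prop :=
| cartan_part0 a : cartan_part P a 0
| cartan_part_lin p k z : P p -> cartan_part P 0 z ->
    cartan_part P 0 (k *: bracket (E p) (E (- p)) + z).

Definition triangular P M a z : Prop := exists z1 z0 z2,
  [/\ nil_part P a z1, cartan_part P a z0, nil_part M a z2 & z = z1 + z0 + z2].

Lemma cartan_part_comb P a k z z' : cartan_part P a z -> cartan_part P a z' ->
  cartan_part P a (k *: z + z').
Proof.
move=> az; elim: az z' => {a z} [a z' az'|p l z Pp _ IH z' az'].
  by rewrite scaler0 add0r.
by rewrite scalerDr scalerA -addrA; apply: cartan_part_lin => //; apply: IH.
Qed.

Lemma cartan_part_degree P a z : cartan_part P a z -> a = 0 \/ z = 0.
Proof. by case=> {a z} [a|p k z _ _]; [right | left]. Qed.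

End NilPart.

Section Triangular.
Variables (K : fieldType) (g : lieAlgType K) (V : zmodType).
Variables (G : V -> set g) (E : V -> g).
Hypothesis Gclosed : homogeneous_closed G.
Implicit Types (P M : set V) (a b p q : V) (z : g).

(** The relations of Chevalley generators, without the Serre relations. *)
Definition opposite_gens P M : Prop := exists c : V -> V -> K,
  [/\ (forall p, P p -> M (- p)) /\ (forall p, M p -> P (- p)),
      forall p, P p \/ M p -> G p (E p),
      forall p b x, P p -> G b x -> bracket (bracket (E p) (E (- p))) x = c p b *: x
    & forall p q, P p -> P q -> p != q -> bracket (E p) (E (- q)) = 0].

Lemma opposite_gens_sym P M : opposite_gens P M -> opposite_gens M P.
Proof.
case=> c [[PM MP] EG Hc orth]; exists (fun p b => - c (- p) b); split=> //.
- by move=> p [Mp|Pp]; apply: EG; [right|left].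
- move=> p b x /MP Pp Gx; rewrite [bracket (E p) _]bracketC bracketNl.
  by have := Hc (- p) b x Pp Gx; rewrite opprK scaleNr => ->.
- move=> p q /MP Pp /MP Pq pq; rewrite bracketC.
  by have := orth (- q) (- p) Pq Pp; rewrite opprK => -> //; rewrite ?oppr0 // eqr_opp eq_sym.
Qed.

Section Ad.
Variables (P M : set V) (PM : opposite_gens P M).

(** Applied to an iterated bracket of negative generators, a positive one removes
    one of them; the Cartan part arises only from a single generator. *)
Lemma ad_nil_part p a z : P p -> nil_part E M a z -> exists z0 z2,
  [/\ cartan_part E P (p + a) z0, nil_part E M (p + a) z2
    & bracket (E p) z = z0 + z2].
Proof.
have [c [[PM' MP] EG Hc orth]] := PM; move=> Pp.
have MG b w : nil_part E M b w -> G b w.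
  have [G0 Gl Gb] := Gclosed.
  elim=> {b w} [b|q Mq|b k z1 z1' _ bz _ bz'|q b z1 Mq _ bz]; [exact: G0| |exact: Gl|].
    by apply: EG; right.
  by apply: Gb => //; apply: EG; right.
elim=> {a z} [a|q Mq|a k z z' az [z0 [z2 [h0 h2 E0]]] az' [z0' [z2' [h0' h2' E0']]]
             |q a z Mq az [z0 [z2 [h0 h2 E0]]]].
- by exists 0, 0; split; [apply: cartan_part0|apply: nil_part0|rewrite bracket0r addr0].
- have Pq := MP _ Mq; have [->|pq] := eqVneq p (- q).
    exists (bracket (E (- q)) (E q)), 0; split; last by rewrite addr0.
      rewrite addNr; have := cartan_part_lin 1 Pq (cartan_part0 E P 0).
      by rewrite scale1r addr0 opprK.
    exact: nil_part0.
  have := orth _ _ Pp Pq pq; rewrite opprK => ->.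
  by exists 0, 0; split; [apply: cartan_part0|apply: nil_part0|rewrite addr0].
- exists (k *: z0 + z0'), (k *: z2 + z2'); split.
  + exact: cartan_part_comb.
  + exact: nil_part_lin.
  + by rewrite bracketDr bracketZr E0 E0' scalerDr addrACA.
have Pq := MP _ Mq.
have first : nil_part E M (p + (q + a)) (bracket (bracket (E p) (E q)) z).
  have [->|pq] := eqVneq p (- q).
    have := Hc (- q) a z Pq (MG _ _ az); rewrite opprK addKr => ->.
    by rewrite -[_ *: z]addr0; apply: nil_part_lin => //; apply: nil_part0.
  have := orth _ _ Pp Pq pq; rewrite opprK => ->; rewrite bracket0l.
  exact: nil_part0.
have second : nil_part E M (p + (q + a)) (bracket (E q) (bracket (E p) z)).
  rewrite E0 bracketDr addrCA -[bracket _ _ + _]addr0 -[_ + _ + 0]scale1r.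
  rewrite scale1r addr0 -[bracket (E q) z0]scale1r; apply: nil_part_lin; last first.
    exact: nil_part_ad.
  have [->|->] := cartan_part_degree h0; last by rewrite bracket0r; apply: nil_part0.
  rewrite addr0; elim: h0 => {z0 E0} [b|r k w Pr _ IH].
    by rewrite bracket0r; apply: nil_part0.
  rewrite bracketDr bracketZr; apply: nil_part_lin => //.
  rewrite bracketC (Hc r q) //; last by apply: EG; right.
  rewrite -scaleNr -[_ *: _]addr0; apply: nil_part_lin; last exact: nil_part0.
  exact: nil_part_gen.
exists 0, (bracket (E p) (bracket (E q) z)); split; [exact: cartan_part0| |by rewrite add0r].
rewrite bracket_jacobi -[bracket (bracket _ _) _]scale1r.
exact: nil_part_lin.
Qed.

Lemma ad_cartan_part p a z : P p -> cartan_part E P a z ->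
  nil_part E P (p + a) (bracket (E p) z).
Proof.
have [c [[PM' MP] EG Hc orth]] := PM; move=> Pp.
elim=> {a z} [a|q k z Pq _ IH]; first by rewrite bracket0r; apply: nil_part0.
rewrite bracketDr bracketZr; apply: nil_part_lin => //.
rewrite bracketC (Hc q p) //; last by apply: EG; left.
rewrite addr0 -scaleNr -[_ *: _]addr0; apply: nil_part_lin; last exact: nil_part0.
exact: nil_part_gen.
Qed.

Lemma nil_part_add (Q : set V) a z z' : nil_part E Q a z -> nil_part E Q a z' ->
  nil_part E Q a (z + z').
Proof. by move=> az az'; rewrite -[z]scale1r; apply: nil_part_lin. Qed.

Lemma ad_triangular p a z : P p -> triangular E P M a z ->
  triangular E P M (p + a) (bracket (E p) z).
Proof.
move=> Pp [z1 [z0 [z2 [h1 h0 h2 ->]]]].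
have [w0 [w2 [k0 k2 E2]]] := ad_nil_part Pp h2.
exists (bracket (E p) z1 + bracket (E p) z0), w0, w2; split=> //.
  by apply: nil_part_add; [apply: nil_part_ad|apply: ad_cartan_part].
by rewrite !bracketDr E2 addrA.
Qed.

End Ad.

Lemma triangular_swap P M a z : opposite_gens P M -> triangular E P M a z ->
  triangular E M P a z.
Proof.
case=> c [[PM MP] _ _ _] [z1 [z0 [z2 [h1 h0 h2 ->]]]].
exists z2, z0, z1; split=> //; last by rewrite [RHS]addrC [z2 + z0]addrC addrA.
elim: h0 => {a z0 h1 h2} [a|p k z0 Pp _ IH]; first exact: cartan_part0.
rewrite bracketC scalerN -scaleNr -{2}[p]opprK; apply: cartan_part_lin => //.
exact: PM.
Qed.

Lemma triangular_lin P M a k z z' : triangular E P M a z -> triangular E P M a z' ->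
  triangular E P M a (k *: z + z').
Proof.
move=> [z1 [z0 [z2 [h1 h0 h2 ->]]]] [w1 [w0 [w2 [k1 k0 k2 ->]]]].
exists (k *: z1 + w1), (k *: z0 + w0), (k *: z2 + w2); split.
- exact: nil_part_lin.
- exact: cartan_part_comb.
- exact: nil_part_lin.
- by rewrite !scalerDr addrACA [k *: z1 + _ + _]addrACA.
Qed.

Definition opp_gens P M : V -> set g := fun a => [set z | (P a \/ M a) /\ z = E a].

(** The triangular sum is stable under the generators, hence under the whole
    algebra that they generate, which therefore lies in it. *)
Lemma hgen_triangular P M : opposite_gens P M ->
  forall a z, hgen (opp_gens P M) a z -> triangular E P M a z.
Proof.
move=> PM.
have stab b y : hgen (opp_gens P M) b y -> forall a z, triangular E P M a z ->
    triangular E P M (b + a) (bracket y z).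
  elim=> {b y} [b y [[Pb|Mb] ->] a z az|b k y y' _ IH _ IH' a z az|b c y y' _ IH _ IH' a z az].
  - exact: (ad_triangular PM).
  - apply: triangular_swap; first exact: opposite_gens_sym.
    apply: (ad_triangular (opposite_gens_sym PM)) => //.
    exact: triangular_swap az.
  - by rewrite bracketDl bracketZl; apply: triangular_lin; [apply: IH|apply: IH'].
  - have -> : bracket (bracket y y') z = bracket y (bracket y' z) - bracket y' (bracket y z).
      by rewrite [bracket y (bracket y' z)]bracket_jacobi addrK.
    rewrite [X in triangular _ _ _ _ X]addrC -scaleN1r; apply: triangular_lin.
      by rewrite [b + c]addrC -addrA; apply: IH'; apply: IH.
    by rewrite -addrA; apply: IH; apply: IH'.
move=> a z; elim=> {a z} [a z [[Pa|Ma] ->]|a k z z' _ IH _ IH'|a b z z' az _ _ IH'].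
- by exists (E a), 0, 0; split; [exact: nil_part_gen|exact: cartan_part0
    |exact: nil_part0|rewrite !addr0].
- by exists 0, 0, (E a); split; [exact: nil_part0|exact: cartan_part0
    |exact: nil_part_gen|rewrite !add0r].
- exact: triangular_lin.
- exact: stab.
Qed.

End Triangular.

(** * Scalars *)

Section RatChar0.
Variables (K : fieldType) (K0 : [pchar K] =i pred0).

(** The characteristic is recorded in the term, because the ring morphism
    structure depends on it. *)
Definition ratr_char0 : rat -> K := let _ := K0 in ratr.

Fact ratr_char0_zmod : zmod_morphism ratr_char0.
Proof.
move=> x y; rewrite /ratr_char0 ratrD_pchar0 //; congr (_ + _).
by apply/eqP; rewrite -addr_eq0 -ratrD_pchar0 // addNr -[0]/(0%:R) ratr_nat.
Qed.

Fact ratr_char0_monoid : monoid_morphism ratr_char0.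
Proof.
split=> [|x y]; first by rewrite /ratr_char0 -[1]/(1%:R) ratr_nat.
exact: ratrM_pchar0.
Qed.

HB.instance Definition _ := GRing.isZmodMorphism.Build rat K ratr_char0 ratr_char0_zmod.
HB.instance Definition _ := GRing.isMonoidMorphism.Build rat K ratr_char0 ratr_char0_monoid.

Lemma ratr_char0E q : ratr q = ratr_char0 q. Proof. by []. Qed.

End RatChar0.

(** The multiplicative group of K is written additively, so that the characters of
    a lattice are its additive maps. *)
Record kunit (K : fieldType) : Type := KUnit { kval :> K; kvalP : kval != 0 }.
HB.instance Definition _ K := [isSub for @kval K].
HB.instance Definition _ (K : fieldType) := [Choice of kunit K by <:].

Section KUnit.
Variable K : fieldType.
Implicit Types a b : kunit K.

Definition kunit_zero : kunit K := KUnit (oner_neq0 K).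
Definition kunit_opp a : kunit K := KUnit (invr_neq0 (kvalP a)).
Definition kunit_add a b : kunit K := KUnit (mulf_neq0 (kvalP a) (kvalP b)).

Fact kunit_addA : associative kunit_add.
Proof. by move=> a b c; apply/val_inj; apply: mulrA. Qed.
Fact kunit_addC : commutative kunit_add.
Proof. by move=> a b; apply/val_inj; apply: mulrC. Qed.
Fact kunit_add0 : left_id kunit_zero kunit_add.
Proof. by move=> a; apply/val_inj; apply: mul1r. Qed.
Fact kunit_addN : left_inverse kunit_zero kunit_opp kunit_add.
Proof. by move=> a; apply/val_inj; apply: mulVf (kvalP a). Qed.

HB.instance Definition _ := GRing.isZmodule.Build (kunit K)
  kunit_addA kunit_addC kunit_add0 kunit_addN.

Lemma kvalD a b : kval (a + b) = kval a * kval b. Proof. by []. Qed.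
Lemma kval0 : kval (0 : kunit K) = 1. Proof. by []. Qed.
Lemma kval_inj : injective (@kval K). Proof. exact: val_inj. Qed.

End KUnit.

(** * Root-graded Lie algebras *)

Section RootGraded.
Variables (K : fieldType) (K0 : [pchar K] =i pred0).
Variables (V : lmodType rat) (form : V -> V -> rat) (R : set V).
Local Notation ci := (cartan_int form).

Section Defs.
Variables (g : lieAlgType K) (G : V -> set g).

Definition root_triple a (e f h : g) : Prop :=
  [/\ G a e, G (- a) f, e != 0, sl2_triple e f h
    & forall b x, G b x -> bracket h x = ratr_char0 K0 (ci b a) *: x].

(** What the construction needs of the root spaces of a coral locally affine Lie
    algebra, with degrees in an arbitrary locally affine root system, so that both
    algebras can be indexed by the roots of the first one. The field [rg_radical]
    is the trace of the nondegeneracy of the invariant form. *)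
Record root_graded : Prop := {
  rg_closed : homogeneous_closed G;
  rg_root : forall a x, form a a != 0 -> ~ R a -> G a x -> x = 0;
  rg_triple : forall a, R a -> exists e f h, root_triple a e f h;
  rg_line : forall a x y, R a -> G a x -> G a y -> x != 0 -> exists k, y = k *: x;
  rg_radical : forall a y, a != 0 -> form a a = 0 -> G a y ->
    (forall b x, R b -> G b x -> bracket y x = 0) -> y = 0;
  rg_indep : forall (s : seq V) (x : V -> g), uniq s ->
    (forall a, a \in s -> G a (x a)) -> \sum_(a <- s) x a = 0 ->
    forall a, a \in s -> x a = 0
}.

End Defs.

Hypothesis lars : locally_affine_root_system form R.
Local Notation Lam := (int_span R).

Section One.
Variables (g : lieAlgType K) (G : V -> set g).
Hypothesis rg : root_graded G.

Lemma root_triple_sym a e f h : root_triple G a e f h -> root_triple G (- a) f e (- h).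
Proof.
case=> Ge Gf e0 sl Hh; split=> //; last 2 first.
- exact: sl2_triple_sym.
- move=> b x Gx; rewrite bracketNl (Hh b x Gx) -scaleNr -rmorphN; congr (ratr_char0 _ _ *: _).
  rewrite /cartan_int !(rformNl lars) !(rformNr lars) opprK; ring.
- by rewrite opprK.
- case: sl => ef he _ _ _; apply: contra_neq e0 => f0; apply/eqP.
  move: he; rewrite -ef f0 bracket0r bracket0l => /esym/eqP.
  by rewrite scaler_eq0 (pcharf0P K).1 ?orFb.
Qed.

Lemma root_triple_bracket a e f h b x : root_triple G a e f h -> R a -> Lam b ->
  G b x -> x != 0 -> 0 < ci b a -> bracket f x != 0 /\ bracket e (bracket f x) != 0.
Proof.
move=> [_ _ _ sl Hh] Ra Lb Gx x0; have [z zE] := lattice_ci_int lars Lb Ra.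
have := Hh b x Gx; rewrite zE ltr0z; case: z {zE} => // -[|n] // hx _.
have {}hx : bracket h x = n.+1%:R *: x by rewrite hx rmorph_int.
by split; [apply: (sl2_fx_neq0 K0 sl hx x0) | apply: (sl2_efx_neq0 K0 sl hx x0)].
Qed.

Lemma root_triple_bracket2 a e f h b x : root_triple G a e f h ->
  G b x -> x != 0 -> ci b a = -2 -> bracket e (bracket e x) != 0.
Proof.
move=> [_ _ _ sl Hh] Gx x0 ba; apply: contra_neq x0 => ee.
apply: (@sl2_inj _ K0 _ f e (- h) x 2) => //; first exact: sl2_triple_sym.
by rewrite bracketNl (Hh b x Gx) ba rmorphN scaleNr opprK rmorph_nat.
Qed.

(** Raising back what has been lowered reaches all of a one-dimensional space. *)
Lemma root_triple_raise a p e f h x : root_triple G p e f h -> R p -> R a -> R (a - p) ->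
  0 < ci a p -> G (a - p) x -> x != 0 -> bracket e x != 0.
Proof.
move=> T Rp Ra Rap ap Gx x0; have [ea [fa [ha [Gea _ ea0 _ _]]]] := rg_triple rg Ra.
have [G0 Gl Gb] := rg_closed rg; have [_ Gf _ _ _] := T.
have [fe efe] := root_triple_bracket T Rp (int_span_gen Ra) Gea ea0 ap.
have [k kE] : exists k, bracket f ea = k *: x.
  by apply: (rg_line rg Rap Gx _ x0); rewrite addrC; apply: Gb.
by move: efe; rewrite kE bracketZr scaler_eq0 negb_or => /andP[].
Qed.

End One.

Section Pair.
Variables (g1 g2 : lieAlgType K) (G1 : V -> set g1) (G2 : V -> set g2).
Hypotheses (rg1 : root_graded G1) (rg2 : root_graded G2).

Definition pair_pieces : V -> set (g1 * g2)%type :=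
  fun a => [set z | G1 a z.1 /\ G2 a z.2].
Local Notation G12 := pair_pieces.

Lemma pair_closed : homogeneous_closed G12.
Proof.
have [G10 G1l G1b] := rg_closed rg1; have [G20 G2l G2b] := rg_closed rg2.
split=> [a|a k x y [x1 x2] [y1 y2]|a b x y [x1 x2] [y1 y2]]; split=> /=;
  by [apply: G10|apply: G20|apply: G1l|apply: G2l|apply: G1b|apply: G2b].
Qed.

Lemma pair_root a z : form a a != 0 -> ~ R a -> G12 a z -> z = 0.
Proof.
by move=> aa nRa [/(rg_root rg1 aa nRa) z1 /(rg_root rg2 aa nRa)]; case: z z1 => z1 z2 /= -> ->.
Qed.

Section Local.
Variables (F0 : seq V) (F0R : forall a, a \in F0 -> R a) (f : V -> int).
Hypothesis fH : height form R F0 f.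
Local Notation cl := (closure_roots R F0).
Local Notation Lsp := (int_span [set` F0]).

Let gL : subgroup Lam := int_span_subgroup R.
Let gsp : subgroup Lsp := int_span_subgroup [set` F0].
Let spL : Lsp `<=` Lam := span_lattice F0R.
Let fadd : additive_on Lam f. Proof. by case: fH. Qed.

Let P : set V := simple form R F0 f.
Let M : set V := [set a | P (- a)].

Let simpleN' a : simple form R F0 (fun x => - f x) a -> M a.
Proof.
move=> [ca fa pmin]; rewrite /M /P /=; have ca' := closureN lars ca.
have La : Lam a by apply: spL; case: ca.
split=> //; first by rewrite (additive_onN gL fadd).
move=> b cb fb fba RI; have Lb : Lam b by apply: spL; case: cb.
apply: (pmin (- b)); first exact: (closureN lars).
- by rewrite /= (additive_onN gL fadd) // opprK.
- by move: fba => /=; rewrite !(additive_onN gL fadd) //; lia.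
- have -> : a - - b = - (- a - b) by rewrite opprB !opprK addrC.
  case: RI => [/(rootN lars)|I0]; first by left.
  by right; rewrite (rformNl lars) (rformNr lars) opprK.
Qed.

Variables (E : V -> (g1 * g2)%type).
Hypothesis E1 : forall a, P a ->
  root_triple G1 a (E a).1 (E (- a)).1 (bracket (E a) (E (- a))).1.
Hypothesis E2 : forall a, P a ->
  root_triple G2 a (E a).2 (E (- a)).2 (bracket (E a) (E (- a))).2.

Let PR a : P a -> R a. Proof. by case=> -[]. Qed.
Let MR a : M a -> R a. Proof. by move=> /PR/(rootN lars); rewrite opprK. Qed.

Let E1' a : M a -> root_triple G1 a (E a).1 (E (- a)).1 (bracket (E a) (E (- a))).1.
Proof.
move=> /E1/root_triple_sym; rewrite opprK; congr root_triple.
by rewrite /= -bracketC.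
Qed.

Let E2' a : M a -> root_triple G2 a (E a).2 (E (- a)).2 (bracket (E a) (E (- a))).2.
Proof.
move=> /E2/root_triple_sym; rewrite opprK; congr root_triple.
by rewrite /= -bracketC.
Qed.

Let EG a : P a \/ M a -> G12 a (E a).
Proof.
by case=> [Pa|Ma]; split; [case: (E1 Pa)|case: (E2 Pa)|case: (E1' Ma)|case: (E2' Ma)].
Qed.

(** A difference of distinct simple roots is neither a root nor isotropic, so
    the bracket of a simple root vector with the opposite of another vanishes. *)
Lemma local_opposite : opposite_gens G12 E P M.
Proof.
exists (fun p b => ratr_char0 K0 (ci b p)); split=> //.
- by split=> p //; rewrite /M /= opprK.
- move=> p b x Pp [x1 x2]; have [_ _ _ _ H1] := E1 Pp; have [_ _ _ _ H2] := E2 Pp.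
  apply/pair_equal_spec => /=.
  by split; [apply: H1 | apply: H2].
- move=> p q Pp Pq pq.
  have [_ _ Gb] := pair_closed.
  have MqN : P (- q) \/ M (- q) by right; rewrite /M /= opprK.
  have := Gb _ _ _ _ (EG (or_introl Pp)) (EG MqN); apply: pair_root.
    by apply/eqP => iso; apply: (simple_diff lars F0R fH Pp Pq pq); right.
  by move=> Rpq; apply: (simple_diff lars F0R fH Pp Pq pq); left.
Qed.

Local Notation S := (opp_gens E P M).

Let S_G a z : hgen S a z -> G12 a z.
Proof. by apply: (hgen_min pair_closed) => {a z} a _ [PM ->]; apply: EG. Qed.

(** Along the construction of a positive root from simple ones, brackets with simple
    root vectors keep both components nonzero. The height s is f or its opposite,
    which covers the negative roots as well. *)
Lemma hgen_reach s : height form R F0 s -> (forall p, simple form R F0 s p -> P p \/ M p) ->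
  forall a, cl a -> 0 < s a -> exists z, [/\ hgen S a z, z.1 != 0 & z.2 != 0].
Proof.
move=> sH sPM a; have [n] := ubnP `|s a|%N; elim: n a => // n IH a san ca sa.
have tri1 p : P p \/ M p -> exists h, root_triple G1 p (E p).1 (E (- p)).1 h.
  by case=> [/E1|/E1'] T; eexists; apply: T.
have tri2 p : P p \/ M p -> exists h, root_triple G2 p (E p).2 (E (- p)).2 h.
  by case=> [/E2|/E2'] T; eexists; apply: T.
have PMR p : P p \/ M p -> R p by case=> [/PR|/MR].
have gen p : P p \/ M p -> hgen S p (E p) by move=> PMp; apply: hgen_gen.
have [sa'|[p sp [cap sap sapa ap]]|[p [b [sp cb /andP[sb sba] bp aE]]]] :=
  positive_cases lars F0R sH ca sa.
- have PMa := sPM _ sa'; exists (E a); split; first exact: gen.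
    by have [h []] := tri1 _ PMa.
  by have [h []] := tri2 _ PMa.
- have PMp := sPM _ sp; have Rp := PMR _ PMp.
  have [z [hz z1 z2]] : exists z, [/\ hgen S (a - p) z, z.1 != 0 & z.2 != 0].
    by apply: IH => //; lia.
  have [G1z G2z] := S_G hz.
  exists (bracket (E p) z); split.
  + by rewrite -[a](subrK p) addrC; apply: hgen_bracket => //; apply: gen.
  + have [h T] := tri1 _ PMp.
    exact: (root_triple_raise rg1 T Rp ca.1 cap.1 ap G1z z1).
  + have [h T] := tri2 _ PMp.
    exact: (root_triple_raise rg2 T Rp ca.1 cap.1 ap G2z z2).
- have PMp := sPM _ sp; have Rp := PMR _ PMp.
  have [z [hz z1 z2]] : exists z, [/\ hgen S b z, z.1 != 0 & z.2 != 0].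
    by apply: IH => //; lia.
  have [G1z G2z] := S_G hz.
  exists (bracket (E p) (bracket (E p) z)); split.
  + have -> : a = p + (p + b) by rewrite aE addrC [b + p]addrC.
    by do 2!apply: (hgen_bracket (gen _ PMp)).
  + have [h T] := tri1 _ PMp; exact: (root_triple_bracket2 T G1z z1 bp).
  + have [h T] := tri2 _ PMp; exact: (root_triple_bracket2 T G2z z2 bp).
Qed.

Lemma local_reach a : cl a -> exists z, [/\ hgen S a z, z.1 != 0 & z.2 != 0].
Proof.
move=> ca; have [_ f0 _] := fH; have := f0 _ ca; rewrite neq_lt => /orP[fa|fa].
  apply: (hgen_reach (heightN fH)) => //; last by rewrite oppr_gt0.
  by move=> p /simpleN'; right.
by apply: (hgen_reach fH) => //; left.
Qed.

Let nil_pos a z : nil_part E P a z -> z = 0 \/ [/\ G12 a z, Lsp a & 0 < f a].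
Proof.
have [G0 Gl Gb] := pair_closed.
elim=> {a z} [a|p Pp|a k z z' _ IH _ IH'|p a z Pp _ IH]; first by left.
- by right; split; [apply: EG; left|case: Pp => -[]|case: Pp].
- case: IH => [->|[Gz La fa]].
    case: IH' => [->|[Gz La fa]]; first by left; rewrite scaler0 addr0.
    by right; split=> //; rewrite scaler0 add0r.
  right; split=> //; case: IH' => [->|[Gz' _ _]]; last exact: Gl.
  by apply: Gl => //; apply: G0.
- case: IH => [->|[Gz La fa]]; first by left; rewrite bracket0r.
  have [[Rp Lp] fp _] := Pp; right; split.
  + by apply: Gb => //; apply: EG; left.
  + exact: (subgroupD gsp).
  + by rewrite fadd ?addr_gt0 //; apply: spL.
Qed.

Let nil_neg a z : nil_part E M a z -> z = 0 \/ Lsp a /\ f a < 0.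
Proof.
elim=> {a z} [a|p Mp|a k z z' _ IH _ IH'|p a z Mp _ IH]; first by left.
- have [[_ Lp] fp _] := Mp; have Lp' : Lsp p by rewrite -[p]opprK; apply: (subgroupN gsp).
  by right; split=> //; move: fp; rewrite (additive_onN gL fadd) ?oppr_gt0 //; apply: spL.
- case: IH => [->|La]; last by right.
  by case: IH' => [->|La]; [left; rewrite scaler0 addr0|right].
- case: IH => [->|[La fa]]; first by left; rewrite bracket0r.
  have [[_ Lp] fp _] := Mp; have Lp' : Lsp p by rewrite -[p]opprK; apply: (subgroupN gsp).
  move: fp; rewrite (additive_onN gL fadd) ?oppr_gt0 //; last exact: spL.
  move=> fp; right; split; first exact: (subgroupD gsp).
  by rewrite fadd ?ltr_pDl //; [lia|apply: spL|apply: spL].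
Qed.

(** In the degree of a simple root nothing but its generator is generated: it
    would take a decomposition of the simple root. *)
Lemma simple_line p z : P p -> hgen S p z -> exists k, z = k *: E p.
Proof.
move=> Pp /(hgen_triangular pair_closed local_opposite)[z1 [z0 [z2 [h1 h0 h2 ->]]]].
have [[Rp Lp] fp pmin] := Pp.
have -> : z0 = 0.
  have [p0|//] := cartan_part_degree h0.
  by have := root_neq0 lars Rp; rewrite p0 eqxx.
have -> : z2 = 0.
  by have [//|[_]] := nil_neg h2; lia.
rewrite !addr0; elim: h1 Pp Rp Lp fp pmin {h0 h2} => {p z z0 z1 z2}
    [a _ _ _ _ _|p Pp _ _ _ _ _|a k z z' _ IH _ IH' Pa Ra La fa amin|p a z Pp az _ _ Rpa Lpa fpa pamin].
- by exists 0; rewrite scale0r.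
- by exists 1; rewrite scale1r.
- have [k1 ->] := IH Pa Ra La fa amin; have [k2 ->] := IH' Pa Ra La fa amin.
  by exists (k * k1 + k2); rewrite scalerDl scalerA.
- have [->|[Gz La fa]] := nil_pos az; first by exists 0; rewrite bracket0r scale0r.
  have [->|z0] := eqVneq z 0; first by exists 0; rewrite bracket0r scale0r.
  have [cp fp _] := Pp; case: (pamin p cp fp).
    by rewrite fadd ?ltrDl //; apply: spL; case: cp.
  rewrite addrC addKr; have [iso|niso] := eqVneq (form a a) 0; first by right.
  left; apply: contrapT => nRa; move/eqP: z0; apply.
  exact: pair_root niso nRa Gz.
Qed.

(** Bracketed with an element of the opposite degree, (0, y) acts on the vector of
    a simple root not orthogonal to a by zero in the first component and by a
    nonzero scalar in the second, off the line of that vector. *)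
Lemma local_unique a y : cl a -> hgen S a (0, y) -> y = 0.
Proof.
move=> ca hy; apply: contrapT => /eqP y0; have [_ f0 _] := fH.
have caN := closureN lars ca.
have [p Pp pa] : exists2 p, P p & ci p a != 0.
  have := f0 _ ca; rewrite neq_lt => /orP[fa|fa].
    have [|p sp ap] := simple_obtuse lars F0R fH caN.
      by rewrite (additive_onN gL fadd) ?oppr_gt0 //; apply: spL; case: ca.
    exists p => //; rewrite (ci_eq0 lars p ca.1) (form_sym lars).
    by apply/eqP => ap0; move: ap; rewrite (rformNl lars) ap0 oppr0 ltxx.
  have [p sp ap] := simple_obtuse lars F0R fH ca fa; exists p => //.
  by rewrite (ci_eq0 lars p ca.1) (form_sym lars) gt_eqF.
have [z' [hz' z1 z2]] := local_reach caN.
have [e [k [h T]]] := rg_triple rg2 ca.1; have [Ge Gk e0 [ek _ _ _ _] Hh] := T.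
have k0 : k != 0 by case: (root_triple_sym T).
have [_ Gy] := S_G hy; have [_ Gz'] := S_G hz'.
have [l1 yE] := rg_line rg2 ca.1 Ge Gy e0.
have [l2 zE] := rg_line rg2 caN.1 Gk Gz' k0.
rewrite /= in yE; have l10 : l1 != 0 by apply: contra_neq y0 => l0; rewrite yE l0 scale0r.
have l20 : l2 != 0 by apply: contra_neq z2 => l0; rewrite zE l0 scale0r.
have hp : hgen S p (E p) by apply: hgen_gen; split=> //; left.
have := hgen_bracket (hgen_bracket hy hz') hp; rewrite addrN add0r => /(simple_line Pp)[m].
have [_ G2p] := EG (or_introl Pp).
move/pair_equal_spec => /= [].
rewrite !bracket0l yE zE bracketZl bracketZr ek !bracketZl (Hh p _ G2p) => /esym/eqP.
have [_ _ Ep1 _ _] := E1 Pp; have [_ _ Ep2 _ _] := E2 Pp.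
rewrite scaler_eq0 (negPf Ep1) orbF => /eqP->; rewrite scale0r => /eqP.
by rewrite !scaler_eq0 (negPf l10) (negPf l20) (negPf Ep2) fmorph_eq0 (negPf pa).
Qed.

End Local.

End Pair.
End RootGraded.

(** * Consistent scalars *)

Section Consistent.
Variables (K : fieldType) (K0 : [pchar K] =i pred0).
Variables (V : lmodType rat) (form : V -> V -> rat) (R : set V).
Hypothesis lars : locally_affine_root_system form R.
Local Notation ci := (cartan_int form).
Local Notation Lam := (int_span R).
Variables (g1 g2 : lieAlgType K) (G1 : V -> set g1) (G2 : V -> set g2).
Hypotheses (rg1 : root_graded K0 form R G1) (rg2 : root_graded K0 form R G2).
Variables (e1 : V -> g1) (e2 : V -> g2).
Hypothesis e1P : forall a, R a -> G1 a (e1 a) /\ e1 a != 0.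
Hypothesis e2P : forall a, R a -> G2 a (e2 a) /\ e2 a != 0.
Implicit Types (F : set V) (c : V -> kunit K) (s : seq V) (a b p : V).

Let gL : subgroup Lam := int_span_subgroup R.
Local Notation G12 := (pair_pieces G1 G2).
Local Notation cl := (closure_roots R).

(** The graph of the correspondence [e1 a] to [c a *: e2 a] over the roots in F;
    c is consistent on F when the algebra that it generates is still a graph in
    the degrees of roots. *)
Definition line_gens F c : V -> set (g1 * g2)%type :=
  fun a => [set z | [/\ R a, F a & z = (e1 a, kval (c a) *: e2 a)]].

Definition consistent F c : Prop :=
  forall a y, R a -> hgen (line_gens F c) a (0, y) -> y = 0.

Lemma line_gens_graded F c a z : hgen (line_gens F c) a z -> G12 a z.
Proof.
apply: (hgen_min (pair_closed rg1 rg2)) => {a z} a _ [Ra _ ->].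
have [G20 G2l G2b] := rg_closed rg2; split; first by case: (e1P Ra).
by rewrite /= -[_ *: _]addr0; apply: G2l => //; case: (e2P Ra).
Qed.

Lemma consistent_sub F F' c c' : F `<=` F' -> (forall a, F a -> c a = c' a) ->
  consistent F' c' -> consistent F c.
Proof.
move=> FF' cc' cons a y Ra hy; apply: (cons a y Ra).
apply: hgen_sub hy => {a y Ra} a _ [Ra Fa ->]; apply: hgen_gen; rewrite cc' //.
by split=> //; apply: FF'.
Qed.

(** Generating only from simple roots, consistency is automatic. *)
Lemma consistent_exists s : (forall a, a \in s -> R a) -> exists c, consistent (cl s) c.
Proof.
move=> sR; have [f [fadd f0 fi]] := height_exists lars sR.
have fH : height form R s f by split=> // a [Ra sa]; apply: f0.
have /choice[T1 T1P] a : exists t : g1 * g1 * g1, R a -> root_triple K0 form G1 a t.1.1 t.1.2 t.2.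
  have [/(rg_triple rg1)[e [k [h T]]]|nRa] := pselect (R a); last by exists 0.
  by exists (e, k, h).
have /choice[T2 T2P] a : exists t : g2 * g2 * g2, R a -> root_triple K0 form G2 a t.1.1 t.1.2 t.2.
  have [/(rg_triple rg2)[e [k [h T]]]|nRa] := pselect (R a); last by exists 0.
  by exists (e, k, h).
pose E a := if 0 < f a then ((T1 a).1.1, (T2 a).1.1)
            else ((T1 (- a)).1.2, (T2 (- a)).1.2).
have PE a : simple form R s f a ->
    E a = ((T1 a).1.1, (T2 a).1.1) /\ E (- a) = ((T1 a).1.2, (T2 a).1.2).
  move=> [[Ra _] fa _]; rewrite /E fa (additive_onN gL fadd) ?oppr_gt0.
    by rewrite ltNge (ltW fa) /= opprK.
  exact: int_span_gen.
have E1 a : simple form R s f a -> root_triple K0 form G1 a (E a).1 (E (- a)).1 (bracket (E a) (E (- a))).1.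
  move=> Pa; have [-> ->] := PE a Pa; have [[Ra _] _ _] := Pa.
  by have T := T1P a Ra; have [_ _ _ [ef _ _ _ _] _] := T; rewrite /= ef.
have E2 a : simple form R s f a -> root_triple K0 form G2 a (E a).2 (E (- a)).2 (bracket (E a) (E (- a))).2.
  move=> Pa; have [-> ->] := PE a Pa; have [[Ra _] _ _] := Pa.
  by have T := T2P a Ra; have [_ _ _ [ef _ _ _ _] _] := T; rewrite /= ef.
set P := simple form R s f in PE E1 E2; pose M : set V := [set a | P (- a)].
have PMR a : P a \/ M a -> R a.
  by case=> [[[]]//|[[Ra _] _ _]]; rewrite -[a]opprK; apply: (rootN lars).
have SG a z : hgen (opp_gens E P M) a z -> G12 a z.
  apply: (hgen_min (pair_closed rg1 rg2)) => {a z} a _ [[Pa|Ma] ->].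
    by split; [case: (E1 a Pa)|case: (E2 a Pa)].
  by split; [case: (E1 _ Ma)|case: (E2 _ Ma)]; rewrite opprK.
have /choice[c cP] a : exists k : kunit K, cl s a ->
    hgen (opp_gens E P M) a (e1 a, kval k *: e2 a).
  have [ca|nca] := pselect (cl s a); last by exists 0.
  have [z [hz z1 z2]] := local_reach lars rg1 rg2 sR fH E1 E2 ca.
  have [Ga1 e10] := e1P ca.1; have [Ga2 e20] := e2P ca.1; have [Gz1 Gz2] := SG _ _ hz.
  have [k zE1] := rg_line rg1 ca.1 Ga1 Gz1 e10.
  have [l zE2] := rg_line rg2 ca.1 Ga2 Gz2 e20.
  have k0 : k != 0 by apply: contra_neq z1 => k0; rewrite zE1 k0 scale0r.
  have l0 : l != 0 by apply: contra_neq z2 => l0; rewrite zE2 l0 scale0r.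
  exists (KUnit (mulf_neq0 (invr_neq0 k0) l0)) => _.
  have := hgenZ k^-1 hz; congr (hgen _ _ _).
  by apply/pair_equal_spec; rewrite /= zE1 zE2 !scalerA mulVf // scale1r.
exists c => a y Ra hy.
have csa : cl s a.
  split=> //; apply: (hgen_degree (int_span_subgroup [set` s]) _ hy).
  by move=> b w [_ [_ Lb] _].
apply: (local_unique lars rg1 rg2 sR fH E1 E2 csa).
by apply: hgen_sub hy => b w [Rb cb ->]; apply: cP.
Qed.

Lemma scale_pair a F c k l : R a -> F a -> consistent F c ->
  hgen (line_gens F c) a (k *: e1 a, l *: e2 a) -> l = k * kval (c a).
Proof.
move=> Ra Fa cons hz; have [_ e20] := e2P Ra.
have hg : hgen (line_gens F c) a (e1 a, kval (c a) *: e2 a) by apply: hgen_gen.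
have := hgen_lin (- k) hg hz; set w := (X in hgen _ _ X).
have -> : w = (0, (l - k * kval (c a)) *: e2 a).
  apply/pair_equal_spec; rewrite /= scaleNr addNr; split=> //.
  by rewrite scalerA -scalerDl mulNr addrC.
move=> /(cons a _ Ra)/eqP; rewrite scaler_eq0 (negPf e20) orbF subr_eq0.
by move=> /eqP.
Qed.

(** The bracket of the lines of opposite roots acts on either line, by the same
    scalar in both components when the scalars are consistent. *)
Lemma opposite_scalars a x1 y1 h1 x2 y2 h2 : R a ->
  root_triple K0 form G1 a x1 y1 h1 -> root_triple K0 form G2 a x2 y2 h2 ->
  exists k1 k2, k2 != 0 /\ forall F c, F a -> F (- a) -> consistent F c ->
    k1 = kval (c a) * kval (c (- a)) * k2 /\
    bracket (e1 a, kval (c a) *: e2 a) (e1 (- a), kval (c (- a)) *: e2 (- a))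
      = (k1 *: h1, k1 *: h2).
Proof.
move=> Ra T1 T2; have RN := rootN lars Ra.
have [Gx1 Gy1 x10 [xy1 _ _ _ _] H1] := T1; have [Gx2 Gy2 x20 [xy2 _ _ _ _] H2] := T2.
have y10 : y1 != 0 by case: (root_triple_sym lars T1).
have y20 : y2 != 0 by case: (root_triple_sym lars T2).
have [Ga1 e10] := e1P Ra; have [Ga2 e20] := e2P Ra.
have [GN1 eN1] := e1P RN; have [GN2 eN2] := e2P RN.
have [k1 k1E] := rg_line rg1 Ra Gx1 Ga1 x10.
have [k1' k1E'] := rg_line rg1 RN Gy1 GN1 y10.
have [k2 k2E] := rg_line rg2 Ra Gx2 Ga2 x20.
have [k2' k2E'] := rg_line rg2 RN Gy2 GN2 y20.
exists (k1 * k1'), (k2 * k2'); split.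
  by rewrite mulf_neq0 //; [apply: contra_neq e20|apply: contra_neq eN2] => k0;
    rewrite ?k2E ?k2E' k0 scale0r.
move=> F c Fa FN cons; pose m := k1 * k1'; pose n := kval (c a) * kval (c (- a)) * (k2 * k2').
have bE : bracket (e1 a, kval (c a) *: e2 a) (e1 (- a), kval (c (- a)) *: e2 (- a))
    = (m *: h1, n *: h2) :> (g1 * g2)%type.
  apply/pair_equal_spec; rewrite /= k1E k1E' k2E k2E' !(bracketZl, bracketZr) xy1 xy2 !scalerA.
  by split; congr (_ *: _); rewrite /m /n; ring.
rewrite bE -/m -/n; suff -> : n = m by [].
have ga : hgen (line_gens F c) a (e1 a, kval (c a) *: e2 a) by apply: hgen_gen.
have gN : hgen (line_gens F c) (- a) (e1 (- a), kval (c (- a)) *: e2 (- a)) by apply: hgen_gen.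
have := hgen_bracket (hgen_bracket ga gN) ga; rewrite subrr add0r bE.
set w := (X in hgen _ _ X); have -> : w = ((2 * m) *: e1 a, (2 * n * kval (c a)) *: e2 a).
  have two x : x * 2 = x * ratr_char0 K0 (ci a a).
    by rewrite (ciaa lars Ra) rmorph_nat.
  apply/pair_equal_spec; rewrite /= !(bracketZl, bracketZr) (H1 a _ Ga1) (H2 a _ Ga2).
  rewrite !scalerA [2 * m]mulrC [2 * n]mulrC !two; split=> //.
  by congr (_ *: _); ring.
move=> /(scale_pair Ra Fa cons) /eqP; rewrite -subr_eq0 -mulrBl -mulrBr.
by rewrite !mulf_eq0 (pcharf0P K).1 // (negPf (kvalP (c a))) orbF /= subr_eq0 => /eqP.
Qed.

(** Two consistent choices differ by a character: the ratio is determined by its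
    values at the simple roots, which are independent. *)
Lemma consistent_ratio s c c' : connected_roots form R s ->
  consistent (cl s) c -> consistent (cl s) c' ->
  exists2 chi : V -> kunit K, additive_on (int_span [set` s]) chi &
    forall a, cl s a -> c' a = chi a + c a.
Proof.
move=> [sR sconn] cons cons'; have [f [fadd f0 fi]] := height_exists lars sR.
have fH : height form R s f by split=> // a [Ra sa]; apply: f0.
have ind := simple_indep lars sR fH sconn.
have [chi chiadd chiE] := zindep_extend (fun a => c' a - c a) ind.
set P := simple form R s f in ind chiadd chiE.
have gP := int_span_subgroup P.
have pos_span a : cl s a -> 0 < f a -> int_span P a.
  move=> ca fa; have [t tP ->] := simple_sum lars sR fH ca fa.
  by apply: (subgroup_sum gP) => p /tP; apply: int_span_gen.
have cl_span a : cl s a -> int_span P a.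
  move=> ca; have [_ f0' _] := fH; have := f0' _ ca; rewrite neq_lt => /orP[fa|]; last exact: pos_span.
  rewrite -[a]opprK; apply: (subgroupN gP); apply: pos_span; first exact: (closureN lars).
  by rewrite (additive_onN gL fadd) ?oppr_gt0 //; apply: int_span_gen; case: ca.
have sP : int_span [set` s] `<=` int_span P.
  apply: int_span_min => // a sa; apply: cl_span; split; first exact: sR.
  exact: int_span_gen.
exists chi; first exact: additive_on_sub chiadd.
pose r a := c' a - c a.
suff rE : forall a, cl s a -> r a = chi a by move=> a ca; rewrite -rE // /r subrK.
have rN a : cl s a -> r (- a) = - r a.
  move=> ca; have Ra := ca.1; have caN := closureN lars ca.
  have [x1 [y1 [h1 T1]]] := rg_triple rg1 Ra; have [x2 [y2 [h2 T2]]] := rg_triple rg2 Ra.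
  have [k1 [k2 [k2n kE]]] := opposite_scalars Ra T1 T2.
  have [m _] := kE _ _ ca caN cons; have [m' _] := kE _ _ ca caN cons'.
  have E : c' a + c' (- a) = c a + c (- a).
    by apply/kval_inj/(mulIf k2n); rewrite !kvalD -m -m'.
  by rewrite /r opprB; apply/eqP; rewrite subr_eq addrAC eq_sym subr_eq -E addrC.
have r0 a x1 x2 (u : (V -> kunit K) -> kunit K) : cl s a -> x1 != 0 ->
    (forall d, hgen (line_gens (cl s) d) a (x1, kval (u d) *: x2)) -> r a = u c' - u c.
  move=> ca n0 hx; have [G1a e10] := e1P ca.1; have [G2a e20] := e2P ca.1.
  have [Gx1 Gx2] := line_gens_graded (hx c).
  have [k kE] := rg_line rg1 ca.1 G1a Gx1 e10; rewrite /= in kE.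
  have [l lE] := rg_line rg2 ca.1 G2a Gx2 e20.
  have x2E : x2 = ((kval (u c))^-1 * l) *: e2 a.
    by rewrite -scalerA -lE /= scalerA mulVf ?scale1r // kvalP.
  have main d : consistent (cl s) d -> kval (u d) * ((kval (u c))^-1 * l) = k * kval (d a).
    move=> consd; apply: (scale_pair ca.1 ca consd); have := hx d.
    congr (hgen _ _ _); apply/pair_equal_spec; rewrite kE; split=> //.
    by rewrite {1}x2E scalerA.
  have k0 : k != 0 by apply: contra_neq n0; rewrite kE => ->; rewrite scale0r.
  have E := main c cons; have E' := main c' cons'.
  apply/eqP; rewrite /r subr_eq addrAC eq_sym subr_eq; apply/eqP/kval_inj.
  rewrite !kvalD; apply: (mulfI k0); rewrite mulrCA -E [RHS]mulrA -E'; ring.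
have gen d a : cl s a -> hgen (line_gens (cl s) d) a (e1 a, kval (d a) *: e2 a).
  by move=> ca; apply: hgen_gen; split=> //; case: ca.
have r1 p b : cl s p -> cl s b -> cl s (p + b) -> bracket (e1 p) (e1 b) != 0 ->
    r (p + b) = r p + r b.
  move=> cp cb cpb n0; transitivity ((c' p + c' b) - (c p + c b)); last by rewrite opprD addrACA.
  apply: (r0 _ _ (bracket (e2 p) (e2 b)) (fun d => d p + d b) cpb n0) => d.
  have := hgen_bracket (gen d _ cp) (gen d _ cb); congr (hgen _ _ _); apply/pair_equal_spec.
  by rewrite /= bracketZl bracketZr scalerA.
have r2 p b : cl s p -> cl s b -> cl s (p + (p + b)) ->
    bracket (e1 p) (bracket (e1 p) (e1 b)) != 0 -> r (p + (p + b)) = r p + (r p + r b).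
  move=> cp cb cpb n0; transitivity ((c' p + (c' p + c' b)) - (c p + (c p + c b))); last first.
    by rewrite !opprD addrACA; congr (_ + _); rewrite addrACA.
  apply: (r0 _ _ (bracket (e2 p) (bracket (e2 p) (e2 b))) (fun d => d p + (d p + d b)) cpb n0) => d.
  have := hgen_bracket (gen d _ cp) (hgen_bracket (gen d _ cp) (gen d _ cb)).
  congr (hgen _ _ _); apply/pair_equal_spec.
  rewrite /= !(bracketZl, bracketZr) !scalerA; split=> //.
  by congr (_ *: _); rewrite mulrA mulrAC.
have chiP p : P p -> chi p = r p by move=> Pp; apply: chiE.
have main a : cl s a -> 0 < f a -> r a = chi a.
  have [n] := ubnP `|f a|%N; elim: n a => // n IH a fan ca fa.
  have [sa|[p sp [cap fap fapa ap]]|[p [b [sp cb /andP[fb fba] bp aE]]]] :=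
    positive_cases lars sR fH ca fa.
  - by rewrite chiP.
  - have cp : cl s p by case: sp.
    have E : a = p + (a - p) by rewrite addrC subrK.
    rewrite {1}E r1 //; last 2 first.
    + by rewrite -E.
    + have [x1 [y1 [h1 T1]]] := rg_triple rg1 cp.1; have [Gx1 _ x10 _ _] := T1.
      have [Gp ep0] := e1P cp.1; have [Gap eap0] := e1P cap.1.
      have [k kE] := rg_line rg1 cp.1 Gx1 Gp x10.
      have := root_triple_raise lars rg1 T1 cp.1 ca.1 cap.1 ap Gap eap0.
      rewrite kE bracketZl scaler_eq0 negb_or => ->; rewrite andbT.
      by apply: contra_neq ep0 => k0; rewrite kE k0 scale0r.
    rewrite (IH (a - p)) //; last by lia.
    by rewrite -chiP // {2}E (chiadd p (a - p)) //; [apply: int_span_gen|apply: cl_span].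
  - have cp : cl s p by case: sp.
    have E : a = p + (p + b) by rewrite aE addrC [b + p]addrC.
    rewrite {1}E r2 //; last 2 first.
    + by rewrite -E.
    + have [x1 [y1 [h1 T1]]] := rg_triple rg1 cp.1; have [Gx1 _ x10 _ _] := T1.
      have [Gp ep0] := e1P cp.1; have [Gb eb0] := e1P cb.1.
      have [k kE] := rg_line rg1 cp.1 Gx1 Gp x10.
      have k0 : k != 0 by apply: contra_neq ep0 => k0; rewrite kE k0 scale0r.
      have := root_triple_bracket2 T1 Gb eb0 bp.
      by rewrite kE !(bracketZl, bracketZr) !scaler_eq0 !negb_or k0 => ->.
    rewrite (IH b) //; last by lia.
    have Pp : int_span P p by apply: int_span_gen.
    have Pb : int_span P b by apply: cl_span.
    by rewrite -chiP // E !chiadd //; apply: (subgroupD gP).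
move=> a ca; have [_ f0' _] := fH; have := f0' _ ca; rewrite neq_lt => /orP[fa|]; last exact: main.
have caN := closureN lars ca; apply: oppr_inj; rewrite -rN // main //.
  by rewrite (additive_onN gP chiadd) //; apply: cl_span.
by rewrite (additive_onN gL fadd) ?oppr_gt0 //; apply: int_span_gen; case: ca.
Qed.

(** Conversely a character of the lattice acts on the second algebra by
    automorphisms. *)
Lemma consistent_twist F c chi : additive_on Lam chi -> consistent F c ->
  consistent F (fun a => chi a + c a).
Proof.
move=> chiadd cons a y Ra hy.
suff H b z : hgen (line_gens F (fun a => chi a + c a)) b z ->
    Lam b /\ hgen (line_gens F c) b (z.1, (kval (chi b))^-1 *: z.2).
  have [_ /= /(cons a _ Ra)/eqP] := H _ _ hy.
  by rewrite scaler_eq0 invr_eq0 (negPf (kvalP _)) => /eqP.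
elim=> {a y Ra hy b z} [b _ [Rb Fb ->]|b k z z' _ [Lb IH] _ [_ IH']|a b z z' _ [La IH] _ [Lb IH']].
- split; first exact: int_span_gen.
  apply: hgen_gen; split=> //; apply/pair_equal_spec; split=> //=.
  by rewrite scalerA (mulKf (kvalP (chi b))).
- split=> //; have := hgen_lin k IH IH'; congr (hgen _ _ _).
  by apply/pair_equal_spec; split=> //=; rewrite scalerDr !scalerA mulrC.
- split; first exact: (subgroupD gL).
  have := hgen_bracket IH IH'; congr (hgen _ _ _).
  apply/pair_equal_spec; split=> //=.
  by rewrite bracketZl bracketZr scalerA chiadd // kvalD invfM.
Qed.

(** Gluing: over a basis of the lattice the characters by which the local choices
    differ are normalized away. *)
Lemma consistent_global (B : set V) : zbasis B Lam ->
  exists2 c, consistent R c & forall b, B b -> R b -> c b = 0.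
Proof.
move=> [BL Bind Bspan].
have /choice[rep repP] b : exists t : seq V * (V -> int), B b ->
    [/\ forall a, a \in t.1 -> R a, b = \sum_(a <- t.1) a *~ t.2 a
     & R b -> t = ([:: b], fun=> 1)].
  have [Bb|nB] := pselect (B b); last by exists ([::], fun=> 0).
  have [Rb|nR] := pselect (R b).
    exists ([:: b], fun=> 1) => _; split=> // [a|]; first by rewrite inE => /eqP->.
    by rewrite big_seq1 mulr1z.
  have [s [k [_ sR bE]]] := int_span_uniqP (BL b Bb).
  by exists (s, k).
pose th c b : kunit K := \sum_(a <- (rep b).1) c a *~ (rep b).2 a.
have /choice[X XP] c : exists X : V -> kunit K, additive_on Lam X /\ forall b, B b -> X b = th c b.
  have [X Xadd XE] := zindep_extend (th c) Bind.
  by exists X; split=> //; apply: additive_on_sub Xadd.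
have shift G (D : seq V) c c' a : connected_roots form R G -> (forall b, b \in D -> B b) ->
    (forall b, b \in D -> forall x, x \in (rep b).1 -> x \in G) ->
    int_span [set` D] a -> a \in G -> consistent (cl G) c -> consistent (cl G) c' ->
    c' a - X c' a = c a - X c a.
  move=> Gc DB DG aD aG cons cons'; have [chi chiadd chiE] := consistent_ratio Gc cons cons'.
  have gG := int_span_subgroup [set` G]; have gD := int_span_subgroup [set` D].
  have clG x : x \in G -> cl G x.
    by move=> xG; split; [apply: Gc.1|apply: int_span_gen].
  have DLam : int_span [set` D] `<=` Lam by apply: int_span_min => // b /= bD; apply: BL; apply: DB.
  have repG b x : b \in D -> x \in (rep b).1 -> int_span [set` G] (x *~ (rep b).2 x).
    move=> bD xb; apply: (subgroupMz gG); apply: int_span_gen; exact: (DG b bD).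
  have DGs : int_span [set` D] `<=` int_span [set` G].
    apply: int_span_min => // b /= bD; have [_ -> _] := repP b (DB b bD).
    by apply: (subgroup_sum gG) => x xb; apply: repG.
  have XE : X c' a = chi a + X c a.
    apply: (@additive_on_eq _ _ [set` D] _ (fun a => chi a + X c a)) => //.
    - by apply: additive_on_sub (XP c').1.
    - move=> x y Dx Dy /=; rewrite chiadd; [|exact: DGs|exact: DGs].
      by rewrite (XP c).1; [rewrite addrACA|exact: DLam|exact: DLam].
    - move=> b /= bD; have Bb := DB b bD; rewrite (XP c').2 // (XP c).2 // /th.
      have [_ bE _] := repP b Bb.
      have -> : chi b = \sum_(x <- (rep b).1) chi x *~ (rep b).2 x.
        rewrite {1}bE (additive_on_sum gG chiadd) => [|x]; last exact: repG.
        apply: eq_big_seq => x xb; rewrite (additive_onMz gG chiadd) //.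
        by apply: int_span_gen; apply: (DG b bD).
      rewrite -big_split; apply: eq_big_seq => x xb /=.
      by rewrite chiE ?mulrzDl //; apply: clG; apply: (DG b bD).
  rewrite XE (chiE a (clG a aG)) opprD addrACA subrr add0r; reflexivity.
have /choice[D DP] a : exists D : seq V, R a -> (forall b, b \in D -> B b) /\ int_span [set` D] a.
  have [Ra|nR] := pselect (R a); last by exists [::].
  have [s [k [us sB aE]]] := int_span_uniqP (Bspan a (int_span_gen Ra)).
  exists s => _; split=> //; rewrite aE; have gs := int_span_subgroup [set` s].
  by apply: (subgroup_sum gs) => b bs; apply: (subgroupMz gs); apply: int_span_gen.
pose need a := a :: flatten [seq (rep b).1 | b <- D a].
have needR a : R a -> forall x, x \in need a -> R x.
  move=> Ra x; rewrite inE => /orP[/eqP->//|/flattenP[t /mapP[b bD ->]]].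
  by have [RR _ _] := repP b ((DP a Ra).1 b bD); apply: RR.
have /choice[con conP] s : exists G, (forall a, a \in s -> R a) ->
    connected_roots form R G /\ {subset s <= G}.
  have [sR|nR] := pselect (forall a, a \in s -> R a); last by exists [::].
  by have [G Gc sG] := connected_cover lars sR; exists G.
have /choice[cc ccP] s : exists c, connected_roots form R s -> consistent (cl s) c.
  have [[sR _]|nR] := pselect (connected_roots form R s); last by exists (fun=> 0).
  by have [c cons] := consistent_exists sR; exists c.
have clS (s t : seq V) : {subset s <= t} -> cl s `<=` cl t.
  by move=> st a [Ra sa]; split=> //; apply: int_spanS sa.
pose c a := cc (con (need a)) a - X (cc (con (need a))) a.
have cE G a d : R a -> connected_roots form R G -> {subset need a <= G} ->
    consistent (cl G) d -> c a = d a - X d a.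
  move=> Ra Gc nG cons; have [DB aD] := DP a Ra.
  have [nc nsub] := conP _ (needR a Ra).
  have [J Jc JP] : exists2 J, connected_roots form R J & {subset con (need a) ++ G <= J}.
    by apply: (connected_cover lars) => x; rewrite mem_cat => /orP[/nc.1|/Gc.1].
  have repN b : b \in D a -> forall x, x \in (rep b).1 -> x \in need a.
    move=> bD x xb; rewrite inE; apply/orP; right; apply/flattenP.
    by exists (rep b).1 => //; apply/mapP; exists b.
  have aN : a \in need a by rewrite inE eqxx.
  have consJ := ccP _ Jc.
  have consJ1 : consistent (cl (con (need a))) (cc J).
    by apply: consistent_sub consJ => //; apply: clS => x xn; apply: JP; rewrite mem_cat xn.
  have consJ2 : consistent (cl G) (cc J).
    by apply: consistent_sub consJ => //; apply: clS => x xn; apply: JP; rewrite mem_cat xn orbT.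
  rewrite /c -(shift (con (need a)) (D a) (cc (con (need a))) (cc J) a) //; last 3 first.
  - by move=> b bD x /(repN b bD)/nsub.
  - exact: nsub.
  - exact: ccP.
  apply: (shift G (D a)) => //; last exact: nG.
  by move=> b bD x /(repN b bD)/nG.
exists c => [a y Ra hy|b Bb Rb].
  (* only finitely many generators intervene *)
  have [s sR hs] : exists2 s : seq V, (forall a, a \in s -> R a)
      & hgen (line_gens [set` s] c) a (0, y).
    elim: {Ra} hy => {a y} [a z [Ra _ ->]|a k z z' _ [s sR hs] _ [t tR ht]
                         |a b z z' _ [s sR hs] _ [t tR ht]].
    - exists [:: a]; first by move=> b; rewrite inE => /eqP->.
      by apply: hgen_gen; split=> //=; rewrite inE.
    - exists (s ++ t); first by move=> b; rewrite mem_cat => /orP[/sR|/tR].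
      by apply: hgen_lin; [apply: hgen_sub hs|apply: hgen_sub ht] => b w [Rb bs ->];
        apply: hgen_gen; split=> //=; rewrite mem_cat bs ?orbT.
    - exists (s ++ t); first by move=> x; rewrite mem_cat => /orP[/sR|/tR].
      by apply: hgen_bracket; [apply: hgen_sub hs|apply: hgen_sub ht] => x w [Rx xs ->];
        apply: hgen_gen; split=> //=; rewrite mem_cat xs ?orbT.
  have [G Gc GP] : exists2 G, connected_roots form R G & {subset flatten [seq need a | a <- s] <= G}.
    apply: (connected_cover lars) => x /flattenP[t /mapP[b /sR Rb ->]]; exact: needR.
  have nG b : b \in s -> {subset need b <= G}.
    by move=> bs x xb; apply: GP; apply/flattenP; exists (need b) => //; apply/mapP; exists b.
  have cons := ccP G Gc.
  have Xadd := (XP (cc G)).1.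
  have cons' : consistent (cl G) (fun a => - X (cc G) a + cc G a).
    apply: consistent_twist => // u v Lu Lv; by rewrite Xadd // opprD.
  apply: (consistent_sub (F := [set` s]) (c := c) _ _ cons' Ra hs) => [b bs|b bs].
    by split; [apply: sR|apply: int_span_gen; apply: (nG b bs); rewrite inE eqxx].
  by rewrite (cE G b (cc G)) //; [rewrite addrC|apply: sR|apply: nG].
rewrite /c (XP _).2 // /th; have [_ _ ->] := repP b Bb; last by [].
by rewrite /= big_seq1 mulr1z subrr.
Qed.

End Consistent.

(** * The graph of the isomorphism *)

Section HomogeneousSums.
Variables (K : fieldType) (g : lieAlgType K) (V : zmodType).
Implicit Types (D : V -> set g).

Inductive hsum D : g -> Prop :=
| hsum0 : hsum D 0
| hsum_cons a w z : D a w -> hsum D z -> hsum D (w + z).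

Lemma hsum_in D a w : D a w -> hsum D w.
Proof. by move=> Dw; rewrite -[w]addr0; apply: hsum_cons Dw (hsum0 D). Qed.

Lemma hsumD D z z' : hsum D z -> hsum D z' -> hsum D (z + z').
Proof.
move=> Dz Dz'; elim: Dz => [|a w {}z Dw _ IH]; first by rewrite add0r.
by rewrite -addrA; apply: hsum_cons Dw IH.
Qed.

Section Hgen.
Variable S : V -> set g.

Lemma hsumZ k z : hsum (hgen S) z -> hsum (hgen S) (k *: z).
Proof.
elim=> [|a w {}z Dw _ IH]; first by rewrite scaler0; apply: hsum0.
by rewrite scalerDr; apply: (hsum_cons (hgenZ k Dw) IH).
Qed.

Lemma hsum_bracket z z' : hsum (hgen S) z -> hsum (hgen S) z' ->
  hsum (hgen S) (bracket z z').
Proof.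
move=> Dz Dz'; elim: Dz => [|a w {}z Dw _ IH]; first by rewrite bracket0l; apply: hsum0.
rewrite bracketDl; apply: hsumD => // {IH}; elim: Dz' => [|b w' {}z' Dw' _ IH].
  by rewrite bracket0r; apply: hsum0.
by rewrite bracketDr; apply: (hsum_cons (hgen_bracket Dw Dw') IH).
Qed.

Lemma hsum_uniqP z : hsum (hgen S) z -> exists (s : seq V) (w : V -> g),
  [/\ uniq s, forall a, a \in s -> hgen S a (w a) & z = \sum_(a <- s) w a].
Proof.
elim=> [|a w {}z Dw _ [s [v [us vD ->]]]].
  by exists [::], (fun=> 0); split=> //; rewrite big_nil.
pose v' b := if b == a then w + (if a \in s then v a else 0) else v b.
have vs : \sum_(b <- s | b != a) v' b = \sum_(b <- s | b != a) v b.
  by apply: eq_bigr => b /negPf ba; rewrite /v' ba.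
have [as_|nas] := boolP (a \in s).
  exists s, v'; split=> // [b bs|].
    rewrite /v'; case: eqP => [->|_]; last exact: vD.
    by rewrite as_; apply: hgenD => //; apply: vD.
  by rewrite !(bigD1_seq a as_ us) /= vs /v' eqxx as_ addrA.
exists (a :: s), v'; split=> [|b|]; first by rewrite /= nas.
  rewrite inE /v'; case: eqP => [->|_] /= bs; last exact: vD.
  by rewrite (negPf nas) addr0.
rewrite big_cons {1}/v' eqxx (negPf nas) addr0; congr (_ + _).
apply: eq_big_seq => b bs; rewrite /v'; case: eqP => // ba. by rewrite -ba bs in nas.
Qed.

End Hgen.
End HomogeneousSums.

Lemma hsum_sub (K : fieldType) (g : lieAlgType K) (V V' : zmodType)
    (D : V -> set g) (D' : V' -> set g) :
  (forall a w, D a w -> hsum D' w) -> forall z, hsum D z -> hsum D' z.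
Proof. by move=> DD' z; elim=> [|a w {}z /DD' Dw _ IH]; [exact: hsum0|exact: hsumD]. Qed.

Section Graph.
Variables (K : fieldType) (K0 : [pchar K] =i pred0).
Variables (V : lmodType rat) (form : V -> V -> rat) (R : set V).
Hypothesis lars : locally_affine_root_system form R.
Local Notation ci := (cartan_int form).

Definition real_gens (g : lieAlgType K) (G : V -> set g) : V -> set g :=
  fun a => [set x | R a /\ G a x].

Variables (g1 g2 : lieAlgType K) (G1 : V -> set g1) (G2 : V -> set g2).
Hypotheses (rg1 : root_graded K0 form R G1) (rg2 : root_graded K0 form R G2).
Variables (h1 : V -> g1) (h2 : V -> g2).
Hypothesis h1P : forall a, R a -> exists e f, root_triple K0 form G1 a e f (h1 a).
Hypothesis h2P : forall a, R a -> exists e f, root_triple K0 form G2 a e f (h2 a).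
Hypothesis coroot_rel : forall s : seq (K * V), (forall p, p \in s -> R p.2) ->
  \sum_(p <- s) p.1 *: h1 p.2 = 0 <-> \sum_(p <- s) p.1 *: h2 p.2 = 0.
Variables (e1 : V -> g1) (e2 : V -> g2).
Hypothesis e1P : forall a, R a -> G1 a (e1 a) /\ e1 a != 0.
Hypothesis e2P : forall a, R a -> G2 a (e2 a) /\ e2 a != 0.
Variables (c : V -> kunit K).
Hypothesis cons : consistent R e1 e2 R c.

Local Notation D := (hgen (line_gens R e1 e2 R c)).
Let DG a z : D a z -> pair_pieces G1 G2 a z.
Proof. exact: (line_gens_graded rg1 rg2 e1P e2P). Qed.

Definition graph_line a : (g1 * g2)%type := (e1 a, kval (c a) *: e2 a).

Lemma graph_line_in a : R a -> D a (graph_line a).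
Proof. by move=> Ra; apply: hgen_gen. Qed.

Lemma graph_real a z : R a -> D a z -> exists k, z = k *: graph_line a.
Proof.
move=> Ra Dz; have [Gz1 Gz2] := DG Dz; have [Ge e0] := e1P Ra.
have [k kE] := rg_line rg1 Ra Ge Gz1 e0; exists k.
have := hgen_lin (- k) (graph_line_in Ra) Dz; set w := (X in D a X).
have wE : w = (0, z.2 - k *: (graph_line a).2).
  by apply/pair_equal_spec; rewrite /= kE scaleNr addNr; split=> //; rewrite scaleNr addrC.
rewrite wE => /(cons Ra)/eqP; rewrite subr_eq0 => /eqP z2.
by case: z kE z2 {Dz w wE Gz1 Gz2} => z1 z2 /= -> ->.
Qed.

Lemma graph_coroot a : R a -> exists m,
  bracket (graph_line a) (graph_line (- a)) = (m *: h1 a, m *: h2 a).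
Proof.
move=> Ra; have [x1 [y1 T1]] := h1P Ra; have [x2 [y2 T2]] := h2P Ra.
have [k1 [k2 [_ kE]]] := opposite_scalars lars rg1 rg2 e1P e2P Ra T1 T2.
by exists k1; have [_ ->] := kE _ _ Ra (rootN lars Ra) cons.
Qed.

(** The pairs of coroots come from brackets of the lines of opposite roots. *)
Lemma graph_zero z : D 0 z -> exists2 s : seq (K * V), (forall p, p \in s -> R p.2) &
  z = (\sum_(p <- s) p.1 *: h1 p.2, \sum_(p <- s) p.1 *: h2 p.2).
Proof.
have pr : forall a w, form a a != 0 -> ~ R a -> pair_pieces G1 G2 a w -> w = 0.
  exact: (pair_root rg1 rg2).
have gens a w : line_gens R e1 e2 R c a w -> R a /\ pair_pieces G1 G2 a w.
  by move=> gw; split; [case: gw|apply: DG; apply: hgen_gen].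
move=> /(hgen_isotropic lars (pair_closed rg1 rg2) pr gens).
rewrite (rform0l lars) => /(_ erefl); elim=> [|k a b x y w Ra Rb ab Dx Dy _ [s sR ->]].
  by exists [::] => //; rewrite !big_nil.
have [l ->] := graph_real Ra Dx; have bE : b = - a by apply/eqP; rewrite -addr_eq0 addrC ab.
rewrite bE in Rb Dy; have [l' ->] := graph_real Rb Dy.
have [m mE] := graph_coroot Ra; rewrite bracketZl bracketZr mE.
exists ((k * (l * (l' * m)), a) :: s).
  by move=> p; rewrite inE => /orP[/eqP->|/sR].
by apply/pair_equal_spec; rewrite !big_cons /= !scalerA; split; congr (_ *: _ + _); ring.
Qed.

(** In the degrees of roots this is consistency; in the other degrees a degenerate
    pair is annihilated by all root vectors, and in degree zero the relations
    between coroots are the same on both sides. *)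
Lemma graph_injr a y : D a (0, y) -> y = 0.
Proof.
move=> Dy; have [_ Gy] := DG Dy.
have [aa|aa] := eqVneq (form a a) 0; last first.
  have [Ra|nRa] := pselect (R a); first exact: cons Ra Dy.
  exact: (rg_root rg2 aa nRa Gy).
have [a0|a0] := eqVneq a 0.
  rewrite a0 in Dy; have [s sR /pair_equal_spec[/esym E1 ->]] := graph_zero Dy.
  exact/(coroot_rel sR).
apply: (rg_radical rg2 a0 aa Gy) => b x Rb Gx.
have [Gb eb0] := e2P Rb; have [k ->] := rg_line rg2 Rb Gb Gx eb0.
have [_ _ Gbr] := rg_closed rg2.
suff E : bracket y (kval (c b) *: e2 b) = 0.
  move: E => /eqP; rewrite !bracketZr scaler_eq0 (negPf (kvalP _)) /= => /eqP->.
  by rewrite scaler0.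
have := hgen_bracket Dy (graph_line_in Rb); set w := (X in D _ X).
have -> : w = (0, bracket y (kval (c b) *: e2 b)).
  by apply/pair_equal_spec; rewrite /= bracket0l.
have [Rab|nRab] := pselect (R (a + b)); first by move/(cons Rab).
move=> /DG[_]; apply: (rg_root rg2) => //.
by rewrite (isotropicD lars) //; apply: (lars_nonisotropic lars).
Qed.

Lemma graph_injl a x : D a (x, 0) -> x = 0.
Proof.
move=> Dx; have [Gx _] := DG Dx.
have real b u : R b -> D b (u, 0) -> u = 0.
  move=> Rb /(graph_real Rb)[k /pair_equal_spec[/= -> /esym/eqP]].
  have [_ e20] := e2P Rb; rewrite !scaler_eq0 (negPf (kvalP _)) (negPf e20) !orbF.
  by move=> /eqP->; rewrite scale0r.
have [aa|aa] := eqVneq (form a a) 0; last first.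
  have [Ra|nRa] := pselect (R a); first exact: real Ra Dx.
  exact: (rg_root rg1 aa nRa Gx).
have [a0|a0] := eqVneq a 0.
  rewrite a0 in Dx; have [s sR /pair_equal_spec[-> /esym E2]] := graph_zero Dx.
  exact/(coroot_rel sR).
apply: (rg_radical rg1 a0 aa Gx) => b y Rb Gy.
have [Gb eb0] := e1P Rb; have [k ->] := rg_line rg1 Rb Gb Gy eb0.
suff E : bracket x (e1 b) = 0 by rewrite bracketZr E scaler0.
have := hgen_bracket Dx (graph_line_in Rb); set w := (X in D _ X).
have -> : w = (bracket x (e1 b), 0) by apply/pair_equal_spec; rewrite /= bracket0l.
have [Rab|nRab] := pselect (R (a + b)); first by move/(real _ _ Rab).
move=> /DG[+ _]; apply: (rg_root rg1) => //.
by rewrite (isotropicD lars) //; apply: (lars_nonisotropic lars).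
Qed.

Let sum_fst (s : seq V) (w : V -> (g1 * g2)%type) : (\sum_(a <- s) w a).1 = \sum_(a <- s) (w a).1.
Proof. by elim/big_rec2: _ => // a u v _ <-. Qed.

Let sum_snd (s : seq V) (w : V -> (g1 * g2)%type) : (\sum_(a <- s) w a).2 = \sum_(a <- s) (w a).2.
Proof. by elim/big_rec2: _ => // a u v _ <-. Qed.

Lemma graph_sum_injr y : hsum D (0, y) -> y = 0.
Proof.
move=> /hsum_uniqP[s [w [us wD E]]].
have E1 : \sum_(a <- s) (w a).1 = 0 by rewrite -sum_fst -E.
have E2 : y = \sum_(a <- s) (w a).2 by rewrite -sum_snd -E.
rewrite E2 big_seq big1 // => a as_; apply: (@graph_injr a).
have w1 : (w a).1 = 0.
  apply: (rg_indep rg1 us _ E1 as_) => b bs; by have [] := DG (wD b bs).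
by rewrite -w1 -surjective_pairing; apply: wD.
Qed.

Lemma graph_sum_injl x : hsum D (x, 0) -> x = 0.
Proof.
move=> /hsum_uniqP[s [w [us wD E]]].
have E1 : x = \sum_(a <- s) (w a).1 by rewrite -sum_fst -E.
have E2 : \sum_(a <- s) (w a).2 = 0 by rewrite -sum_snd -E.
rewrite E1 big_seq big1 // => a as_; apply: (@graph_injl a).
have w2 : (w a).2 = 0.
  apply: (rg_indep rg2 us _ E2 as_) => b bs; by have [] := DG (wD b bs).
by rewrite -w2 -surjective_pairing; apply: wD.
Qed.

Lemma graph_proj a z : D a z -> hgen (real_gens G1) a z.1 /\ hgen (real_gens G2) a z.2.
Proof.
elim=> {a z} [a z [Ra _ ->]|a k z z' _ [IH1 IH2] _ [IH1' IH2']|a b z z' _ [IH1 IH2] _ [IH1' IH2']].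
- split; first by apply: hgen_gen; split=> //; case: (e1P Ra).
  by apply: hgenZ; apply: hgen_gen; split=> //; case: (e2P Ra).
- by split; apply: hgen_lin.
- by split; apply: hgen_bracket.
Qed.

Lemma graph_total1 a x : hgen (real_gens G1) a x -> exists y, D a (x, y).
Proof.
elim=> {a x} [a x [Ra Gx]|a k x x' _ [y Dy] _ [y' Dy']|a b x x' _ [y Dy] _ [y' Dy']].
- have [Ge e0] := e1P Ra; have [k ->] := rg_line rg1 Ra Ge Gx e0.
  by exists (k *: (graph_line a).2); apply: (hgenZ k (graph_line_in Ra)).
- by exists (k *: y + y'); apply: (hgen_lin k Dy Dy').
- by exists (bracket y y'); apply: (hgen_bracket Dy Dy').
Qed.

Lemma graph_total2 a y : hgen (real_gens G2) a y -> exists x, D a (x, y).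
Proof.
elim=> {a y} [a y [Ra Gy]|a k y y' _ [x Dx] _ [x' Dx']|a b y y' _ [x Dx] _ [x' Dx']].
- have [Ge e0] := e2P Ra; have [k ->] := rg_line rg2 Ra Ge Gy e0.
  exists ((k / kval (c a)) *: e1 a); have := hgenZ (k / kval (c a)) (graph_line_in Ra).
  congr (D _ _); apply/pair_equal_spec; split=> //=.
  by rewrite scalerA divfK // kvalP.
- by exists (k *: x + x'); apply: (hgen_lin k Dx Dx').
- by exists (bracket x x'); apply: (hgen_bracket Dx Dx').
Qed.

Lemma graph_sum_proj z : hsum D z ->
  hsum (hgen (real_gens G1)) z.1 /\ hsum (hgen (real_gens G2)) z.2.
Proof.
elim=> [|a w {}z /graph_proj[w1 w2] _ [z1 z2]]; first by split; apply: hsum0.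
by split; [apply: hsum_cons w1 z1 | apply: hsum_cons w2 z2].
Qed.

Lemma graph_sum_total1 x : hsum (hgen (real_gens G1)) x -> exists y, hsum D (x, y).
Proof.
elim=> [|a w {}x /graph_total1[v Dv] _ [y Dy]]; first by exists 0; apply: hsum0.
by exists (v + y); apply: (hsum_cons Dv Dy).
Qed.

Lemma graph_sum_total2 y : hsum (hgen (real_gens G2)) y -> exists x, hsum D (x, y).
Proof.
elim=> [|a w {}y /graph_total2[v Dv] _ [x Dx]]; first by exists 0; apply: hsum0.
by exists (v + x); apply: (hsum_cons Dv Dx).
Qed.

End Graph.

(** * Weights of a split quadratic Lie algebra *)

Section SplitQuadratic.
Variables (K : fieldType) (g : lieAlgType K) (h : submodClosed g).
Variable kappa : g -> g -> K.
Hypothesis sq : split_quadratic h kappa.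
Local Notation W := (dual (submod h)).
Implicit Types (a b : W) (x y z : g) (s t : submod h).

Local Notation ev a t := (\val a t : K).

Lemma weightD a b t : ev (a + b) t = ev a t + ev b t. Proof. by rewrite raddfD. Qed.
Lemma weight0 t : ev (0 : W) t = 0. Proof. by rewrite raddf0. Qed.
Lemma weightZ k a t : ev (k *: a) t = k * ev a t. Proof. by rewrite linearZ. Qed.

Lemma weight_linear a k s t : ev a (k *: s + t) = k * ev a s + ev a t.
Proof. by have := valP a => /asboolP; apply. Qed.

Lemma weight_at0 a : ev a 0 = 0.
Proof.
have := weight_linear a 1 0 0; rewrite scale1r mul1r addr0 => /esym/eqP.
by rewrite -subr_eq0 addrK => /eqP.
Qed.

Lemma weight_atZ a k t : ev a (k *: t) = k * ev a t.
Proof. by have := weight_linear a k t 0; rewrite addr0 weight_at0 addr0. Qed.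

Lemma weight_ext a b : (forall t, ev a t = ev b t) -> a = b.
Proof. by move=> ab; apply/val_inj/funext. Qed.

Lemma weight_neq a b : a != b -> exists t, ev a t != ev b t.
Proof.
move=> /eqP ab; apply: contrapT => nt; apply: ab; apply: weight_ext => t.
by apply/eqP; apply: contraT => tn; case: nt; exists t.
Qed.

Lemma root_space_lin a k x y : root_space a x -> root_space a y -> root_space a (k *: x + y).
Proof.
move=> ax ay t; rewrite bracketDr bracketZr ax ay scalerDr !scalerA.
by rewrite mulrC.
Qed.

Lemma root_space0 a : root_space a 0.
Proof. by move=> t; rewrite bracket0r scaler0. Qed.

Lemma root_spaceZ a k x : root_space a x -> root_space a (k *: x).
Proof. by move=> ax; rewrite -[_ *: _]addr0; apply: root_space_lin => //; apply: root_space0. Qed.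

Lemma root_spaceB a x y : root_space a x -> root_space a y -> root_space a (x - y).
Proof. by move=> ax ay; rewrite addrC -scaleN1r; apply: root_space_lin. Qed.

Lemma root_space_bracket a b x y : root_space a x -> root_space b y ->
  root_space (a + b) (bracket x y).
Proof.
move=> ax by_ t; rewrite bracket_jacobi ax by_ bracketZl bracketZr -scalerDl.
by rewrite weightD.
Qed.

Lemma root_space_indep (r : seq W) (x : W -> g) : uniq r ->
  (forall a, a \in r -> root_space a (x a)) -> \sum_(a <- r) x a = 0 ->
  forall a, a \in r -> x a = 0.
Proof.
elim: r x => // a r IH x /= /andP[nar ur] xr s0.
have xrr b : b \in r -> x b = 0.
  move=> br; have ab : b != a by apply: contraNneq nar => <-.
  have [t tab] := weight_neq ab.
  have /(IH _ ur) : \sum_(b <- r) (ev b t - ev a t) *: x b = 0.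
    have := congr1 (fun z => bracket (\val t) z - ev a t *: z) s0.
    rewrite bracket0r scaler0 subr0 => E; rewrite -[RHS]E.
    rewrite big_cons bracketDr scalerDr (xr a (mem_head _ _)) opprD addrACA subrr add0r.
    rewrite bracket_sumr scaler_sumr -sumrB; apply: eq_big_seq => c cr.
    by rewrite scalerBl xr // inE cr orbT.
  move=> /(_ _ b br) E; have : (ev b t - ev a t) *: x b = 0.
    by apply: E => c cr; apply: root_spaceZ; apply: xr; rewrite inE cr orbT.
  by move/eqP; rewrite scaler_eq0 subr_eq0 (negPf tab) => /eqP.
move=> b; rewrite inE => /orP[/eqP->|]; last exact: xrr.
move: s0; rewrite big_cons big_seq big1 ?addr0 // => c cr; exact: xrr.
Qed.

Let kl := kappa_linear sq.
Let ksym := kappa_sym sq.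

Lemma kappaDl x y z : kappa (x + y) z = kappa x z + kappa y z.
Proof. by have := kl z 1 x y; rewrite scale1r mul1r. Qed.

Lemma kappa0l z : kappa 0 z = 0.
Proof. by apply: (addrI (kappa 0 z)); rewrite -kappaDl !addr0. Qed.

Lemma kappaZl k x z : kappa (k *: x) z = k * kappa x z.
Proof. by have := kl z k x 0; rewrite addr0 kappa0l addr0. Qed.

Lemma kappaDr x y z : kappa z (x + y) = kappa z x + kappa z y.
Proof. by rewrite ksym kappaDl ![kappa _ z]ksym. Qed.

Lemma kappaZr k x z : kappa z (k *: x) = k * kappa z x.
Proof. by rewrite ksym kappaZl ksym. Qed.

Lemma kappa0r z : kappa z 0 = 0.
Proof. by rewrite ksym kappa0l. Qed.

Lemma kappa_sumr (I : Type) (r : seq I) (F : I -> g) z :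
  kappa z (\sum_(i <- r) F i) = \sum_(i <- r) kappa z (F i).
Proof. by elim/big_ind2: _ => [|? ? ? ? <- <-|//]; rewrite ?kappa0r ?kappaDr. Qed.

Lemma kappa_orth a b x y : root_space a x -> root_space b y -> a + b != 0 -> kappa x y = 0.
Proof.
move=> ax by_ /weight_neq[t]; rewrite weight0 weightD => tab.
have E : (ev a t + ev b t) * kappa x y = 0.
  rewrite mulrDl -kappaZl -ax -kappaZr -by_ -(kappa_invariant sq) -kappaDl.
  by rewrite [bracket x _]bracketC subrr kappa0l.
by move/eqP: E; rewrite mulf_eq0 (negPf tab) => /eqP.
Qed.

(** The form pairs a root space with the opposite one only, so its nondegeneracy
    is inherited by this pairing. *)
Lemma kappa_pairing a x : root_space a x -> (forall y, root_space (- a) y -> kappa x y = 0) -> x = 0.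
Proof.
move=> ax xy; apply: (kappa_nondegenerate sq) => y.
have [_ /(_ y)[n [b [z [bz ->]]]]] := quadratic_split sq.
rewrite kappa_sumr big1 // => i _; have [bi|bi] := eqVneq (a + b i) 0.
  by apply: xy; have := bz i; congr (root_space _ _); apply/eqP; rewrite -addr_eq0 addrC bi.
exact: (kappa_orth ax (bz i)).
Qed.

Lemma cartan_root_space x : x \in h -> root_space (0 : W) x.
Proof.
move=> xh t; have [[[ab _] _] _] := (quadratic_split sq, tt).
by rewrite (ab _ _ (valP t) xh) weight0 scale0r.
Qed.

(** An element of weight 0 commutes with the Cartan subalgebra and would enlarge
    it to a larger abelian subalgebra. *)
Lemma weight0_h x : root_space (0 : W) x -> x \in h.
Proof.
move=> x0; have [[ab max] _] := quadratic_split sq.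
pose hx : {pred g} := fun y => `[< exists2 u, u \in h & exists k, y = u + k *: x >].
have hx_closed : submod_closed hx.
  split; first by apply/asboolP; exists 0; [exact: rpred0|exists 0; rewrite scale0r addr0].
  move=> k y z /asboolP[u uh [l ->]] /asboolP[v vh [m ->]]; apply/asboolP.
  exists (k *: u + v); first by rewrite rpredD ?rpredZ.
  by exists (k * l + m); rewrite scalerDr scalerDl scalerA addrACA.
pose HX : submodClosed g := HB.pack hx
  (GRing.isSubmodClosed.Build K g hx (GRing.submod_closed_semi hx_closed)).
apply: (max HX).
- have com u : u \in h -> bracket u x = 0.
    by move=> uh; have := x0 (Submod uh); rewrite weight0 scale0r.
  move=> y z /asboolP[u uh [l ->]] /asboolP[v vh [m ->]].
  rewrite bracketDl !bracketDr !bracketZl !bracketZr (ab _ _ uh vh) (com _ uh).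
  by rewrite [bracket x v]bracketC (com _ vh) bracketxx oppr0 !scaler0 !addr0.
- by move=> y yh; apply/asboolP; exists y => //; exists 0; rewrite scale0r addr0.
- by apply/asboolP; exists 0; [exact: rpred0|exists 1; rewrite scale1r add0r].
Qed.

Lemma h_kappa_inj s t : (forall u : submod h, kappa (\val u) (\val s) = kappa (\val u) (\val t)) -> s = t.
Proof.
move=> st; apply/val_inj/eqP; rewrite -subr_eq0; apply/eqP.
apply: (@kappa_pairing (0 : W)); first by apply: root_spaceB; apply: cartan_root_space; apply: valP.
move=> y; rewrite oppr0 => /weight0_h yh.
rewrite ksym kappaDr -scaleN1r kappaZr mulN1r; apply/eqP; rewrite subr_eq0; apply/eqP.
exact: (st (Submod yh)).
Qed.

(** The relation that [sharp] inverts; unlike [sharp] it has a meaning for every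
    weight. *)
Definition represents a t : Prop := forall s, kappa (\val s) (\val t) = ev a s.

Lemma represents_sharp a t : represents a t -> sharp kappa a = t.
Proof.
move=> at_; have at' : flat kappa t = \val a by apply/funext => s; apply: at_.
have : flat kappa (sharp kappa a) = \val a.
  by apply: (@xgetPex _ 0 [set t | flat kappa t = \val a]); exists t.
rewrite -at' => E; apply: h_kappa_inj => u.
exact: (congr1 (fun f => f u) E).
Qed.

Lemma represents_comb a b k t u : represents a t -> represents b u ->
  represents (k *: a + b) (k *: t + u).
Proof. by move=> at_ bu s; rewrite weightD weightZ linearP kappaDr kappaZr at_ bu. Qed.

Lemma bracket_opposite a x y : root_space a x -> root_space (- a) y ->
  exists2 t : submod h, \val t = bracket x y &
    forall s, kappa (\val s) (\val t) = ev a s * kappa x y.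
Proof.
move=> ax ay; have := root_space_bracket ax ay; rewrite subrr => /weight0_h xyh.
exists (Submod xyh) => //= s.
by rewrite -(kappa_invariant sq) ax kappaZl.
Qed.

Lemma root_represented a x : root_space a x -> x != 0 -> exists t, represents a t.
Proof.
move=> ax x0; have [y ay xy] : exists2 y, root_space (- a) y & kappa x y != 0.
  apply: contrapT => ny; move/eqP: x0; apply; apply: (kappa_pairing ax) => y ay.
  by apply/eqP; apply: contraT => xy; case: ny; exists y.
have [t _ tP] := bracket_opposite ax ay; exists ((kappa x y)^-1 *: t) => s /=.
by rewrite kappaZr tP mulrC mulfK.
Qed.

(** Both sides have the same products with the Cartan subalgebra. *)
Lemma bracket_represented a x y t : represents a t -> root_space a x -> root_space (- a) y ->
  bracket x y = kappa x y *: \val t.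
Proof.
move=> at_ ax ay; have [u <- uP] := bracket_opposite ax ay.
have -> : u = kappa x y *: t by apply: h_kappa_inj => s; rewrite /= kappaZr uP at_ mulrC.
by [].
Qed.

End SplitQuadratic.

(** * The core of a coral locally affine Lie algebra *)

Section CoralCore.
Variables (K : fieldType) (K0 : [pchar K] =i pred0) (g : lieAlgType K).
Variables (h : submodClosed g) (kappa : g -> g -> K).
Hypothesis lea : leala h kappa.
Local Notation W := (dual (submod h)).
Local Notation V := (submod (rootQ K0 h)).
Hypothesis gcore : forall x : g, exists a b, [/\ a \in h, b \in core h & x = a + b].
Variable form : V -> V -> rat.
Hypothesis formE : forall a b, ratr (form a b) = root_form kappa (\val a : W) (\val b : W).
Local Notation R := [set a : V | integrable_roots h (\val a : W)].
Hypothesis lars : locally_affine_root_system form R.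
Local Notation ci := (cartan_int form).
Local Notation sq := (leala_quadratic lea).
Implicit Types (a b : V) (x y z : g) (s t u : submod h).

Definition piece : V -> set g := fun a => root_space (\val a : W).
Local Notation ev a t := (\val (\val a : W) t : K).

Lemma valQ_scale (q : rat) a : \val (q *: a) = (ratr q *: (\val a : W)) :> W.
Proof. by rewrite linearZ. Qed.

Lemma valD a b : \val (a + b) = (\val a : W) + (\val b : W) :> W.
Proof. by rewrite raddfD. Qed.

Lemma valN a : \val (- a) = - (\val a : W) :> W.
Proof. by rewrite raddfN. Qed.

Lemma val0 : \val (0 : V) = 0 :> W.
Proof. by rewrite raddf0. Qed.

Lemma root_represented_exists a : exists t, represents kappa (\val a : W) t.
Proof.
have /asboolP[n [c [v [Rv aE]]]] := valP a.
have H (w : W) : integrable_roots h w -> exists t, represents kappa w t.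
  by move=> [[_ [x x0 wx]] _]; apply: (root_represented sq wx x0).
rewrite aE; elim/big_rec: _ => [|i w _ [t wt]].
  by exists 0 => s; rewrite weight0 raddf0 (kappa0r sq).
have [u vu] := H _ (Rv i); exists (ratr (c i) *: u + t).
exact: (represents_comb sq).
Qed.

Definition dualvec a : submod h := sharp kappa (\val a : W).

Lemma dualvecP a : represents kappa (\val a : W) (dualvec a).
Proof.
have [t at_] := root_represented_exists a; rewrite /dualvec.
by rewrite (represents_sharp sq at_).
Qed.

Lemma form_dualvec a b : ev b (dualvec a) = ratr_char0 K0 (form a b).
Proof. by rewrite -ratr_char0E formE /root_form dualvecP. Qed.

Lemma piece_closed : homogeneous_closed piece.
Proof.
split=> [a|a k x y|a b x y]; first exact: root_space0.
  exact: root_space_lin.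
by rewrite /piece valD; apply: root_space_bracket.
Qed.

Lemma piece_root a x : form a a != 0 -> ~ R a -> piece a x -> x = 0.
Proof.
move=> aa nRa ax; apply: contrapT => /eqP x0; apply: nRa.
apply: (leala_integrable lea); last by rewrite -formE ratr_char0E fmorph_eq0.
split; last by exists x.
apply: contra_neq aa => a0; have -> : a = 0 by apply: val_inj; rewrite a0 val0.
exact: (rform0l lars).
Qed.

Lemma iter_bracketZ k x n y : iter n (bracket (k *: x)) y = k ^+ n *: iter n (bracket x) y.
Proof.
elim: n => [|n IH]; first by rewrite scale1r.
by rewrite !iterS IH bracketZl bracketZr scalerA exprS.
Qed.

(** The coroot 2 t / (a, a), where t is the vector dual to a; dividing in the
    rational numbers gives its weights as Cartan integers. *)
Definition coroot_vec a : submod h := ratr_char0 K0 (2 / form a a) *: dualvec a.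

Lemma coroot_vec_weight a b : R a -> ev b (coroot_vec a) = ratr_char0 K0 (ci b a).
Proof.
move=> Ra; rewrite weight_atZ form_dualvec -rmorphM; congr (ratr_char0 _ _).
by rewrite /cartan_int; ring.
Qed.

Lemma piece_triple a : R a -> exists e f, root_triple K0 form piece a e f (\val (coroot_vec a)).
Proof.
move=> Ra; have [aroot [x [y [ax ay [t tE at0] nx ny]]]] := Ra.
have aa : form a a != 0 by apply: (lars_nonisotropic lars).
have xyE := bracket_represented sq (dualvecP a) ax ay.
have kxy : kappa x y != 0.
  apply: contra_neq at0 => k0; have -> : t = 0.
    by apply: val_inj; rewrite tE xyE k0 scale0r raddf0.
  exact: (weight_at0 (\val a : W)).
pose k := (kappa x y)^-1 * ratr_char0 K0 (2 / form a a).
have hH b z : piece b z -> bracket (\val (coroot_vec a)) z = ratr_char0 K0 (ci b a) *: z.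
  by move=> bz; rewrite bz coroot_vec_weight.
exists x, (k *: y); split=> //.
- by rewrite /piece valN; apply: root_spaceZ.
- by apply: contra_neq kxy => ->; apply: (kappa0l sq).
- split.
  + rewrite bracketZr xyE scalerA /k mulrAC mulVf // mul1r.
    by rewrite /coroot_vec linearZ.
  + by rewrite (hH a) // (ciaa lars Ra) rmorph_nat.
  + rewrite (hH (- a)) ?(ciNl lars) ?(ciaa lars Ra) ?rmorphN ?rmorph_nat //.
    by rewrite /piece valN; apply: root_spaceZ.
  + exact: nx.
  + move=> z; have [n yn] := ny z; exists n.
    by rewrite iter_bracketZ yn scaler0.
Qed.

(** A suitable combination w of e and another vector is orthogonal to f, hence
    commutes with f, whereas the square of f is injective on the weight 2. *)
Lemma piece_line a x y : R a -> piece a x -> piece a y -> x != 0 -> exists k, y = k *: x.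
Proof.
move=> Ra ax ay x0; have [e [f T]] := piece_triple Ra; have [Ge Gf e0 sl H] := T.
have [ef _ _ _ _] := sl.
have main z : piece a z -> exists k, z = k *: e.
  move=> az; rewrite /piece valN in Gf.
  have fz w : piece a w -> bracket f w = - (kappa w f *: \val (dualvec a)).
    by move=> aw; rewrite bracketC (bracket_represented sq (dualvecP a) aw Gf).
  have kef : kappa e f != 0.
    apply: contra_neq e0 => k0; have := H a e Ge; rewrite -ef.
    rewrite (bracket_represented sq (dualvecP a) Ge Gf) k0 scale0r bracket0l.
    move=> /esym/eqP; rewrite (ciaa lars Ra) rmorph_nat scaler_eq0.
    by rewrite (pcharf0P K).1 // => /eqP.
  exists (kappa z f / kappa e f); apply/eqP; rewrite -subr_eq0; apply/eqP.
  set w := z - _; have aw : piece a w by apply: root_spaceB => //; apply: root_spaceZ.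
  apply: (@sl2_inj _ K0 _ e f (\val (coroot_vec a)) w 2) => //.
    by rewrite (H a w aw) (ciaa lars Ra) rmorph_nat.
  rewrite /= (fz w aw) /w -scaleN1r (kappaDl sq) -scaleN1r (kappaZl sq) (kappaZl sq).
  by rewrite divfK // mulN1r subrr scale0r scaler0 bracket0r.
have [k xE] := main x ax; have [l yE] := main y ay.
have k0 : k != 0 by apply: contra_neq x0 => k0; rewrite xE k0 scale0r.
by exists (l / k); rewrite yE xE scalerA divfK.
Qed.

Lemma piece_indep (r : seq V) (x : V -> g) : uniq r ->
  (forall a, a \in r -> piece a (x a)) -> \sum_(a <- r) x a = 0 ->
  forall a, a \in r -> x a = 0.
Proof.
move=> ur xr s0 a ar.
pose inv (w : W) : V := xget 0 [set a : V | \val a = w].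
have invK b : inv (\val b) = b.
  by apply: val_inj; apply: (@xgetPex _ 0 [set a : V | \val a = \val b]); exists b.
have := @root_space_indep _ _ _ [seq (\val b : W) | b <- r] (x \o inv) _ _ _ (\val a).
rewrite /= invK; apply.
- by rewrite map_inj_uniq //; apply: val_inj.
- by move=> w /mapP[b br ->]; rewrite invK; apply: xr.
- by rewrite big_map -[RHS]s0; apply: eq_bigr => b _; rewrite /= invK.
- by apply/mapP; exists a.
Qed.

Local Notation C := (hgen (real_gens R piece)).

Let hsum_pred : {pred g} := fun x => `[< hsum C x >].

Let hsum_pred_closed : submod_closed hsum_pred.
Proof.
split; first by apply/asboolP; apply: hsum0.
move=> k x y /asboolP Cx /asboolP Cy; apply/asboolP.
by apply: hsumD => //; apply: hsumZ.
Qed.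

Let hsum_pred_bracket : {in hsum_pred &, forall x y, bracket x y \in hsum_pred}.
Proof.
by move=> x y /asboolP Cx /asboolP Cy; apply/asboolP; apply: hsum_bracket.
Qed.

Lemma integrable_in_V (w : W) : integrable_roots h w -> exists2 a : V, \val a = w & R a.
Proof.
move=> iw; have wV : (w : dualQ K0 h) \in rootQ K0 h.
  apply/asboolP; exists 1%N, (fun=> 1), (fun=> w); split=> //.
  by rewrite big_ord1 scale1r.
by exists (Submod wV).
Qed.

(** The homogeneous sums form a subalgebra that contains the generators of the core. *)
Lemma core_hsum x : x \in core h -> hsum C x.
Proof.
pose SM : submodClosed g := HB.pack hsum_pred
  (GRing.isSubmodClosed.Build K g hsum_pred (GRing.submod_closed_semi hsum_pred_closed)).
pose LS : lieSubalgClosed g := HB.pack hsum_pred SM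
  (isBracketClosed.Build K g hsum_pred hsum_pred_bracket).
move=> /asboolP/(_ LS) H; apply/asboolP; apply: H => z [w iw [k [y [y' [wy wy' ->]]]]].
have [a aE Ra] := integrable_in_V iw; rewrite -aE in wy wy'.
have RN := rootN lars Ra.
have gy : C a y by apply: hgen_gen.
have gy' v : root_space (- (\val a : W)) v -> C (- a) v.
  by move=> av; apply: hgen_gen; split=> //; rewrite /piece valN.
apply/asboolP; apply: hsumD; last exact: hsum_in (gy' _ wy').
apply: hsumD; last exact: hsum_in gy.
apply: hsumZ; rewrite -aE; pose A := [set t : submod h | ev a t = 2 /\
  \val t \in lin_span [set z : g | exists x y : g,
      [/\ root_space (\val a : W) x, root_space (- (\val a : W)) y & z = bracket x y]]].
have [ex|nex] := pselect (exists t, A t); last first.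
  have -> : coroot (\val a : W) = 0.
    by apply: xgetPN => t At; apply: nex; exists t.
  by rewrite raddf0; apply: hsum0.
have [_ /asboolP[n [c [v [vP ->]]]]] : A (coroot (\val a : W)) by apply: xgetPex ex.
elim/big_rec: _ => [|i w' _ Cw]; first exact: hsum0.
apply: hsumD => //; apply: hsumZ; have [u [u' [au au' ->]]] := vP i.
have gu : C a u by apply: hgen_gen.
exact: hsum_in (hgen_bracket gu (gy' _ au')).
Qed.

Lemma hsum_core x : hsum C x -> x \in core h.
Proof.
have gens a y : real_gens R piece a y -> y \in core h.
  move=> [Ra ay]; apply/asboolP => S; apply; exists (\val a : W) => //.
  exists 0, y, 0; split=> //; first exact: root_space0.
  by rewrite scale0r add0r addr0.
elim=> [|a y {}x Cy _ IH]; first exact: rpred0.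
apply: rpredD => // {IH}; elim: Cy => {a x y} [a y|a k y y' _ IH _ IH'|a b y y' _ IH _ IH'].
- exact: gens.
- by rewrite rpredD ?rpredZ.
- exact: bracket_closed.
Qed.

(** Since the algebra is spanned by the Cartan subalgebra and the core, all root
    spaces lie in the core. *)
Lemma root_space_core (w : W) x : w != 0 -> root_space w x -> x != 0 ->
  exists2 a : V, \val a = w & C a x.
Proof.
move=> w0 wx x0; have [u [v [uh vc xE]]] := gcore x.
have [s [f [us fC vE]]] := hsum_uniqP (core_hsum vc).
have fG a : a \in s -> piece a (f a).
  move=> as_; apply: (hgen_min piece_closed _ (fC a as_)).
  by move=> b y [].
pose inv (w : W) : V := xget 0 [set a : V | \val a = w].
have invK b : inv (\val b) = b.
  by apply: val_inj; apply: (@xgetPex _ 0 [set a : V | \val a = \val b]); exists b.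
pose L := [seq (\val a : W) | a <- s].
pose F (b : W) := (if b == w then x else 0) - (if b == 0 then u else 0)
  - (if b \in L then f (inv b) else 0).
pose U := undup [:: w, 0 & L].
have uU : uniq U by apply: undup_uniq.
have pick (c : W) (y : g) : c \in U -> \sum_(b <- U) (if b == c then y else 0) = y.
  move=> cU; rewrite (bigD1_seq c) //= eqxx big1 ?addr0 // => b /negPf->.
  by [].
have FU (b : W) : b \in U -> root_space b (F b).
  move=> _; apply: root_spaceB; first apply: root_spaceB.
  - by case: eqP => [->|_] //; apply: root_space0.
  - by case: eqP => [->|_]; [apply: (cartan_root_space sq)|apply: root_space0].
  - by case: ifP => [/mapP[a as_ ->]|_]; [rewrite invK; apply: fG|apply: root_space0].
have wU : w \in U by rewrite mem_undup inE eqxx.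
have FS : \sum_(b <- U) F b = 0.
  rewrite sumrB sumrB !pick // ?mem_undup ?inE ?eqxx ?orbT //.
  have -> : \sum_(b <- U) (if b \in L then f (inv b) else 0) = v.
    have uL : uniq L by rewrite map_inj_uniq //; apply: val_inj.
    have -> : v = \sum_(b <- L) f (inv b).
      by rewrite big_map vE; apply: eq_bigr => a _; rewrite invK.
    rewrite -big_mkcond -big_filter; apply: perm_big; apply: uniq_perm => //.
      exact: filter_uniq.
    move=> b; rewrite mem_filter mem_undup !inE; case: (b \in L) => //=.
    by rewrite !orbT.
  by rewrite xE [u + v]addrC addrK subrr.
have := root_space_indep uU FU FS wU; rewrite /F eqxx (negPf w0) subr0.
case: ifP => [/mapP[a as_ wE]|_]; last by move/eqP; rewrite subr0 (negPf x0).
rewrite wE invK => /eqP; rewrite subr_eq0 => /eqP ->; exists a => //.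
exact: fC.
Qed.

(** The opposite root space lies in the core and its degree is isotropic, so it
    consists of sums of brackets of real root vectors; by invariance y is
    orthogonal to it. *)
Lemma piece_radical a y : a != 0 -> form a a = 0 -> piece a y ->
  (forall b x, R b -> piece b x -> bracket y x = 0) -> y = 0.
Proof.
move=> a0 aa ay yx; apply: (kappa_pairing sq ay) => z az.
have [->|z0] := eqVneq z 0; first exact: (kappa0r sq).
have [|b bE Cz] := @root_space_core (- (\val a : W)) z _ az z0.
  by rewrite -valN; apply: contra_neq a0 => E; apply: oppr_inj; rewrite oppr0;
    apply: val_inj; rewrite E val0.
have bb : b = - a by apply: val_inj; rewrite bE valN.
rewrite bb in Cz; have aaN : form (- a) (- a) = 0.
  by rewrite (rformNl lars) (rformNr lars) opprK.
have gens c w : real_gens R piece c w -> R c /\ piece c w by [].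
elim: (hgen_isotropic lars piece_closed piece_root gens Cz aaN) => [|k c d v w z' Rc Rd cd Cv Cw _ IH].
  exact: (kappa0r sq).
rewrite (kappaDr sq) (kappaZr sq) IH addr0 -(kappa_invariant sq) (yx c v Rc) ?(kappa0l sq) ?mulr0 //.
by apply: (hgen_min piece_closed _ Cv) => e y' [].
Qed.

Lemma piece_root_graded : root_graded K0 form R piece.
Proof.
split.
- exact: piece_closed.
- exact: piece_root.
- by move=> a /piece_triple[e [f T]]; exists e, f, (\val (coroot_vec a)).
- exact: piece_line.
- exact: piece_radical.
- exact: piece_indep.
Qed.

End CoralCore.

(** * Comparing two forms on a root system *)

Section TwoForms.
Variables (V : lmodType rat) (f1 f2 : V -> V -> rat) (R : set V).
Hypotheses (l1 : locally_affine_root_system f1 R) (l2 : locally_affine_root_system f2 R).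
Implicit Types a b x : V.

Let ci_bound f a b : locally_affine_root_system f R -> R a -> R b -> `|cartan_int f a b| <= 4.
Proof.
move=> l Ra Rb; rewrite -(czE l (int_span_gen Ra) Rb) -intr_norm.
by rewrite (_ : 4 = 4%:~R) // ler_int; apply: (cz_bound l).
Qed.

(** The Cartan integers depend on the roots only: two reflections in the same
    root compose to a transvection, of infinite order unless they agree, whereas
    the Cartan integers are bounded. *)
Lemma cartan_int_unique a x : R a -> cartan_int f1 x a = cartan_int f2 x a.
Proof.
move=> Ra; have main b : R b -> cartan_int f1 b a = cartan_int f2 b a.
  move=> Rb; set u1 := cartan_int f1 b a; set u2 := cartan_int f2 b a.
  pose u := u1 - u2.
  have E1 q : cartan_int f1 (b + q *: a) a = u1 + q * 2.
    by rewrite (ciDl l1) (ciZl l1) (ciaa l1 Ra).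
  have E2 q : cartan_int f2 (b + q *: a) a = u2 + q * 2.
    by rewrite (ciDl l2) (ciZl l2) (ciaa l2 Ra).
  have Rn (n : nat) : R (b + (n%:R * u) *: a).
    elim: n => [|n IH]; first by rewrite mul0r scale0r addr0.
    have S1 := lars_reflection l1 Ra IH; rewrite E1 -addrA -scalerBl in S1.
    have := lars_reflection l2 Ra S1; rewrite E2 -addrA -scalerBl; congr (R (b + _ *: a)).
    by rewrite /u -[n.+1]addn1 natrD; ring.
  have b1 := ci_bound l1 Rb Ra; have b5 := ci_bound l1 (Rn 5) Ra.
  rewrite E1 in b5; rewrite -/u1 in b1.
  have [z1 z1E] := lars_integral l1 Ra Rb; have [z2 z2E] := lars_integral l2 Ra Rb.
  rewrite -/u1 in z1E; rewrite -/u2 in z2E.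
  apply/eqP; rewrite -subr_eq0 -/u; apply: contraT => u0.
  have uz : u = (z1 - z2)%:~R by rewrite /u z1E z2E rmorphB.
  have [ub|ub] : 1 <= u \/ u <= -1.
    rewrite uz intr_eq0 in u0 *.
    have [zb|zb] : 1 <= z1 - z2 \/ z1 - z2 <= -1 by lia.
      by left; rewrite (_ : 1 = 1%:~R) // ler_int.
    by right; rewrite (_ : -1 = (-1)%:~R) // ler_int.
  - by move: b1 b5; rewrite !ler_norml => /andP[? ?] /andP[? ?]; lra.
  - by move: b1 b5; rewrite !ler_norml => /andP[? ?] /andP[? ?]; lra.
have /asboolP[n [c [v [Rv ->]]]] := lars_span l1 x.
elim/big_rec: _ => [|i y _ IH].
  by rewrite (isotropic_ci0 l1) ?(rform0l l1) // (isotropic_ci0 l2) ?(rform0l l2).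
by rewrite (ciDl l1) (ciDl l2) (ciZl l1) (ciZl l2) IH main.
Qed.

Lemma isotropic_unique x : (f1 x x == 0) = (f2 x x == 0).
Proof.
have dir (f f' : V -> V -> rat) : locally_affine_root_system f R -> locally_affine_root_system f' R ->
    (forall a x, R a -> cartan_int f x a = cartan_int f' x a) -> f x x = 0 -> f' x x = 0.
  move=> l l' ff xx; apply: (rform_ext l') => a Ra.
  have := isotropic_ci0 l a xx; rewrite ff // => /eqP.
  by rewrite (ci_eq0 l') // (form_sym l') => /eqP.
apply/eqP/eqP; first exact: (dir f1 f2 l1 l2 cartan_int_unique).
by apply: (dir f2 f1 l2 l1) => a y Ra; rewrite cartan_int_unique.
Qed.

(** For nonorthogonal roots the ratio of the lengths is the ratio of the Cartan
    integers; irreducibility propagates the factor. *)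
Lemma norm_proportional : exists2 c : rat, c != 0 & forall a, R a -> f2 a a = c * f1 a a.
Proof.
have [[a0 Ra0]|nR] := pselect (exists a, R a); last first.
  by exists 1 => // a Ra; case: nR; exists a.
have n0 a : R a -> f1 a a != 0 /\ f2 a a != 0.
  by move=> Ra; split; [apply: (lars_nonisotropic l1)|apply: (lars_nonisotropic l2)].
have [m1 m2] := n0 _ Ra0; pose c := f2 a0 a0 / f1 a0 a0.
pose R1 := [set a | R a /\ f2 a a = c * f1 a a].
have step a b : R a -> R b -> f1 a b != 0 -> f2 a a = c * f1 a a -> f2 b b = c * f1 b b.
  move=> Ra Rb ab E; have [na1 na2] := n0 _ Ra; have [nb1 nb2] := n0 _ Rb.
  have H1 := cartan_int_unique b Ra; have H2 := cartan_int_unique a Rb.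
  have nab : cartan_int f1 a b != 0 by rewrite (ci_eq0 l1).
  have P1 : cartan_int f1 b a * f1 a a = cartan_int f1 a b * f1 b b.
    by rewrite !ciE [f1 b a](form_sym l1) !divfK.
  have P2 : cartan_int f1 b a * f2 a a = cartan_int f1 a b * f2 b b.
    by rewrite H1 H2 !ciE [f2 b a](form_sym l2) !divfK.
  by apply: (mulfI nab); rewrite -P2 E mulrCA P1 mulrCA.
have [|a b [Ra Ea] [Rb nb]|R10|R20] := @lars_irreducible _ _ _ l1 R1 (R `\` R1).
- apply/seteqP; split=> a; last by case=> [[]|[]].
  by move=> Ra; have [?|?] := pselect (R1 a); [left|right].
- apply/eqP; apply: contraT => ab; case: nb; split=> //; exact: step Ra Rb ab Ea.
- have : R1 a0 by split=> //; rewrite /c divfK.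
  by rewrite R10.
- exists c; first by rewrite mulf_neq0 // invr_neq0.
  move=> a Ra; apply: contrapT => na; suff : (R `\` R1) a by rewrite R20.
  by split=> // -[].
Qed.

End TwoForms.

Section Pullback.
Variables (V1 V2 : lmodType rat) (psi : {linear V1 -> V2}) (psi_bij : bijective psi).
Variables (form : V2 -> V2 -> rat) (R1 : set V1) (R2 : set V2).
Hypothesis psiR : forall a, R1 a <-> R2 (psi a).
Hypothesis lars : locally_affine_root_system form R2.

Lemma pullback_root_system : locally_affine_root_system (fun a b => form (psi a) (psi b)) R1.
Proof.
have [inv psiK invK] := psi_bij.
have R2inv b : R2 b -> R1 (inv b) by move=> Rb; apply/psiR; rewrite invK.
split.
- by move=> y k x z /=; rewrite linearP (form_linear lars).
- by move=> x y; apply: (form_sym lars).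
- by move=> x; apply: (form_psd lars).
- by move=> a /psiR; apply: (lars_nonisotropic lars).
- move=> v; have /asboolP[n [c [w [Rw E]]]] := lars_span lars (psi v).
  apply/asboolP; exists n, c, (inv \o w); split=> [i|]; first exact: R2inv.
  apply: (can_inj psiK); rewrite E linear_sum; apply: eq_bigr => i _.
  by rewrite linearZ /= invK.
- by move=> a b /psiR Ra /psiR Rb; apply: (lars_integral lars Ra Rb).
- move=> a b /psiR Ra /psiR Rb; apply/psiR; rewrite linearB linearZ /=.
  exact: (lars_reflection lars Ra Rb).
- move=> A B AB orth; have im (C : set V1) : psi @` C = set0 -> C = set0.
    move=> C0; apply/seteqP; split=> // x Cx; suff : (psi @` C) (psi x) by rewrite C0.
    by exists x.
  have [|x y [a Aa <-] [b Bb <-]|A0|B0] := @lars_irreducible _ _ _ lars (psi @` A) (psi @` B).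
  + apply/seteqP; split=> [b Rb|_ [[a Aa <-]|[a Aa <-]]]; last 2 first.
    * by apply/psiR; rewrite AB; left.
    * by apply/psiR; rewrite AB; right.
    have := R2inv b Rb; rewrite AB => -[Ab|Bb]; [left|right]; exists (inv b) => //; exact: invK.
  + exact: orth.
  + by left; apply: im.
  + by right; apply: im.
- have [d d0 dE] := lars_affine lars.
  have span a : int_span R1 a <-> int_span R2 (psi a).
    split=> [[n [z [v [Rv ->]]]]|[n [z [v [Rv E]]]]].
      exists n, z, (psi \o v); split=> [i|]; first exact/psiR.
      by rewrite raddf_sum; apply: eq_bigr => i _; rewrite raddfMz.
    exists n, z, (inv \o v); split=> [i|]; first exact: R2inv.
    apply: (can_inj psiK); rewrite E raddf_sum; apply: eq_bigr => i _.
    by rewrite raddfMz /= invK.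
  exists (inv d); first by apply: contra_neq d0 => E; rewrite -[d]invK E raddf0.
  have setE x : (form_radical form `&` int_span R2) x <-> exists z : int, x = d *~ z.
    by rewrite dE.
  apply/seteqP; split=> [x [rx Lx]|x [z ->]].
    have [|z E] := (setE (psi x)).1.
      by split; [move=> w; rewrite -[w]invK; apply: rx|apply/span].
    by exists z; apply: (can_inj psiK); rewrite E raddfMz /= invK.
  have [|r L] := (setE (psi (inv d *~ z))).2.
    by exists z; rewrite raddfMz /= invK.
  by split; [move=> w; apply: r|apply/span].
Qed.

End Pullback.

Section TransferGraded.
Variables (K : fieldType) (K0 : [pchar K] =i pred0).
Variables (V1 V2 : lmodType rat) (psi : {linear V1 -> V2}) (psi_bij : bijective psi).
Variables (f1 : V1 -> V1 -> rat) (f2 : V2 -> V2 -> rat) (R1 : set V1) (R2 : set V2).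
Hypothesis psiR : forall a, R1 a <-> R2 (psi a).
Hypotheses (l1 : locally_affine_root_system f1 R1) (l2 : locally_affine_root_system f2 R2).
Variables (g : lieAlgType K) (G : V2 -> set g).
Hypothesis rg : root_graded K0 f2 R2 G.

Let l12 := pullback_root_system psi_bij psiR l2.

Lemma pullback_triple a e f h : R1 a -> root_triple K0 f2 G (psi a) e f h ->
  root_triple K0 f1 (G \o psi) a e f h.
Proof.
move=> Ra [Ge Gf e0 sl H]; split=> //; first by rewrite /= raddfN.
by move=> b x Gx; rewrite (H _ x Gx) (cartan_int_unique l1 l12).
Qed.

Lemma pullback_graded : root_graded K0 f1 R1 (G \o psi).
Proof.
have [G0 Gl Gb] := rg_closed rg; have inj := bij_inj psi_bij.
split.
- split=> [a|a k x y|a b x y]; [exact: G0|exact: Gl|].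
  by rewrite /= raddfD; apply: Gb.
- move=> a x aa nRa; apply: (rg_root rg).
    by move: aa; rewrite (isotropic_unique l1 l12).
  by move=> /psiR.
- move=> a Ra; have [e [f [h T]]] := rg_triple rg ((psiR a).1 Ra).
  by exists e, f, h; apply: pullback_triple.
- by move=> a x y /psiR; apply: (rg_line rg).
- move=> a y a0 /eqP aa Gy yx; apply: (rg_radical rg (a := psi a)) => //.
  + by apply: contra_neq a0 => E; apply: inj; rewrite E raddf0.
  + by apply/eqP; rewrite (isotropic_unique l1 l12) in aa.
  + have [inv psiK invK] := psi_bij.
    move=> b x Rb Gx; apply: (yx (inv b)); rewrite /= ?invK //.
    by apply/psiR; rewrite invK.
- move=> s x us Gx s0 a as_; have [inv psiK invK] := psi_bij.
  have := @rg_indep _ _ _ _ _ _ _ rg [seq psi b | b <- s] (x \o inv) _ _ _ (psi a).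
  rewrite /= psiK; apply.
  + by rewrite map_inj_uniq.
  + by move=> w /mapP[b bs ->]; rewrite psiK; apply: Gx.
  + by rewrite big_map -[RHS]s0; apply: eq_bigr => b _; rewrite /= psiK.
  + by apply/mapP; exists a.
Qed.

End TransferGraded.

(** * Linear relations between roots over the base field *)

Section Relations.
Variables (K : fieldType) (K0 : [pchar K] =i pred0).

(** The K-span of the rational linear relations between the vectors. *)
Definition rational_relation (V : lmodType rat) n (k : 'I_n -> K) (a : 'I_n -> V) : Prop :=
  exists m (u : 'I_m -> K) (q : 'I_m -> 'I_n -> rat),
    (forall l, \sum_i q l i *: a i = 0) /\
    (forall i, k i = \sum_l u l * ratr_char0 K0 (q l i)).

Variables (V : lmodType rat) (form : V -> V -> rat) (R : set V).
Hypothesis lars : locally_affine_root_system form R.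

(** Every vector has a nonzero multiple in the root lattice, and the isotropic elements of
    the lattice form a cyclic group. *)
Lemma isotropic_line : exists2 d : V, d != 0 &
  forall v, form v v = 0 -> exists q : rat, v = q *: d.
Proof.
have [d [d0 Ld dd dP]] := exists_delta lars; exists d => // v vv.
have gL := int_span_subgroup R.
have [N N0 LN] : exists2 N : int, N != 0 & int_span R (v *~ N).
  have /asboolP[n [c [w [Rw ->]]]] := lars_span lars v.
  elim/big_rec: _ => [|i y _ [N N0 LN]]; first by exists 1; rewrite // mul0rz; apply: (subgroup0 gL).
  exists (denq (c i) * N); first by rewrite mulf_neq0 // denq_eq0.
  rewrite mulrzDl; apply: (subgroupD gL); last first.
    by rewrite mulrC mulrzA; apply: (subgroupMz gL).
  rewrite -scaler_int scalerA rmorphM /= mulrAC [_ * c i]mulrC -numqE -rmorphM /= scaler_int.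
  by apply: (subgroupMz gL); apply: int_span_gen.
have [|z E] := dP _ LN; first by rewrite (rformMzl lars) (isotropic_radical lars) // mul0rz.
exists (z%:~R / N%:~R); have N0' : N%:~R != 0 :> rat by rewrite intr_eq0.
by rewrite mulrC -scalerA scaler_int -E -scaler_int scalerA mulVf // scale1r.
Qed.

(** The Gram matrix has rational entries, so the K-linear relations between the
    vectors modulo the radical are spanned by rational ones; the radical being a
    line, one of these corrects the others to genuine relations. *)
Lemma relation_rational (W : lmodType K) (iota : V -> W) n (k : 'I_n -> K) (a : 'I_n -> V)
    (pair : V -> W -> K) :
  (forall q x y, iota (q *: x + y) = ratr_char0 K0 q *: iota x + iota y) ->
  injective iota ->
  (forall b, scalar (pair b)) ->
  (forall x b, pair b (iota x) = ratr_char0 K0 (form x b)) ->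
  \sum_i k i *: iota (a i) = 0 <-> rational_relation k a.
Proof.
move=> iota_lin iota_inj pair_lin pairE.
have iota0 : iota 0 = 0.
  have := iota_lin 1 0 0; rewrite rmorph1 !scale1r addr0 => /esym/eqP.
  by rewrite -subr_eq0 addrK => /eqP.
have iotaS m (q : 'I_m -> rat) (b : 'I_m -> V) :
    iota (\sum_i q i *: b i) = \sum_i ratr_char0 K0 (q i) *: iota (b i).
  elim/big_rec2: _ => // i y1 y2 _ <-; exact: iota_lin.
have pair0 b : pair b 0 = 0.
  have := pair_lin b 1 0 0; rewrite scale1r mul1r addr0 => /esym/eqP.
  by rewrite -subr_eq0 addrK => /eqP.
have pairS b (u : 'I_n -> K) (w : 'I_n -> W) : pair b (\sum_i u i *: w i) = \sum_i u i * pair b (w i).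
  elim/big_rec2: _ => // i y1 y2 _ <-; exact: pair_lin.
split=> [k0|[m [u [q [qa kE]]]]]; last first.
  under eq_bigr do rewrite kE scaler_suml.
  rewrite exchange_big big1 // => l _ /=.
  transitivity (u l *: iota (\sum_i q l i *: a i)); last by rewrite qa iota0 scaler0.
  by rewrite iotaS scaler_sumr; apply: eq_bigr => i _; rewrite scalerA.
pose M : 'M[rat]_n := \matrix_(i, j) form (a i) (a j).
pose kr : 'rV[K]_n := \row_i k i.
have kM : kr *m map_mx (ratr_char0 K0) M = 0.
  apply/rowP => j; rewrite !mxE; have := congr1 (pair (a j)) k0; rewrite pairS pair0 => E; rewrite -[RHS]E.
  by apply: eq_bigr => i _; rewrite !mxE pairE.
have /submxP[u uE] : (kr <= map_mx (ratr_char0 K0) (kermx M))%MS.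
  by rewrite map_kermx; apply/sub_kermxP.
pose v (l : 'I_n) := \sum_i kermx M l i *: a i.
have vv l : form (v l) (v l) = 0.
  have va j : form (v l) (a j) = 0.
    have := congr1 (fun A : 'M_n => A l j) (mulmx_ker M); rewrite !mxE => E.
    rewrite /v (rform_suml lars) -[RHS]E; apply: eq_bigr => i _.
    by rewrite (rformZl lars) ?mxE.
  rewrite {2}/v (form_sym lars) (rform_suml lars) big1 // => i _.
  by rewrite (rformZl lars) (form_sym lars) va mulr0.
have [d d0 dP] := isotropic_line.
have /choice[r rE] l : exists q : rat, v l = q *: d by apply: dP.
have kE i : k i = \sum_l u 0 l * ratr_char0 K0 (kermx M l i).
  by have := congr1 (fun A : 'rV_n => A 0 i) uE; rewrite !mxE => ->; apply: eq_bigr => l _; rewrite ?mxE.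
have id0 : iota d != 0 by apply: contra_neq d0 => E; apply: iota_inj; rewrite E iota0.
have iv l : iota (v l) = ratr_char0 K0 (r l) *: iota d.
  by rewrite rE; have := iota_lin (r l) d 0; rewrite addr0 iota0 addr0.
have ur : \sum_l u 0 l * ratr_char0 K0 (r l) = 0.
  apply/eqP; suff : (\sum_l u 0 l * ratr_char0 K0 (r l)) *: iota d == 0.
    by rewrite scaler_eq0 (negPf id0) orbF.
  apply/eqP; rewrite -[RHS]k0 scaler_suml.
  under eq_bigr do rewrite -scalerA -iv /v iotaS scaler_sumr.
  rewrite exchange_big; apply: eq_bigr => i _ /=.
  by rewrite kE scaler_suml; apply: eq_bigr => l _; rewrite scalerA.
have [[l0 rl0]|nr] := pselect (exists l, r l != 0); last first.
  exists n, (u 0), (fun l i => kermx M l i); split=> // l.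
  rewrite -/(v l) rE; have -> : r l = 0 by apply/eqP; apply: contraT => rl; case: nr; exists l.
  by rewrite scale0r.
exists n, (u 0), (fun l i => kermx M l i - r l / r l0 * kermx M l0 i); split=> [l|i].
  under eq_bigr do rewrite scalerBl -scalerA.
  rewrite sumrB -scaler_sumr -/(v l) -/(v l0) !rE scalerA divfK // subrr.
  by [].
rewrite kE; apply/eqP; rewrite -subr_eq0 -sumrB.
apply/eqP; transitivity ((\sum_l u 0 l * ratr_char0 K0 (r l)) * ratr_char0 K0 (kermx M l0 i / r l0)).
  rewrite mulr_suml; apply: eq_bigr => l _; rewrite -mulrBr -rmorphB -[RHS]mulrA -rmorphM.
  by congr (_ * ratr_char0 _ _); rewrite opprB addrC subrK; ring.
by rewrite ur mul0r.
Qed.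

End Relations.

Section CorootRelation.
Variables (K : fieldType) (K0 : [pchar K] =i pred0).

Lemma rational_relation_scale (V : lmodType rat) n (k k' : 'I_n -> K) (a : 'I_n -> V) l :
  (forall i, k' i = l * k i) -> rational_relation K0 k a -> rational_relation K0 k' a.
Proof.
move=> kk [m [u [q [qa kE]]]]; exists m, (fun j => l * u j), q; split=> // i.
by rewrite kk kE mulr_sumr; apply: eq_bigr => j _; rewrite mulrA.
Qed.

Lemma rational_relation_map (V1 V2 : lmodType rat) (psi : {linear V1 -> V2}) n
    (k : 'I_n -> K) (a : 'I_n -> V1) : injective psi ->
  rational_relation K0 k a <-> rational_relation K0 k (psi \o a).
Proof.
move=> inj; split=> -[m [u [q [qa kE]]]]; exists m, u, q; split=> // l.
  under eq_bigr do rewrite /= -linearZ.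
  by rewrite -linear_sum qa linear0.
apply: inj; rewrite linear_sum linear0 -[RHS](qa l).
by apply: eq_bigr => i _; rewrite linearZ.
Qed.

Variables (g : lieAlgType K) (h : submodClosed g) (kappa : g -> g -> K).
Hypothesis lea : leala h kappa.
Local Notation W := (dual (submod h)).
Local Notation V := (submod (rootQ K0 h)).
Variable form : V -> V -> rat.
Hypothesis formE : forall a b, ratr (form a b) = root_form kappa (\val a : W) (\val b : W).
Local Notation R := [set a : V | integrable_roots h (\val a : W)].
Hypothesis lars : locally_affine_root_system form R.

(** Coroots are rational multiples of the vectors dual to the roots, and duality
    is injective, so the claim follows from [relation_rational]. *)
Lemma coroot_relation n (k : 'I_n -> K) (a : 'I_n -> V) :
  \sum_i k i *: \val (coroot_vec kappa form (a i)) = 0 :> g <->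
  rational_relation K0 (fun i => k i * ratr_char0 K0 (2 / form (a i) (a i))) a.
Proof.
have sq := leala_quadratic lea.
pose k' i := k i * ratr_char0 K0 (2 / form (a i) (a i)).
pose t : submod h := \sum_i k' i *: dualvec kappa (a i).
have tE : \sum_i k i *: \val (coroot_vec kappa form (a i)) = \val t :> g.
  rewrite /t linear_sum; apply: eq_bigr => i _; rewrite /coroot_vec !linearZ /=.
  by rewrite scalerA mulrC.
pose w : W := \sum_i k' i *: (\val (a i) : W).
have tw : represents kappa w t.
  rewrite /t /w; elim/big_rec2: _ => [s|i y1 y2 _ IH]; first by rewrite weight0 raddf0 (kappa0r sq).
  by apply: (represents_comb sq) => //; apply: (dualvecP lea).
have rel := @relation_rational K K0 V form R lars W (fun b => \val b) n k' a
  (fun b v => \val v (dualvec kappa b)).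
rewrite tE; apply: iff_trans (rel _ _ _ _).
- split=> [t0|w0].
    apply: weight_ext => s; rewrite weight0 -(tw s).
    have -> : t = 0 by apply: val_inj; rewrite t0 raddf0.
    by rewrite raddf0 (kappa0r sq).
  have -> : t = 0.
    apply: (h_kappa_inj sq) => s; rewrite tw -/w.
    have -> : w = 0 by exact: w0.
    by rewrite weight0 raddf0 (kappa0r sq).
  by rewrite raddf0.
- by move=> q x y; rewrite valD valQ_scale.
- exact: val_inj.
- by move=> b l v v'; rewrite weightD weightZ.
- by move=> x b; rewrite (form_dualvec lea formE) (form_sym lars).
Qed.

End CorootRelation.

(** * The isomorphism of cores *)

Section CoreIsomorphism.
Variables (K : fieldType) (K0 : [pchar K] =i pred0).
Variables (g1 g2 : lieAlgType K) (h1 : submodClosed g1) (h2 : submodClosed g2).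
Variables (kappa1 : g1 -> g1 -> K) (kappa2 : g2 -> g2 -> K).
Hypotheses (lea1 : leala h1 kappa1) (lea2 : leala h2 kappa2).
Hypothesis gcore1 : forall x : g1, exists a b, [/\ a \in h1, b \in core h1 & x = a + b].
Hypothesis gcore2 : forall x : g2, exists a b, [/\ a \in h2, b \in core h2 & x = a + b].
Local Notation W1 := (dual (submod h1)).
Local Notation W2 := (dual (submod h2)).
Local Notation V1 := (submod (rootQ K0 h1)).
Local Notation V2 := (submod (rootQ K0 h2)).
Variables (form1 : V1 -> V1 -> rat) (form2 : V2 -> V2 -> rat).
Hypothesis form1E : forall a b, ratr (form1 a b) = root_form kappa1 (\val a : W1) (\val b : W1).
Hypothesis form2E : forall a b, ratr (form2 a b) = root_form kappa2 (\val a : W2) (\val b : W2).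
Local Notation R1 := [set a : V1 | integrable_roots h1 (\val a : W1)].
Local Notation R2 := [set a : V2 | integrable_roots h2 (\val a : W2)].
Hypothesis lars1 : locally_affine_root_system form1 R1.
Hypothesis lars2 : locally_affine_root_system form2 R2.
Variable psi : {linear V1 -> V2}.
Hypothesis psi_bij : bijective psi.
Hypothesis psiR : forall a, R1 a <-> R2 (psi a).

Local Notation G1 := (@piece K K0 g1 h1).
Local Notation G2 := (@piece K K0 g2 h2).
Local Notation G2' := (G2 \o psi).
Local Notation C1 := (hgen (real_gens R1 G1)).
Local Notation C2 := (hgen (real_gens R1 G2')).

Let psi_inj : injective psi. Proof. exact: bij_inj. Qed.
Let rg1 : root_graded K0 form1 R1 G1.
Proof. exact: (piece_root_graded lea1 gcore1 form1E lars1). Qed.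
Let rg2 : root_graded K0 form1 R1 G2'.
Proof.
apply: (pullback_graded psi_bij psiR lars1 lars2).
exact: (piece_root_graded lea2 gcore2 form2E lars2).
Qed.

Let cr1 a : g1 := \val (coroot_vec kappa1 form1 a).
Let cr2 a : g2 := \val (coroot_vec kappa2 form2 (psi a)).

Let cr1P a : R1 a -> exists e f, root_triple K0 form1 G1 a e f (cr1 a).
Proof. exact: (piece_triple lea1 form1E lars1). Qed.

Let cr2P a : R1 a -> exists e f, root_triple K0 form1 G2' a e f (cr2 a).
Proof.
move=> Ra; have [e [f T]] := piece_triple lea2 form2E lars2 ((psiR a).1 Ra).
by exists e, f; apply: (pullback_triple psi_bij psiR lars1 lars2 Ra T).
Qed.

(** The lengths of corresponding roots are proportional, so both sides are
    governed by the same rational relations. *)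
Let cr_rel (s : seq (K * V1)) : (forall p, p \in s -> R1 p.2) ->
  \sum_(p <- s) p.1 *: cr1 p.2 = 0 <-> \sum_(p <- s) p.1 *: cr2 p.2 = 0.
Proof.
move=> sR; have [c c0 cE] := norm_proportional lars1 (pullback_root_system psi_bij psiR lars2).
rewrite [X in X = 0 <-> _]big_tnth [X in _ <-> X = 0]big_tnth; pose k i := (tnth (in_tuple s) i).1; pose a i := (tnth (in_tuple s) i).2.
have Ra i : R1 (a i) by apply: sR; apply: mem_tnth.
apply: (iff_trans (coroot_relation lea1 form1E lars1 k a)).
apply: iff_sym; apply: (iff_trans (coroot_relation lea2 form2E lars2 k (psi \o a))).
apply: (iff_trans (iff_sym (rational_relation_map K0 _ a psi_inj))).
have n1 i : form1 (a i) (a i) != 0 by apply: (lars_nonisotropic lars1).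
have E i : k i * ratr_char0 K0 (2 / form2 (psi (a i)) (psi (a i))) =
    ratr_char0 K0 c^-1 * (k i * ratr_char0 K0 (2 / form1 (a i) (a i))).
  rewrite (cE _ (Ra i)) [RHS]mulrCA -rmorphM; congr (_ * ratr_char0 _ _).
  by rewrite invfM mulrCA.
split; last by apply: rational_relation_scale => i; apply: E.
apply: (rational_relation_scale (l := ratr_char0 K0 c)) => i.
by rewrite /= E mulrA -rmorphM divff // rmorph1 mul1r.
Qed.

Let core1_hsum x : x \in core h1 <-> hsum C1 x.
Proof.
split; first exact: (core_hsum lars1).
exact: hsum_core.
Qed.

Let pull a x : C2 a x <-> hgen (real_gens R2 G2) (psi a) x.
Proof.
have [inv psiK invK] := psi_bij; split.
  elim=> {a x} [a x [Ra Gx]|a k x y _ IH _ IH'|a b x y _ IH _ IH'].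
  - by apply: hgen_gen; split=> //; apply/psiR.
  - exact: hgen_lin.
  - by rewrite raddfD; apply: hgen_bracket.
rewrite -{2}[a]psiK; elim=> {a x} [a x [Ra Gx]|a k x y _ IH _ IH'|a b x y _ IH _ IH'].
- apply: hgen_gen; split; last by rewrite /= invK.
  by apply: (psiR (inv a)).2; rewrite invK.
- exact: hgen_lin.
- have -> : inv (a + b) = inv a + inv b.
    by apply: psi_inj; rewrite invK [RHS]raddfD /= !invK.
  exact: hgen_bracket.
Qed.

Let core2_hsum y : y \in core h2 <-> hsum C2 y.
Proof.
have [inv psiK invK] := psi_bij; split=> [/(core_hsum lars2)|Cy].
  by apply: hsum_sub => a w Cw; apply: (@hsum_in _ _ _ _ (inv a)); apply/pull; rewrite invK.
apply: hsum_core; apply: hsum_sub Cy => a w /pull; exact: hsum_in.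
Qed.

Let root1 a x : a != 0 -> G1 a x -> x != 0 -> C1 a x.
Proof.
move=> a0 ax x0; have [|b bE Cb] := root_space_core lea1 gcore1 lars1 _ ax x0.
  by apply: contra_neq a0 => E; apply: val_inj; rewrite E val0.
by have <- : b = a by apply: val_inj.
Qed.

Let root2 a y : a != 0 -> G2' a y -> y != 0 -> C2 a y.
Proof.
move=> a0 ay y0; have [|b bE Cb] := root_space_core lea2 gcore2 lars2 _ ay y0.
  apply: contra_neq a0 => E; apply: psi_inj; rewrite raddf0; apply: val_inj.
  by rewrite E val0.
by apply/pull; have <- : b = psi a by apply: val_inj.
Qed.

Section FromScalars.
Variables (e1 : V1 -> g1) (e2 : V1 -> g2).
Hypothesis e1P : forall a, R1 a -> G1 a (e1 a) /\ e1 a != 0.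
Hypothesis e2P : forall a, R1 a -> G2' a (e2 a) /\ e2 a != 0.
Variables (c : V1 -> kunit K).
Hypothesis cons : consistent R1 e1 e2 R1 c.
Local Notation D := (hgen (line_gens R1 e1 e2 R1 c)).

Let Dr y : hsum D (0, y) -> y = 0.
Proof. exact: (graph_sum_injr lars1 rg1 rg2 cr1P cr2P cr_rel e1P e2P cons). Qed.

Let Dl x : hsum D (x, 0) -> x = 0.
Proof. exact: (graph_sum_injl lars1 rg1 rg2 cr1P cr2P cr_rel e1P e2P cons). Qed.

Let hsumB z z' : hsum D z -> hsum D z' -> hsum D (z - z').
Proof. by move=> Dz Dz'; apply: hsumD => //; rewrite -scaleN1r; apply: hsumZ. Qed.

Let Dfun x y y' : hsum D (x, y) -> hsum D (x, y') -> y = y'.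
Proof.
move=> Dy Dy'; apply/eqP; rewrite -subr_eq0; apply/eqP; apply: Dr.
have := hsumB Dy Dy'; congr hsum; apply/pair_equal_spec; split=> //; exact: subrr.
Qed.

Let Dinj x x' y : hsum D (x, y) -> hsum D (x', y) -> x = x'.
Proof.
move=> Dx Dx'; apply/eqP; rewrite -subr_eq0; apply/eqP; apply: Dl.
have := hsumB Dx Dx'; congr hsum; apply/pair_equal_spec; split=> //; exact: subrr.
Qed.

Let proj z : hsum D z -> z.1 \in core h1 /\ z.2 \in core h2.
Proof. by move=> /(graph_sum_proj e1P e2P)[z1 z2]; split; [apply/core1_hsum|apply/core2_hsum]. Qed.

(** Homogeneous sums in D are the graph of a bijection between the cores; it maps
    root spaces to root spaces because D is graded. *)
Lemma core_iso_exists : exists2 phi : submod (core h1) -> submod (core h2),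
  core_iso_along psi phi & forall z, hsum D z -> sub_maps phi z.1 z.2.
Proof.
have /choice[phi phiP] (x : submod (core h1)) : exists y : submod (core h2), hsum D (\val x, \val y).
  have [y Dy] := graph_sum_total1 rg1 e2 e1P c ((core1_hsum _).1 (valP x)).
  by have [_ yc] := proj Dy; exists (Submod yc).
have /choice[rho rhoP] (y : submod (core h2)) : exists x : submod (core h1), hsum D (\val x, \val y).
  have [x Dx] := graph_sum_total2 rg2 e1 e2P c ((core2_hsum _).1 (valP y)).
  by have [xc _] := proj Dx; exists (Submod xc).
have maps z : hsum D z -> sub_maps phi z.1 z.2.
  move=> Dz; have [z1 z2] := proj Dz; exists (Submod z1); split=> //=.
  by apply: Dfun (phiP _) _; rewrite /= -surjective_pairing.
exists phi => //; split; first split.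
- move=> k x x'; apply: val_inj; apply: Dfun (phiP _) _.
  have := hsumD (hsumZ k (phiP x)) (phiP x'); congr hsum.
- move=> x x'; apply: val_inj; apply: Dfun (phiP _) _.
  exact: hsum_bracket (phiP x) (phiP x').
- exists rho => [x|y]; apply: val_inj.
    exact: Dinj (rhoP _) (phiP _).
  exact: Dfun (phiP _) (rhoP _).
move=> a [a0 _]; have a0' : a != 0 by apply: contra_neq a0 => ->; rewrite val0.
have lines b z : D b z -> pair_pieces G1 G2' b z := @line_gens_graded _ _ _ _ _ _ _ _ _ rg1 rg2 _ _ e1P e2P _ _ _ _.
split=> [x ax|].
  have [->|x0] := eqVneq x 0; first exact: rpred0.
  by apply/core1_hsum; apply: hsum_in (root1 a0' ax x0).
apply/seteqP; split=> [y [x ax [x' [x'E <-]]]|y ay].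
  have [x0|x0] := eqVneq x 0.
    have -> : \val (phi x') = 0.
      by apply: Dr; have := phiP x'; rewrite x'E x0.
    exact: root_space0.
  have [y' Dy'] := graph_total1 rg1 e2 e1P c (root1 a0' ax x0).
  have -> : \val (phi x') = y'.
    by apply: Dfun (phiP x') _; rewrite x'E; apply: hsum_in Dy'.
  by have [] := lines _ _ Dy'.
have [->|y0] := eqVneq y 0.
  exists 0; first exact: root_space0.
  have := maps 0 (hsum0 D); by [].
have [x Dx] := graph_total2 rg2 e1 e2P c (root2 a0' ay y0).
exists x; first by have [] := lines _ _ Dx.
exact: maps (hsum_in Dx).
Qed.

(** A nonzero vector of a root space has a nonzero partner in D. *)
Lemma roots_correspond : sub_image psi (root_set h1) (root_set h2).
Proof.
have [inv psiK invK] := psi_bij.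
have inV (w : W1) : root_set h1 w -> exists2 a : V1, \val a = w & a != 0 /\ exists2 x, x != 0 & C1 a x.
  move=> [w0 [x x0 wx]]; have [a aE Cx] := root_space_core lea1 gcore1 lars1 w0 wx x0.
  exists a => //; split; last by exists x.
  by apply: contra_neq w0 => a0; rewrite -aE a0 val0.
have lines b z : D b z -> pair_pieces G1 G2' b z := @line_gens_graded _ _ _ _ _ _ _ _ _ rg1 rg2 _ _ e1P e2P _ _ _ _.
split=> [w /inV[a <- _]|]; first exact: valP.
apply/seteqP; split=> [w' [w /inV[a aE [a0 [x x0 Cx]]] [b [bE <-]]]|w' [w0 [y y0 wy]]].
  have <- : a = b by apply: val_inj; rewrite aE bE.
  split.
    apply: contra_neq a0 => E; apply: psi_inj; rewrite raddf0; apply: val_inj.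
    by rewrite E val0.
  have [y Dy] := graph_total1 rg1 e2 e1P c Cx.
  exists y; last by have [] := lines _ _ Dy.
  by apply: contra_neq x0 => y0; apply: Dl; rewrite y0 in Dy; apply: hsum_in Dy.
have [b bE Cy] := root_space_core lea2 gcore2 lars2 w0 wy y0.
have Cy' : C2 (inv b) y by apply/pull; rewrite invK.
have [x Dx] := graph_total2 rg2 e1 e2P c Cy'.
exists (\val (inv b)); last by exists (inv b); rewrite invK.
split.
  apply: contra_neq w0 => E; have : inv b = 0 by apply: val_inj; rewrite E val0.
  by move=> /(congr1 psi); rewrite invK raddf0 -bE => ->; rewrite val0.
exists x; last by have [] := lines _ _ Dx.
by apply: contra_neq y0 => x0; apply: Dr; rewrite x0 in Dx; apply: hsum_in Dx.
Qed.

End FromScalars.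

(** The scalars are read off from the images of the root vectors; the graph of the
    isomorphism contains the algebra that they generate. *)
Lemma core_iso_scalars (phi : submod (core h1) -> submod (core h2)) (e1 : V1 -> g1) (e2 : V1 -> g2) :
  (forall a, R1 a -> G1 a (e1 a) /\ e1 a != 0) ->
  (forall a, R1 a -> G2' a (e2 a) /\ e2 a != 0) ->
  core_iso_along psi phi ->
  exists c, [/\ consistent R1 e1 e2 R1 c,
    forall z, hsum (hgen (line_gens R1 e1 e2 R1 c)) z -> sub_maps phi z.1 z.2
    & forall a, R1 a -> sub_maps phi (e1 a) (kval (c a) *: e2 a)].
Proof.
move=> e1P e2P [[lin br bij] im].
have phi0 : phi 0 = 0.
  have := lin 1 0 0; rewrite !scale1r addr0 => /esym/eqP.
  by rewrite -subr_eq0 addrK => /eqP.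
have /choice[c cP] a : exists k : kunit K, R1 a -> sub_maps phi (e1 a) (kval k *: e2 a).
  have [Ra|nR] := pselect (R1 a); last by exists 0.
  have [Ge1 e10] := e1P a Ra; have [Ge2 e20] := e2P a Ra.
  have [incore imE] := im a Ra.1.
  pose x : submod (core h1) := Submod (incore _ Ge1).
  have Gy : G2' a (\val (phi x)).
    suff : [set y | exists2 x, root_space (\val a : W1) x & sub_maps phi x y] (\val (phi x)).
      by rewrite imE.
    by exists (e1 a) => //; exists x.
  have [k kE] := rg_line rg2 Ra Ge2 Gy e20.
  have k0 : k != 0.
    apply: contra_neq e10 => k0; have : phi x = phi 0.
      by rewrite phi0; apply: val_inj; rewrite kE k0 scale0r raddf0.
    by move=> /(bij_inj bij)/(congr1 \val); rewrite raddf0.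
  by exists (KUnit k0) => _; exists x.
have maps a z : hgen (line_gens R1 e1 e2 R1 c) a z -> sub_maps phi z.1 z.2.
  elim=> {a z} [a z [Ra _ ->]|a k z z' _ [x [xE yE]] _ [x' [xE' yE']]
               |a b z z' _ [x [xE yE]] _ [x' [xE' yE']]].
  - exact: cP.
  - exists (k *: x + x'); rewrite lin !linearP /= xE xE' yE yE'.
    by split.
  - exists (bracket x x'); rewrite br /= xE xE' yE yE'; by split.
exists c; split=> // [a y Ra /maps[x [x0 yE]]|z].
  have x00 : x = 0 by apply: val_inj; rewrite x0 raddf0.
  by have -> : y = \val (phi x); [rewrite yE|rewrite x00 phi0 raddf0].
elim=> [|a w {}z /maps[x [xE yE]] _ [x' [xE' yE']]].
  by exists 0; rewrite phi0 !raddf0.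
exists (x + x'); have -> : phi (x + x') = phi x + phi x'.
  by have := lin 1 x x'; rewrite !scale1r.
by rewrite !raddfD /= xE xE' yE yE'.
Qed.

(** The ratio is a character that is trivial on the basis. *)
Lemma consistent_unique (B : set V1) (e1 : V1 -> g1) (e2 : V1 -> g2) c c' :
  (forall a, R1 a -> G1 a (e1 a) /\ e1 a != 0) ->
  (forall a, R1 a -> G2' a (e2 a) /\ e2 a != 0) ->
  zbasis B (int_span R1) -> B `<=` R1 ->
  consistent R1 e1 e2 R1 c -> consistent R1 e1 e2 R1 c' ->
  (forall b, B b -> c b = c' b) -> forall a, R1 a -> c a = c' a.
Proof.
move=> e1P e2P [BL Bind Bspan] BR cons cons' cc' a Ra.
have [s [k [us sB aE]]] := int_span_uniqP (Bspan a (int_span_gen Ra)).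
have [G Gc sG] : exists2 G, connected_roots form1 R1 G & {subset a :: s <= G}.
  apply: (connected_cover lars1) => b; rewrite inE => /orP[/eqP->//|/sB/BR].
  by [].
have sub d : consistent R1 e1 e2 R1 d -> consistent R1 e1 e2 (closure_roots R1 G) d.
  by apply: consistent_sub => // b [].
have [chi chiadd chiE] := consistent_ratio lars1 rg1 rg2 e1P e2P Gc (sub c cons) (sub c' cons').
have clG b : b \in a :: s -> closure_roots R1 G b.
  by move=> /sG bG; split; [apply: Gc.1|apply: int_span_gen].
have gs := int_span_subgroup [set` s].
have aS : int_span [set` s] a.
  by rewrite aE; apply: (subgroup_sum gs) => b bs; apply: (subgroupMz gs); apply: int_span_gen.
have chia : chi a = 0.
  apply: (@additive_on_eq _ _ [set` s] chi (fun=> 0) _ _ _ a aS).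
  - apply: additive_on_sub chiadd; apply: int_spanS => b /= bs; apply: sG.
    by rewrite inE bs orbT.
  - by move=> x y _ _; rewrite addr0.
  - move=> b /= bs; have := chiE b (clG b _); rewrite inE bs orbT => /(_ isT) E.
    by apply: (addIr (c b)); rewrite -E add0r cc' //; apply: sB.
by rewrite chiE ?chia ?add0r //; apply: clG; rewrite inE eqxx.
Qed.

End CoreIsomorphism.

Theorem theorem3p12 (K : fieldType) (K0 : [pchar K] =i pred0)
    (g1 g2 : lieAlgType K) (h1 : submodClosed g1) (h2 : submodClosed g2)
    (kappa1 : g1 -> g1 -> K) (kappa2 : g2 -> g2 -> K)
    (coral1 : coral_locally_affine K0 h1 kappa1)
    (coral2 : coral_locally_affine K0 h2 kappa2)
    (psi : {linear submod (rootQ K0 h1) -> submod (rootQ K0 h2)})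
    (psi_bij : bijective psi)
    (psi_roots : sub_image psi (integrable_roots h1) (integrable_roots h2)) :
  [/\ sub_image psi (root_set h1) (root_set h2),
      exists phi : submod (core h1) -> submod (core h2),
        core_iso_along psi phi
    & forall (B : set (dualQ K0 h1)) (x : dualQ K0 h1 -> g1)
             (y : dualQ K0 h1 -> g2),
        integral_base B ->
        (forall a : submod (rootQ K0 h1), B (\val a) ->
          [/\ x (\val a) != 0, root_space (\val a) (x (\val a)),
              y (\val a) != 0 & root_space (\val (psi a)) (y (\val a))]) ->
        exists! phi : submod (core h1) -> submod (core h2),
          core_iso_along psi phi /\
          forall a, B a -> sub_maps phi (x a) (y a)].
Proof.
have [lea1 gcore1 [form1 form1E lars1] _] := coral1.
have [lea2 gcore2 [form2 form2E lars2] _] := coral2.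
pose R1 : set (submod (rootQ K0 h1)) := [set a : submod (rootQ K0 h1) | integrable_roots h1 (\val a : dual (submod h1))].
pose R2 : set (submod (rootQ K0 h2)) := [set a : submod (rootQ K0 h2) | integrable_roots h2 (\val a : dual (submod h2))].
have psiR a : R1 a <-> R2 (psi a).
  have [_ imE] := psi_roots; split=> [Ra|Rpa].
    suff : [set y | exists2 x, integrable_roots h1 x & sub_maps psi x y] (\val (psi a)).
      by rewrite imE.
    by exists (\val a) => //; exists a.
  have : [set y | exists2 x, integrable_roots h1 x & sub_maps psi x y] (\val (psi a)).
    by rewrite imE.
  move=> [w iw [b [bE /val_inj/(bij_inj psi_bij) ba]]].
  by rewrite /R1 /= -ba bE.
have rg1 := piece_root_graded lea1 gcore1 form1E lars1.
have rg2 := pullback_graded psi_bij psiR lars1 lars2 (piece_root_graded lea2 gcore2 form2E lars2).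
(* reference root vectors in both algebras *)
have ref1 a : exists z, R1 a -> piece a z /\ z != 0.
  have [Ra|nR] := pselect (R1 a); last by exists 0.
  by have [e [f [h [Ge _ e0 _ _]]]] := rg_triple rg1 Ra; exists e.
have ref2 a : exists z, R1 a -> piece (psi a) z /\ z != 0.
  have [Ra|nR] := pselect (R1 a); last by exists 0.
  by have [e [f [h [Ge _ e0 _ _]]]] := rg_triple rg2 Ra; exists e.
have [E1 E1P] := choice ref1; have [E2 E2P] := choice ref2.
split.
- have [B Bb _] := root_lattice_basis lars1.
  have [c cons _] := consistent_global lars1 rg1 rg2 E1P E2P Bb.
  exact: (roots_correspond lea1 lea2 gcore1 gcore2 form1E form2E lars1 lars2 psi_bij psiR E1P E2P cons).
- have [B Bb _] := root_lattice_basis lars1.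
  have [c cons _] := consistent_global lars1 rg1 rg2 E1P E2P Bb.
  have [phi phiP _] := core_iso_exists lea1 lea2 gcore1 gcore2 form1E form2E lars1 lars2 psi_bij psiR E1P E2P cons.
  by exists phi.
move=> B x y [BR Bind Bspan] xy.
pose BV : set (submod (rootQ K0 h1)) := [set a : submod (rootQ K0 h1) | B (\val a)].
have BVR : BV `<=` R1 by move=> a /BR.
have Bin b : B b -> exists2 a : submod (rootQ K0 h1), \val a = b & BV a.
  move=> Bb; have [a aE _] := integrable_in_V K0 (BR b Bb).
  by exists a => //; rewrite /BV /= aE.
(* rational independence restricts to integral independence *)
have BVb : zbasis BV (int_span R1).
  split=> [a /BVR|s c us sB s0 b bs|].
  - exact: int_span_gen.
  - have bi : (index b s < size s)%N by rewrite index_mem.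
    have := Bind (size s) (fun i => \val (tnth (in_tuple s) i) : dualQ K0 h1)
      (fun i => (c (tnth (in_tuple s) i))%:~R) _ _ _ (Ordinal bi).
    rewrite (tnth_nth 0) /= nth_index // => H; apply/eqP.
    rewrite -(intr_eq0 rat); apply/eqP; apply: H.
    + move=> i j ij; have : tnth (in_tuple s) i = tnth (in_tuple s) j by apply: val_inj.
      by rewrite !(tnth_nth 0) /= => /eqP; rewrite nth_uniq // => /eqP/ord_inj.
    + by move=> i; apply: sB; apply: mem_tnth.
    + have <- : \val (\sum_(i < size s) tnth (in_tuple s) i *~ c (tnth (in_tuple s) i)) =
          \sum_(i < size s) (c (tnth (in_tuple s) i))%:~R *:
            (\val (tnth (in_tuple s) i) : dualQ K0 h1).
        rewrite linear_sum; apply: eq_bigr => i _.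
        by rewrite -scaler_int linearZ.
      have := s0; rewrite big_tnth => ->.
      exact: raddf0.
  - apply: int_span_min => [|a Ra]; first exact: int_span_subgroup.
    have [n [z [v [Bv aE]]]] := Bspan _ Ra.1.
    have /choice[w wP] i : exists b : submod (rootQ K0 h1), \val b = v i /\ BV b.
      by have [b bE Bb] := Bin _ (Bv i); exists b.
    exists n, z, w; split=> [i|]; first by have [] := wP i.
    apply: val_inj; rewrite aE raddf_sum; apply: eq_bigr => i _.
    by have [<- _] := wP i; rewrite raddfMz.
(* with the prescribed vectors as reference vectors on the base, the condition on
   the isomorphism is that its scalars be trivial there *)
pose e1 a := if pselect (BV a) is left _ then x (\val a) else E1 a.
pose e2 a := if pselect (BV a) is left _ then y (\val a) else E2 a.
have e1P a : R1 a -> piece a (e1 a) /\ e1 a != 0.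
  move=> Ra; rewrite /e1; case: pselect => [Ba|_]; last exact: E1P.
  by have [x0 xa _ _] := xy a Ba.
have e2P a : R1 a -> piece (psi a) (e2 a) /\ e2 a != 0.
  move=> Ra; rewrite /e2; case: pselect => [Ba|_]; last exact: E2P.
  by have [_ _ y0 ya] := xy a Ba.
have e1B a : BV a -> e1 a = x (\val a) by rewrite /e1; case: pselect.
have e2B a : BV a -> e2 a = y (\val a) by rewrite /e2; case: pselect.
have [c cons c0] := consistent_global lars1 rg1 rg2 e1P e2P BVb.
have [phi phiP phiD] := core_iso_exists lea1 lea2 gcore1 gcore2 form1E form2E lars1 lars2 psi_bij psiR e1P e2P cons.
exists phi; split.
  split=> // _ /Bin[b <- Bb].
  have := phiD (e1 b, kval (c b) *: e2 b); rewrite /= c0 ?kval0 ?scale1r ?e1B ?e2B //; last exact: BVR.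
  apply; apply: (@hsum_in _ _ _ _ b); apply: hgen_gen; split=> //; try exact: BVR.
  by rewrite c0 ?kval0 ?scale1r ?e1B ?e2B //; apply: BVR.
move=> phi' [iso' xy'].
have [c' [cons' phiD' phiL']] := core_iso_scalars lea2 gcore2 form2E lars1 lars2 psi_bij psiR e1P e2P iso'.
have cc' : forall a, R1 a -> c a = c' a.
  apply: (consistent_unique lea1 lea2 gcore1 gcore2 form1E form2E lars1 lars2 psi_bij psiR e1P e2P BVb BVR cons cons').
  move=> b Bb; have Rb := BVR _ Bb; rewrite c0 //.
  have [u [uE vE]] := phiL' b Rb; have [u' [uE' vE']] := xy' _ Bb.
  have uu : u = u' by apply: val_inj; rewrite uE uE' e1B.
  apply/kval_inj; rewrite kval0; move: vE; rewrite uu vE' e2B // => /eqP.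
  have [_ e20] := e2P b Rb; rewrite e2B // in e20.
  rewrite -subr_eq0 -{1}[y _]scale1r -scalerBl scaler_eq0 (negPf e20) orbF subr_eq0.
  by move=> /eqP.
(* both maps have a graph that contains the algebra generated by the same lines *)
apply/funext => u; apply: val_inj.
have [v Dv] : exists v, hsum (hgen (line_gens R1 e1 e2 R1 c)) (\val u, v).
  apply: (graph_sum_total1 rg1 e2 e1P c); apply: (core_hsum lars1); exact: valP.
have Dv' : hsum (hgen (line_gens R1 e1 e2 R1 c')) (\val u, v).
  apply: hsum_sub Dv => a w Dw; apply: (@hsum_in _ _ _ _ a).
  apply: hgen_sub Dw => b z [Rb _ ->]; apply: hgen_gen; split=> //.
  by rewrite cc'.
have [w [wE wv]] := phiD _ Dv; have [w' [wE' wv']] := phiD' _ Dv'.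
have -> : u = w by apply: val_inj; rewrite wE.
by rewrite wv; have -> : w = w' by apply: val_inj; rewrite wE wE'.
Qed.
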